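(* Assume that $\dfrac{2\|\boldsymbol\beta\|_{\infty,\Omega}^2}{\nu\sigma}<1$ and let $k\ge0$ be an integer. Then there exists a unique $(\boldsymbol u_h,\boldsymbol\omega_h)\in\mathrm X_h\times\mathrm Z_h$ such that $$a(\boldsymbol u_h,\boldsymbol v_h)+b_1(\boldsymbol v_h,\boldsymbol\omega_h)+c(\boldsymbol\omega_h,\boldsymbol v_h)=F(\boldsymbol v_h)\quad\forall\boldsymbol v_h\in\mathrm X_h,\qquad b_1(\boldsymbol u_h,\boldsymbol\theta_h)-d(\boldsymbol\omega_h,\boldsymbol\theta_h)=G(\boldsymbol\theta_h)\quad\forall\boldsymbol\theta_h\in\mathrm Z_h.$$ Moreover, there exist constants $\hat C_1,\hat C_2>0$ independent of $h$ (and of the data $\boldsymbol f,p_\Sigma,\boldsymbol u_\Sigma$) such that $$\|\boldsymbol u_h\|_{\mathrm H}+\|\boldsymbol\omega_h\|_{\mathrm Z}\le\hat C_1\left(\|\boldsymbol f\|_{0,\Omega}+\|p_\Sigma\|_{1/2,\Sigma}+\|\boldsymbol u_\Sigma\|_{-1/2,\Sigma}\right)$$ and $$\|\boldsymbol u-\boldsymbol u_h\|_{\mathrm H}+\|\boldsymbol\omega-\boldsymbol\omega_h\|_{\mathrm Z}\le\hat C_2\inf_{(\boldsymbol v_h,\boldsymbol\theta_h)\in\mathrm X_h\times\mathrm Z_h}\left(\|\boldsymbol u-\boldsymbol v_h\|_{\mathrm H}+\|\boldsymbol\omega-\boldsymbol\theta_h\|_{\mathrm Z}\right),$$ where $(\boldsymbol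 u,\boldsymbol\omega)\in\mathrm X\times\mathrm Z$ is the unique solution of $$a(\boldsymbol u,\boldsymbol v)+b_1(\boldsymbol v,\boldsymbol\omega)+c(\boldsymbol\omega,\boldsymbol v)=F(\boldsymbol v)\quad\forall\boldsymbol v\in\mathrm X,\qquad b_1(\boldsymbol u,\boldsymbol\theta)-d(\boldsymbol\omega,\boldsymbol\theta)=G(\boldsymbol\theta)\quad\forall\boldsymbol\theta\in\mathrm Z.$$
   Context: $\Omega\subset\mathbb R^3$ is a bounded polyhedral domain with Lipschitz boundary $\partial\Omega$, with a disjoint partition $\partial\Omega=\Gamma\cup\Sigma$; $\boldsymbol n$ is the outward unit normal. $\nu>0$ and $\sigma>0$ are constants, $\boldsymbol\beta\in L^\infty(\Omega)^3$ (with usual norm $\|\cdot\|_{\infty,\Omega}$), $\boldsymbol f\in L^2(\Omega)^3$. $\|\cdot\|_{s,\Omega}$ is the norm of $H^s(\Omega)$ or $H^s(\Omega)^3$, with $H^0=L^2$. Spaces: $\mathrm H:=\{\boldsymbol v\in H(\mathrm{div};\Omega):\boldsymbol v\cdot\boldsymbol n=0\text{ on }\Gamma\}$ with the natural norm $\|\boldsymbol v\|_{\mathrm H}^2=\|\boldsymbol v\|_{0,\Omega}^2+\|\mathrm{div}\,\boldsymbol v\|_{0,\Omega}^2$; $\mathrm Z:=\{\boldsymbol\theta\in H(\mathbf{curl};\Omega):\boldsymbol\theta\times\boldsymbol n=\boldsymbol 0\text{ on }\Gamma\}$ with the norm $\|\boldsymbol\theta\|_{\mathrm Z}^2=\|\boldsymbol\theta\|_{0,\Omega}^2+\nu\|\mathbf{curl}\,\boldsymbol\theta\|_{0,\Omega}^2$;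 $\mathrm X:=\{\boldsymbol v\in\mathrm H:\mathrm{div}\,\boldsymbol v=0\text{ in }\Omega\}$. Forms: $a(\boldsymbol u,\boldsymbol v)=\sigma\int_\Omega\boldsymbol u\cdot\boldsymbol v$, $b_1(\boldsymbol v,\boldsymbol\theta)=\sqrt\nu\int_\Omega\mathbf{curl}\,\boldsymbol\theta\cdot\boldsymbol v$, $d(\boldsymbol\omega,\boldsymbol\theta)=\int_\Omega\boldsymbol\omega\cdot\boldsymbol\theta$, $c(\boldsymbol\theta,\boldsymbol v)=\nu^{-1/2}\int_\Omega(\boldsymbol\theta\times\boldsymbol\beta)\cdot\boldsymbol v$, $F(\boldsymbol v)=\int_\Omega\boldsymbol f\cdot\boldsymbol v-\langle\boldsymbol v\cdot\boldsymbol n,p_\Sigma\rangle_\Sigma$, $G(\boldsymbol\theta)=-\sqrt\nu\langle\boldsymbol u_\Sigma,\boldsymbol\theta\rangle_\Sigma$. Boundary data: $p_\Sigma\in H^{1/2}(\Sigma)$ with norm $\|\cdot\|_{1/2,\Sigma}$, and $\boldsymbol u_\Sigma$ is a tangential datum on $\Sigma$ for which $\boldsymbol\theta\mapsto\langle\boldsymbol u_\Sigma,\boldsymbol\theta\rangle_\Sigma$ is a bounded linear functional on $\mathrm Z$ (depending only on the tangential trace of $\boldsymbol\theta$ on $\Sigma$); $\|\boldsymbol u_\Sigma\|_{-1/2,\Sigma}$ denotes the corresponding dual norm, $\sup_{\boldsymbol0\ne\boldsymbol\theta\in\mathrm Z}|\langle\boldsymbol u_\Sigma,\boldsymbol\theta\rangle_\Sigma|/\|\boldsymbol\theta\|_{H(\mathbf{curl};\Omega)}$.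 $\langle\cdot,\cdot\rangle_\Sigma$ denotes duality pairings on $\Sigma$. Discretisation: $\{\mathcal T_h\}_{h>0}$ is a shape-regular family of (conforming) partitions of $\bar\Omega$ into tetrahedra $T$ of diameter $h_T$, compatible with the splitting of $\partial\Omega$ into $\Gamma$ and $\Sigma$, with $h=\max_T h_T$. $\mathcal P_k(T)$ denotes polynomials of total degree $\le k$ on $T$. $\mathbb N_k(T)=\mathcal P_k(T)^3\oplus R_{k+1}(T)$ is the local Nédélec space, where $R_{k+1}(T)$ is the space of vector fields $\boldsymbol r\in\mathcal P_{k+1}(T)^3$ with homogeneous components of degree $k+1$ and $\boldsymbol r(\boldsymbol x)\cdot\boldsymbol x=0$. $RT_k(T)=\mathcal P_k(T)^3\oplus\mathcal P_k(T)\boldsymbol x$ is the Raviart–Thomas space, in the usual sense (the added part may be taken with homogeneous polynomials of degree $k$). Then $\mathrm Z_h:=\{\boldsymbol\theta_h\in\mathrm Z:\boldsymbol\theta_h|_T\in\mathbb N_k(T)\ \forall T\in\mathcal T_h\}$, $\mathrm H_h:=\{\boldsymbol v_h\in\mathrm H:\boldsymbol v_h|_T\in RT_k(T)\ \forall T\in\mathcal T_h\}$, and $\mathrm X_h:=\{\boldsymbol v_h\in\mathrm H_h:\mathrm{div}\,\boldsymbol v_h=0\text{ in }\Omega\}$. *)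

(* Defs.v *)
From HB Require Import structures.
From mathcomp Require Import all_boot all_order all_algebra.
From mathcomp Require Import all_classical all_reals all_analysis.

Set Implicit Arguments.
Unset Strict Implicit.
Unset Printing Implicit Defensive.

Import Order.TTheory GRing.Theory Num.Theory.
Import numFieldNormedType.Exports.

Local Open Scope classical_set_scope.
Local Open Scope ring_scope.

(* R^3.  The library puts Lebesgue measure on R and on products, so points are
   nested pairs; the norm coming with this type is the max norm, hence the
   separate Euclidean norm [enorm] below. *)
Notation E3 R := (R * R * R)%type.

Section Geometry.
Context {R : realType}.
Implicit Types (x y : E3 R) (T : set (E3 R)) (V : 'I_4 -> E3 R).

Definition dot x y : R := x.1.1 * y.1.1 + x.1.2 * y.1.2 + x.2 * y.2.

Definition cross x y : E3 R :=
  (x.1.2 * y.2 - x.2 * y.1.2,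
   x.2 * y.1.1 - x.1.1 * y.2,
   x.1.1 * y.1.2 - x.1.2 * y.1.1).

Definition enorm x : R := Num.sqrt (dot x x).

Definition frontier T : set (E3 R) := closure T `\` T°.

Definition affine_indep V : Prop :=
  forall t : 'I_4 -> R, \sum_i t i = 0 -> \sum_i t i *: V i = 0 ->
  forall i, t i = 0.

(* Closed face of the tetrahedron V spanned by the vertices in I, and its
   relative interior; the face of the empty set of vertices is empty. *)
Definition face V (I : {set 'I_4}) : set (E3 R) :=
  [set x | exists t : 'I_4 -> R, [/\ forall i, 0 <= t i,
     \sum_(i in I) t i = 1 & x = \sum_(i in I) t i *: V i]].

Definition relint_face V (I : {set 'I_4}) : set (E3 R) :=
  [set x | exists t : 'I_4 -> R, [/\ forall i, 0 < t i,
     \sum_(i in I) t i = 1 & x = \sum_(i in I) t i *: V i]].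

Definition vertices_of T V : Prop := affine_indep V /\ T = face V [set: 'I_4]%SET.

Definition tetrahedron T : Prop := exists V, vertices_of T V.

Definition tetrahedral_cover (Omega : set (E3 R)) (Th : set (set (E3 R))) : Prop :=
  [/\ finite_set Th, forall T, Th T -> tetrahedron T &
      closure Omega = \bigcup_(T in Th) T].

(* Near each boundary point, Omega is the strict hypograph of a Lipschitz
   function in some orthonormal frame (a, b, c) centred at that point. *)
Definition lipschitz_boundary (Omega : set (E3 R)) : Prop :=
  forall x, frontier Omega x ->
  exists (a b c : E3 R) (L r : R) (g : R * R -> R),
    [/\ [/\ dot a a = 1, dot b b = 1 & dot c c = 1],
        [/\ dot a b = 0, dot a c = 0 & dot b c = 0],
        0 < r, L.-lipschitz g &
        forall y, enorm (y - x) < r ->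
          (Omega y <-> dot (y - x) c < g (dot (y - x) a, dot (y - x) b))].

Definition polyhedral_lipschitz_domain (Omega : set (E3 R)) : Prop :=
  [/\ [/\ open Omega, connected Omega & Omega !=set0],
      bounded_set Omega,
      exists Th, tetrahedral_cover Omega Th &
      lipschitz_boundary Omega].

Definition boundary_partition (Omega Gam Sig : set (E3 R)) : Prop :=
  Gam `|` Sig = frontier Omega /\ Gam `&` Sig = set0.

Definition conforming (Th : set (set (E3 R))) : Prop :=
  forall T T' V V', Th T -> Th T' -> vertices_of T V -> vertices_of T' V' ->
  exists I I', T `&` T' = face V I /\ T `&` T' = face V' I'.

Definition compatible (Omega Gam Sig : set (E3 R)) (Th : set (set (E3 R))) : Prop :=
  forall T V (I : {set 'I_4}), Th T -> vertices_of T V -> #|I| = 3%N ->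
  face V I `<=` frontier Omega ->
  relint_face V I `<=` Gam \/ relint_face V I `<=` Sig.

Definition diam T : R := sup [set enorm (z.1 - z.2) | z in T `*` T].

Definition inradius T : R :=
  sup [set r : R | exists c, forall x, enorm (x - c) < r -> T x].

Definition mesh_size (Th : set (set (E3 R))) : R := sup [set diam T | T in Th].

Definition shape_regular (hs : set R) (Th : R -> set (set (E3 R))) : Prop :=
  exists2 kappa : R, 0 < kappa &
    forall h T, hs h -> Th h T -> diam T <= kappa * inradius T.

(* [hs] is the set of the parameters h of the family {T_h}. *)
Definition mesh_family (Omega Gam Sig : set (E3 R)) (hs : set R)
    (Th : R -> set (set (E3 R))) : Prop :=
  (forall h, hs h ->
    [/\ 0 < h, mesh_size (Th h) = h, tetrahedral_cover Omega (Th h),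
        conforming (Th h) & compatible Omega Gam Sig (Th h)]) /\
  shape_regular hs Th.

End Geometry.

Section Calculus.
Context {R : realType}.
Implicit Types (phi : E3 R -> R) (psi : E3 R -> E3 R) (U : set (E3 R)).

Definition compwise (P : (E3 R -> R) -> Prop) psi : Prop :=
  [/\ P (fun x => (psi x).1.1), P (fun x => (psi x).1.2) & P (fun x => (psi x).2)].

Definition pd1 phi x : R := 'D_((1, 0, 0) : E3 R) phi x.
Definition pd2 phi x : R := 'D_((0, 1, 0) : E3 R) phi x.
Definition pd3 phi x : R := 'D_((0, 0, 1) : E3 R) phi x.

Definition grad phi x : E3 R := (pd1 phi x, pd2 phi x, pd3 phi x).

Definition divergence psi x : R :=
  pd1 (fun y => (psi y).1.1) x + pd2 (fun y => (psi y).1.2) x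
  + pd3 (fun y => (psi y).2) x.

Definition curl psi x : E3 R :=
  (pd2 (fun y => (psi y).2) x - pd3 (fun y => (psi y).1.2) x,
   pd3 (fun y => (psi y).1.1) x - pd1 (fun y => (psi y).2) x,
   pd1 (fun y => (psi y).1.2) x - pd2 (fun y => (psi y).1.1) x).

Definition iter_derive (s : seq (E3 R)) phi : E3 R -> R :=
  foldr (fun v (g : E3 R -> R) x => 'D_v g x) phi s.

(* C^oo: all iterated directional derivatives exist and are continuous. *)
Definition smooth phi : Prop :=
  forall s, continuous (iter_derive s phi) /\
            forall x v, derivable (iter_derive s phi) x v.

Definition supp phi : set (E3 R) := closure [set x | phi x != 0].

(* C_c^oo(U) *)
Definition testfun U phi : Prop :=
  [/\ smooth phi, compact (supp phi) & supp phi `<=` U].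

(* Polynomials of total degree at most k, and homogeneous ones of degree k. *)
Definition monomial_sum k (D : nat -> bool) (c : nat -> nat -> nat -> R)
    (x : E3 R) : R :=
  \sum_(i < k.+1) \sum_(j < k.+1) \sum_(l < k.+1 | D (i + j + l)%N)
    c i j l * x.1.1 ^+ i * x.1.2 ^+ j * x.2 ^+ l.

Definition poly_le k (p : E3 R -> R) : Prop :=
  exists c, forall x, p x = monomial_sum k (fun m => m <= k)%N c x.

Definition poly_homog k (p : E3 R -> R) : Prop :=
  exists c, forall x, p x = monomial_sum k (fun m => m == k) c x.

Definition nedelec k (q : E3 R -> E3 R) : Prop :=
  exists p r : E3 R -> E3 R,
    [/\ compwise (poly_le k) p, compwise (poly_homog k.+1) r,
        forall x, dot (r x) x = 0 & forall x, q x = p x + r x].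

Definition raviart_thomas k (q : E3 R -> E3 R) : Prop :=
  exists (p : E3 R -> E3 R) (r : E3 R -> R),
    [/\ compwise (poly_le k) p, poly_homog k r & forall x, q x = p x + r x *: x].

End Calculus.

Section Sobolev.
Context {R : realType}.

Definition leb3 : {measure set
    (measurableTypeR R * measurableTypeR R * measurableTypeR R)%type -> \bar R} :=
  ((@lebesgue_measure R \x @lebesgue_measure R) \x @lebesgue_measure R)%E.

Variable Omega : set (E3 R).
Implicit Types (phi P : E3 R -> R) (v w th : E3 R -> E3 R) (S G : set (E3 R)).

(* Functions are total; only their values a.e. on Omega matter. *)
Definition integ (g : E3 R -> R) : R := (\int[leb3]_(x in Omega) g x)%R.

Definition L2 : set (E3 R -> R) := [set g | (g \_ Omega) \in Lfun leb3 2%:E].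
Definition Linf : set (E3 R -> R) := [set g | (g \_ Omega) \in Lfun leb3 +oo%E].
Definition L2v : set (E3 R -> E3 R) := compwise L2.
Definition Linfv : set (E3 R -> E3 R) := compwise Linf.

Definition norm2 (g : E3 R -> R) : R :=
  fine 'N[leb3]_2%:E[EFin \o (g \_ Omega)]%E.
Definition norm2v v : R := norm2 (enorm \o v).

Definition norm_inf (g : E3 R -> R) : R :=
  fine 'N[leb3]_+oo[EFin \o (g \_ Omega)]%E.

(* Maximum of the norms of the components; it is bounded by the essential
   supremum of the Euclidean length. *)
Definition norm_infv v : R :=
  Num.max (Num.max (norm_inf (fun x => (v x).1.1)) (norm_inf (fun x => (v x).1.2)))
    (norm_inf (fun x => (v x).2)).

(* Distributional gradient, divergence and curl in L^2(Omega).  [wgrad], [wdiv]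
   and [wcurl] pick a representative, unique up to a null set when it exists. *)
Definition is_wgrad P w : Prop :=
  L2v w /\ forall psi, compwise (testfun Omega) psi ->
    integ (fun x => P x * divergence psi x) = - integ (fun x => dot (w x) (psi x)).

Definition is_wdiv v (g : E3 R -> R) : Prop :=
  L2 g /\ forall phi, testfun Omega phi ->
    integ (fun x => dot (v x) (grad phi x)) = - integ (fun x => g x * phi x).

Definition is_wcurl th w : Prop :=
  L2v w /\ forall psi, compwise (testfun Omega) psi ->
    integ (fun x => dot (th x) (curl psi x)) = integ (fun x => dot (w x) (psi x)).

Definition wgrad P : E3 R -> E3 R := get (is_wgrad P).
Definition wdiv v : E3 R -> R := get (is_wdiv v).
Definition wcurl th : E3 R -> E3 R := get (is_wcurl th).

Definition H1 : set (E3 R -> R) := [set P | L2 P /\ exists w, is_wgrad P w].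
Definition Hdiv : set (E3 R -> E3 R) := [set v | L2v v /\ exists g, is_wdiv v g].
Definition Hcurl : set (E3 R -> E3 R) := [set th | L2v th /\ exists w, is_wcurl th w].

Definition normH1 P : R := Num.sqrt (norm2 P ^+ 2 + norm2v (wgrad P) ^+ 2).
Definition normHdiv v : R := Num.sqrt (norm2v v ^+ 2 + norm2 (wdiv v) ^+ 2).
Definition normHcurl th : R := Num.sqrt (norm2v th ^+ 2 + norm2v (wcurl th) ^+ 2).

(* v . n = 0 and th x n = 0 on the part G of the boundary.  The traces live in
   H^{-1/2} of the boundary and are given by Green's formulas; their restriction
   to G vanishes when they vanish on all smooth functions whose support does not
   meet the closure of the rest of the boundary. *)
Definition away G : set (E3 R) := ~` closure (frontier Omega `\` G).

Definition normal0 G v : Prop :=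
  forall phi, testfun (away G) phi ->
    integ (fun x => dot (v x) (grad phi x) + wdiv v x * phi x) = 0.

Definition tangential0 G th : Prop :=
  forall psi, compwise (testfun (away G)) psi ->
    integ (fun x => dot (wcurl th x) (psi x) - dot (th x) (curl psi x)) = 0.

(* Functions of H^1(Omega) with zero trace on S: the H^1(Omega)-closure of the
   smooth functions vanishing near S. *)
Definition H1_0 S : set (E3 R -> R) :=
  [set P | H1 P /\ forall e : R, 0 < e ->
     exists2 phi, testfun (~` closure S) phi & normH1 (P \- phi) < e].

(* H^{1/2}(S) = H^1(Omega) / H1_0 S with the quotient norm: an element is
   the class of all its liftings to H^1(Omega). *)
Definition H12 S : set (set (E3 R -> R)) :=
  [set p | exists2 P, H1 P & p = [set Q | H1 Q /\ H1_0 S (Q \- P)]].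

Definition norm12 (p : set (E3 R -> R)) : R := inf [set normH1 P | P in p].

(* <v . n, p> on S for p in H^{1/2}(S), where v . n = 0 on the rest of the
   boundary: Green's formula with any lifting of p, all giving the same value. *)
Definition normal_pairing v (p : set (E3 R -> R)) : R :=
  let P := get p in integ (fun x => dot (v x) (wgrad P x) + wdiv v x * P x).

End Sobolev.

Section Problem.
Context {R : realType}.
Variables (Omega Gam Sig : set (E3 R)) (nu sigma : R) (beta : E3 R -> E3 R).
Implicit Types (u v w th f : E3 R -> E3 R) (p : set (E3 R -> R))
  (us : (E3 R -> E3 R) -> R).

Definition spaceH : set (E3 R -> E3 R) := [set v | Hdiv Omega v /\ normal0 Omega Gam v].

Definition spaceZ : set (E3 R -> E3 R) :=
  [set th | Hcurl Omega th /\ tangential0 Omega Gam th].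

Definition spaceX : set (E3 R -> E3 R) :=
  [set v | spaceH v /\ wdiv Omega v = cst 0 %[ae leb3 in Omega]].

Definition normH v : R := normHdiv Omega v.

Definition normZ th : R :=
  Num.sqrt (norm2v Omega th ^+ 2 + nu * norm2v Omega (wcurl Omega th) ^+ 2).

Definition form_a u v : R := sigma * integ Omega (fun x => dot (u x) (v x)).
Definition form_b1 v th : R :=
  Num.sqrt nu * integ Omega (fun x => dot (wcurl Omega th x) (v x)).
Definition form_d w th : R := integ Omega (fun x => dot (w x) (th x)).
Definition form_c th v : R :=
  (Num.sqrt nu)^-1 * integ Omega (fun x => dot (cross (th x) (beta x)) (v x)).

Definition form_F f p v : R :=
  integ Omega (fun x => dot (f x) (v x)) - normal_pairing Omega v p.
Definition form_G us th : R := - (Num.sqrt nu * us th).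

(* The datum u_Sigma, given by the functional th |-> <u_Sigma, th> on Z. *)
Definition tangential_datum us : Prop :=
  [/\ forall (a : R) th w, spaceZ th -> spaceZ w ->
        us (fun x => a *: th x + w x) = a * us th + us w,
      exists C : R, forall th, spaceZ th -> `|us th| <= C * normHcurl Omega th &
      forall th w, spaceZ th -> spaceZ w ->
        tangential0 Omega Sig (fun x => th x - w x) -> us th = us w].

Definition norm_datum us : R :=
  sup [set `|us th| / normHcurl Omega th | th in
        [set th | spaceZ th /\ ~ (th = cst 0 %[ae leb3 in Omega])]].

Definition piecewise (Loc : (E3 R -> E3 R) -> Prop) (Th : set (set (E3 R))) v : Prop :=
  forall T, Th T -> exists2 q, Loc q & v = q %[ae leb3 in T].

Definition spaceZh k Th : set (E3 R -> E3 R) :=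
  [set th | spaceZ th /\ piecewise (nedelec k) Th th].

Definition spaceHh k Th : set (E3 R -> E3 R) :=
  [set v | spaceH v /\ piecewise (raviart_thomas k) Th v].

Definition spaceXh k Th : set (E3 R -> E3 R) :=
  [set v | spaceHh k Th v /\ wdiv Omega v = cst 0 %[ae leb3 in Omega]].

Definition solution (X Z : set (E3 R -> E3 R)) f p us u w : Prop :=
  [/\ X u, Z w,
      forall v, X v -> form_a u v + form_b1 v w + form_c w v = form_F f p v &
      forall th, Z th -> form_b1 u th - form_d w th = form_G us th].

(* Elements of the spaces are identified when they agree a.e. on Omega. *)
Definition unique_solution (X Z : set (E3 R -> E3 R)) f p us : Prop :=
  exists u w, solution X Z f p us u w /\
    forall u' w', solution X Z f p us u' w' ->
      u' = u %[ae leb3 in Omega] /\ w' = w %[ae leb3 in Omega].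

Definition admissible f p us : Prop :=
  [/\ L2v Omega f, H12 Omega Sig p & tangential_datum us].

Definition best_error (X Z : set (E3 R -> E3 R)) u w : R :=
  inf [set normH (u \- z.1) + normZ (w \- z.2) | z in X `*` Z].

End Problem.

(* Main.v *)
(* The unknown is the triple (u, w, g) with g = curl w, in L^2(Omega)^9 with the
   squared norm |u|^2 + |w|^2 + nu |g|^2.  As curl w lies in X, and in Xh when w
   is in Zh, the momentum equation may be tested with
   v + sqrt(nu) / (16 sigma) curl theta instead of v; this turns the mixed form
   into a coercive one: the terms sqrt(nu) (curl w, u) cancel, a multiple of
   nu |curl w|^2 appears, and the smallness of beta absorbs the convective term.
   Lax-Milgram, its Galerkin version, stability and Cea's lemma then apply with
   constants independent of the mesh.
   X and Z are cut out by orthogonality to test fields, hence closed, and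
   X contains curl Z because curl grad = 0 on test functions.  On the discrete
   side, the weak curl of a piecewise Nedelec field is computed tetrahedron by
   tetrahedron, for which the interior of each tetrahedron has to lie in Omega:
   an open subset of the closure of a Lipschitz domain misses its boundary. *)
Require Import Defs.
From HB Require Import structures.
From mathcomp Require Import all_boot all_order all_algebra.
From mathcomp Require Import all_classical all_reals all_analysis.
From mathcomp Require Import measurable_realfun ess_sup_inf ring lra.

Set Implicit Arguments.
Unset Strict Implicit.
Unset Printing Implicit Defensive.

Import Order.TTheory GRing.Theory Num.Theory.
Import numFieldNormedType.Exports.

Local Open Scope classical_set_scope.
Local Open Scope ring_scope.

(** * Semi-Hilbert spaces: Riesz, Galerkin, Lax-Milgram *)

(** Fields are functions, not classes modulo null sets, so the inner products are only semidefinite: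
    Riesz, Galerkin and Lax-Milgram are proved up to null vectors, and solutions are compared almost
    everywhere. The curl is an unknown of its own because [wcurl] picks a representative by choice
    and need not be linear in the field, while the relation [is_wcurl] is linear and closed. The
    unshifted form on the diagonal already controls [u] and [w], but not the curl, which the norm of
    Z contains. Shifting the test function repairs this at the price of two new cross terms; the
    factor 16 makes the shift small enough for the rest of the form to absorb them. The continuous
    and the discrete problem are instances of one argument on a pair of spaces; its constants are
    fixed before the pair is chosen, and this is where their independence of the mesh comes from. *)

Definition subspace_set {R : realType} {T : lmodType R} (W : set T) : Prop :=
  W 0 /\ forall (a : R) x y, W x -> W y -> W (a *: x + y).

Definition linear_on {R : realType} {T : lmodType R} (W : set T) (L : T -> R) :=
  forall (a : R) x y, W x -> W y -> L (a *: x + y) = a * L x + L y.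

Definition semi_inner {R : realType} {T : lmodType R} (ip : T -> T -> R) : Prop :=
  [/\ forall (a : R) x y z, ip (a *: x + y) z = a * ip x z + ip y z,
      forall x y, ip x y = ip y x & forall x, 0 <= ip x x].

Definition complete_on {R : realType} {T : lmodType R} (ip : T -> T -> R)
    (W : set T) : Prop :=
  forall u : nat -> T, (forall n, W (u n)) ->
    (forall e : R, 0 < e -> exists N : nat, forall m n, (N <= m)%N -> (N <= n)%N ->
       ip (u m - u n) (u m - u n) <= e) ->
    exists2 x, W x & forall e : R, 0 < e -> exists N : nat, forall n, (N <= n)%N ->
       ip (u n - x) (u n - x) <= e.

(** Boundedness is stated with squares to avoid norms: [M] is the square of the usual continuity
    constant, hence the [Num.sqrt M] in Cea's estimate. *)
Record elliptic {R : realType} {T : lmodType R} (ip B : T -> T -> R) (M alpha : R) : Prop :=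
  Elliptic {
    elliptic_linl : forall a x y z, B (a *: x + y) z = a * B x z + B y z;
    elliptic_linr : forall a x y z, B z (a *: x + y) = a * B z x + B z y;
    elliptic_bound_ge0 : 0 <= M;
    elliptic_bound : forall x y, B x y ^+ 2 <= M * ip x x * ip y y;
    elliptic_gt0 : 0 < alpha;
    elliptic_coercive : forall x, alpha * ip x x <= B x x }.

Definition bounded_on {R : realType} {T : lmodType R} (ip : T -> T -> R)
    (W : set T) (L : T -> R) : Prop :=
  exists C : R, forall x, W x -> L x ^+ 2 <= C * ip x x.

Section SemiInner.
Context {R : realType} {T : lmodType R} {ip : T -> T -> R}.
Hypothesis ipS : semi_inner ip.

Lemma ipPl a x y z : ip (a *: x + y) z = a * ip x z + ip y z.
Proof. by case: ipS. Qed.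
Lemma ipC x y : ip x y = ip y x. Proof. by case: ipS. Qed.
Lemma ip_ge0 x : 0 <= ip x x. Proof. by case: ipS. Qed.
Lemma ip0l z : ip 0 z = 0.
Proof. by move: (ipPl (-1) 0 0 z); rewrite scaler0 addr0; lra. Qed.
Lemma ipZl a x z : ip (a *: x) z = a * ip x z.
Proof. by rewrite -[a *: x]addr0 ipPl ip0l addr0. Qed.
Lemma ipDl x y z : ip (x + y) z = ip x z + ip y z.
Proof. by rewrite -{1}[x]scale1r ipPl mul1r. Qed.
Lemma ipNl x z : ip (- x) z = - ip x z.
Proof. by rewrite -scaleN1r ipZl mulN1r. Qed.
Lemma ipBl x y z : ip (x - y) z = ip x z - ip y z.
Proof. by rewrite ipDl ipNl. Qed.
Lemma ipPr a x y z : ip z (a *: x + y) = a * ip z x + ip z y.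
Proof. by rewrite ipC ipPl !(ipC z). Qed.
Lemma ipDr x y z : ip z (x + y) = ip z x + ip z y.
Proof. by rewrite ipC ipDl !(ipC z). Qed.
Lemma ipZr a x z : ip z (a *: x) = a * ip z x.
Proof. by rewrite ipC ipZl (ipC z). Qed.

Lemma ipNr x z : ip z (- x) = - ip z x.
Proof. by rewrite -scaleN1r ipZr mulN1r. Qed.
Definition ipE := (ipDl, ipDr, ipNl, ipNr, ipZl, ipZr).

(** The discriminant criterion. For [a = 0], a nonzero slope is refuted at the point where the
    affine function takes the value -1; otherwise the vertex [- b / a] decides. *)
Lemma quadratic_ge0 (a b c : R) : 0 <= a -> (forall t, 0 <= a * t ^+ 2 + 2 * b * t + c) ->
  b ^+ 2 <= a * c.
Proof.
move=> a0 h; have [a_eq0|an0] := eqVneq a 0.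
  rewrite a_eq0 mul0r; have [->|bn0] := eqVneq b 0; first by rewrite expr0n.
  have := h (- (c + 1) / (2 * b)).
  rewrite a_eq0 [X in 0 <= X](_ : _ = -1); last by field.
  lra.
have ap : 0 < a by rewrite lt_neqAle eq_sym an0.
have := h (- b / a).
rewrite [X in 0 <= X](_ : _ = (a * c - b ^+ 2) / a); last by field.
by rewrite pmulr_lge0 ?invr_gt0// subr_ge0.
Qed.

Lemma ip_CS x y : ip x y ^+ 2 <= ip x x * ip y y.
Proof.
apply: quadratic_ge0 (ip_ge0 x) _ => t.
have := ip_ge0 (t *: x + y).
by rewrite ipPl !ipPr (ipC y x); lra.
Qed.

Definition ipn x := Num.sqrt (ip x x).

Lemma ipn_ge0 x : 0 <= ipn x. Proof. exact: sqrtr_ge0. Qed.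

Lemma ipn_sqr x : ipn x ^+ 2 = ip x x.
Proof. by rewrite sqr_sqrtr// ip_ge0. Qed.

Lemma ip_CSn x y : `|ip x y| <= ipn x * ipn y.
Proof.
rewrite -(@ler_pXn2r _ 2) ?nnegrE ?mulr_ge0 ?ipn_ge0//.
by rewrite real_normK ?num_real// exprMn !ipn_sqr ip_CS.
Qed.

Lemma ipnD x y : ipn (x + y) <= ipn x + ipn y.
Proof.
rewrite -(@ler_pXn2r _ 2) ?nnegrE ?addr_ge0 ?ipn_ge0//.
rewrite sqrrD !ipn_sqr ipDl !ipDr (ipC y x).
have := le_trans (ler_norm _) (ip_CSn x y).
by rewrite mulr2n; lra.
Qed.

Section Riesz.
Variable W : set T.
Hypotheses (Wsub : subspace_set W) (Wc : complete_on ip W).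

Lemma subspace0 : W 0. Proof. by case: Wsub. Qed.
Lemma subspaceP a x y : W x -> W y -> W (a *: x + y).
Proof. by case: Wsub => _; apply. Qed.
Lemma subspaceZ a x : W x -> W (a *: x).
Proof. by move=> Wx; rewrite -[_ *: _]addr0; apply: subspaceP => //; exact: subspace0. Qed.
Lemma subspaceD x y : W x -> W y -> W (x + y).
Proof. by rewrite -{2}[x]scale1r; exact: subspaceP. Qed.
Lemma subspaceB x y : W x -> W y -> W (x - y).
Proof. by move=> Wx Wy; rewrite addrC -scaleN1r; exact: subspaceP. Qed.

Lemma linear_onZ L a x : linear_on W L -> W x -> L (a *: x) = a * L x.
Proof.
move=> Ll Wx; have L0 : L 0 = 0.
  by move: (Ll (-1) 0 0 subspace0 subspace0); rewrite scaler0 addr0; lra.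
by rewrite -[a *: x]addr0 Ll ?L0 ?addr0//; exact: subspace0.
Qed.

Lemma linear_onD L x y : linear_on W L -> W x -> W y -> L (x + y) = L x + L y.
Proof. by move=> Ll Wx Wy; rewrite -{1}[x]scale1r Ll// mul1r. Qed.

(** Minimises [J x = ip x x - 2 L x], a minimiser of which solves the equation. A minimising
    sequence is Cauchy by the parallelogram identity. The equation is obtained along the sequence
    and then passed to the limit, so the infimum need not be shown to be attained. *)
Lemma riesz (L : T -> R) : linear_on W L -> bounded_on ip W L ->
  exists2 x, W x & forall y, W y -> ip x y = L y.
Proof.
move=> Ll [C LC].
pose J x := ip x x - 2 * L x.
(* Nothing is known about the sign of [C]; [K] can be divided by. *)
pose K := Num.max C 1.
have K1 : 1 <= K by rewrite le_max lexx orbT.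
have LK x : W x -> L x ^+ 2 <= K * ip x x.
  move=> Wx; apply: (le_trans (LC x Wx)); rewrite ler_wpM2r ?ip_ge0//.
  by rewrite le_max lexx.
have Jlb x : W x -> - K <= J x.
  move=> Wx; rewrite /J.
  have h : (L x) ^+ 2 / K <= ip x x by rewrite ler_pdivrMr ?(lt_le_trans ltr01)// mulrC LK.
  have : 0 <= (L x - K) ^+ 2 / K by rewrite divr_ge0 ?sqr_ge0// (le_trans ler01).
  rewrite [X in 0 <= X](_ : _ = (L x)^+ 2 / K - 2 * L x + K); first by lra.
  by field; rewrite gt_eqF// (lt_le_trans ltr01).
pose m := inf [set J x | x in W].
have hI : has_inf [set J x | x in W].
  split; first by exists (J 0), 0 => //; exact: subspace0.
  by exists (- K) => _ [x Wx <-]; exact: Jlb.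
have mle x : W x -> m <= J x.
  by move=> Wx; apply: (ge_inf hI.2); exists x.
(* The parallelogram identity: the linear parts of [J] cancel on the right. *)
have JZ x y : W x -> W y ->
  ip (x - y) (x - y) = 2 * J x + 2 * J y - 4 * J (2^-1 *: (x + y)).
  move=> Wx Wy; rewrite /J (linear_onZ _ Ll)//; last exact: subspaceD.
  rewrite (linear_onD Ll)// !ipE (ipC y x).
  by field.
have JC x y : W x -> W y -> ip (x - y) (x - y) <= 2 * (J x - m) + 2 * (J y - m).
  move=> Wx Wy; rewrite JZ//.
  have := mle _ (subspaceZ 2^-1 (subspaceD Wx Wy)); lra.
have /choice[u hu] (n : nat) : exists x, W x /\ J x < m + n.+1%:R^-1.
  have [_ [x Wx <-] h] := @inf_adherent _ _ (n.+1%:R^-1 : R) ltac:(by rewrite invr_gt0) hI.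
  by exists x.
have small (e : R) : 0 < e -> exists N : nat, forall n, (N <= n)%N -> n.+1%:R^-1 <= e.
  move=> e0; exists (Num.truncn e^-1) => n hn.
  rewrite invf_ple ?posrE//; apply: ltW.
  by rewrite (lt_le_trans (truncnS_gt _))// ler_nat ltnS.
have [||x Wx hx] := @Wc u.
- by move=> n; have [] := hu n.
- move=> e e0; have [N hN] := small (e / 4) ltac:(by rewrite divr_gt0).
  exists N => p q hp hq; have [Wp Jp] := hu p; have [Wq Jq] := hu q.
  apply: (le_trans (JC _ _ Wp Wq)); have a1 := hN _ hp; have a2 := hN _ hq.
  move: Jp Jq a1 a2; set s1 := p.+1%:R^-1; set s2 := q.+1%:R^-1; lra.
exists x => // y Wy.
have lim (F : R) (A : R) : 0 <= A -> (forall e : R, 0 < e -> F ^+ 2 <= A * e) -> F = 0.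
  move=> A0 h; apply/eqP; rewrite -sqrf_eq0; apply/eqP/le_anti; rewrite sqr_ge0 andbT.
  apply/ler_addgt0Pl => e e0; rewrite addr0.
  have A1 : 0 < A + 1 by lra.
  apply: (le_trans (h (e / (A + 1)) ltac:(by rewrite divr_gt0))).
  by rewrite mulrA ler_pdivrMr// mulrDr mulr1 mulrC lerDl ltW.
(* [x + t y] cannot lower [J] below its infimum [m], approached along [u] *)
have var n : (ip (u n) y - L y) ^+ 2 <= ip y y * n.+1%:R^-1.
  apply: quadratic_ge0 (ip_ge0 y) _ => t; have [Wn Jn] := hu n.
  have := mle _ (subspaceP t Wy Wn).
  move: Jn; rewrite /J Ll// !ipE (ipC y (u n)).
  set s := _^-1; lra.
apply/eqP; rewrite -subr_eq0; apply/eqP.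
apply: (lim _ (4 * ip y y)); first by rewrite mulr_ge0// ip_ge0.
move=> e e0; have [N1 h1] := small e e0; have [N2 h2] := hx e e0.
pose n := maxn N1 N2.
have a1 := h1 n (leq_maxl _ _); have a2 := h2 n (leq_maxr _ _).
have b2 := ip_CS (u n - x) y.
have yy := ip_ge0 y.
have {a1}b1 : (ip (u n) y - L y) ^+ 2 <= ip y y * e.
  by rewrite (le_trans (var n))// ler_wpM2l.
have c2 : ip (u n - x) (u n - x) * ip y y <= ip y y * e by rewrite mulrC ler_wpM2l.
rewrite ipBl in b2.
have : (ip x y - L y) ^+ 2 <= 2 * (ip (u n) y - L y) ^+ 2 + 2 * (ip (u n) y - ip x y) ^+ 2.
  rewrite -subr_ge0 [X in 0 <= X](_ : _ = (2 * ip (u n) y - L y - ip x y) ^+ 2); last by ring.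
  exact: sqr_ge0.
lra.
Qed.

End Riesz.

(* Null vectors play the role of zero: [indep e] is linear independence in the
   quotient by the null space. *)
Definition indep m (e : 'I_m -> T) : Prop :=
  forall c : 'I_m -> R,
    ip (\sum_i c i *: e i) (\sum_i c i *: e i) = 0 -> forall i, c i = 0.

Lemma subspace_sum (W : set T) m (e : 'I_m -> T) (c : 'I_m -> R) :
  subspace_set W -> (forall i, W (e i)) -> W (\sum_i c i *: e i).
Proof.
move=> Ws We; elim/big_ind: _ => [|x y Wx Wy|i _].
- exact: subspace0.
- exact: subspaceD.
- exact: subspaceZ.
Qed.

(** A relation instead of a map: coordinates need not be unique, and no choice of them has to be
    shown linear. Only zero coordinates must force a null vector. *)
Definition coordinates (W : set T) (I : finType) (rep : T -> (I -> R) -> Prop) : Prop :=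
  [/\ forall x, W x -> exists c, rep x c,
      forall a x y c d, W x -> W y -> rep x c -> rep y d ->
        rep (a *: x + y) (fun i => a * c i + d i),
      rep 0 (fun=> 0) &
      forall x, W x -> rep x (fun=> 0) -> ip x x = 0].

(** A left kernel vector of the matrix of coordinates is a combination with zero coordinates, hence
    a null vector; independence kills it, so the rows are free and no more numerous than the
    columns. *)
Lemma indep_le (W : set T) (I : finType) (rep : T -> (I -> R) -> Prop) m
    (e : 'I_m -> T) :
  subspace_set W -> coordinates W rep -> (forall i, W (e i)) -> indep e -> (m <= #|I|)%N.
Proof.
move=> Ws [rex rlin r0 rnull] We ie.
have /choice[c hc] (i : 'I_m) : exists c, rep (e i) c by exact: rex.
pose C := \matrix_(i < m, j < #|I|) c i (enum_val j).
have repsum (d : 'I_m -> R) : rep (\sum_i d i *: e i) (fun j => \sum_i d i * c i j).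
  suff h s : W (\sum_(i <- s) d i *: e i) /\
      rep (\sum_(i <- s) d i *: e i) (fun j => \sum_(i <- s) d i * c i j).
    by have [] := h (index_enum 'I_m).
  elim: s => [|i s [Ws' IH]].
    rewrite big_nil; split; first exact: subspace0.
    by rewrite (_ : (fun _ => _) = (fun=> 0))//; apply: funext => j; rewrite big_nil.
  rewrite big_cons; split; first exact: subspaceP.
  rewrite (_ : (fun _ => _) = (fun j => d i * c i j + \sum_(i <- s) d i * c i j)).
    exact: rlin.
  by apply: funext => j; rewrite big_cons.
have : row_free C.
  rewrite -kermx_eq0; apply/eqP/row_matrixP => k; rewrite row0.
  set r := row k _; have rC : r *m C = 0.
    by rewrite /r -row_mul mulmx_ker row0.
  clearbody r; have r_ := ie (fun i => r 0 i) _.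
  apply/rowP => i; rewrite r_ ?mxE//; apply: rnull; first exact: subspace_sum.
  have := repsum (fun i => r 0 i); congr rep; apply: funext => j.
  have /rowP/(_ (enum_rank j)) := rC; rewrite !mxE => h.
  by rewrite -[RHS]h; apply: eq_bigr => i' _; rewrite !mxE enum_rankK.
by rewrite -row_leq_rank => /leq_trans; apply; exact: rank_leq_col.
Qed.

(** By [indep_le] a maximal independent family exists, and it spans [W] up to null vectors.
    Coercivity makes its matrix for [B] invertible; boundedness makes [B] and [L] vanish on null
    vectors, so the equation extends from the span to [W]. *)
Lemma galerkin (W : set T) (B : T -> T -> R) (M alpha : R) (L : T -> R)
    (I : finType) (rep : T -> (I -> R) -> Prop) :
  subspace_set W -> elliptic ip B M alpha -> linear_on W L -> bounded_on ip W L -> coordinates W rep ->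
  exists2 x, W x & forall y, W y -> B x y = L y.
Proof.
move=> Ws [Bl Br M0 BM a0 Bc] Ll [C LC] crd.
pose P m := `[< exists e : 'I_m -> T, (forall i, W (e i)) /\ indep e >].
have P0 : exists m, P m.
  exists 0%N; apply/asboolP; exists (fun=> 0); split => [i|c _ i].
    exact: subspace0.
  by case: i.
have Pb m : P m -> (m <= #|I|)%N.
  by move=> /asboolP[e [We ie]]; exact: (indep_le Ws crd).
have [m /asboolP[e [We ie]] mmax] := ex_maxnP P0 Pb.
have L0 : L 0 = 0.
  by rewrite -[0](scale0r 0) (linear_onZ Ws _ Ll) ?mul0r//; exact: subspace0.
have B0l z : B 0 z = 0.
  by move: (Bl (-1) 0 0 z); rewrite scaler0 addr0; lra.
have B0r z : B z 0 = 0.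
  by move: (Br (-1) 0 0 z); rewrite scaler0 addr0; lra.
have Bsuml (c : 'I_m -> R) z : B (\sum_i c i *: e i) z = \sum_i c i * B (e i) z.
  by elim/big_rec2: _ => [|i y1 y2 _ <-]; [exact: B0l|rewrite Bl].
have Bsumr (c : 'I_m -> R) z : B z (\sum_i c i *: e i) = \sum_i c i * B z (e i).
  by elim/big_rec2: _ => [|i y1 y2 _ <-]; [exact: B0r|rewrite Br].
have Lsum (c : 'I_m -> R) : L (\sum_i c i *: e i) = \sum_i c i * L (e i).
  suff [] : W (\sum_i c i *: e i) /\
      L (\sum_i c i *: e i) = \sum_i c i * L (e i) by [].
  elim/big_rec2: _ => [|i y1 y2 _ [Wy <-]]; first by split => //; exact: subspace0.
  by split; [exact: subspaceP|rewrite Ll].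
have span y : W y -> exists c : 'I_m -> R,
    ip (y - \sum_i c i *: e i) (y - \sum_i c i *: e i) = 0.
  move=> Wy; apply: contrapT => h.
  suff /mmax : P m.+1 by rewrite ltnn.
  (* [y] is placed at [ord0] in front of [e]; a null combination with a nonzero coefficient there
     would put [y] in the span. *)
  apply/asboolP; exists (fun i => if unlift ord0 i is Some j then e j else y).
  split => [i|c]; first by case: unliftP => [j|] _.
  rewrite big_ord_recl unlift_none; under eq_bigr do rewrite liftK.
  have [c0|c0] := eqVneq (c ord0) 0.
    rewrite c0 scale0r add0r => /(ie (fun j => c (lift ord0 j))) cj i.
    by case: (unliftP ord0 i) => [j|] ->.
  move=> hn; case: h; exists (fun j => - (c ord0)^-1 * c (lift ord0 j)).
  rewrite [y - _](_ : _ = (c ord0)^-1 *: (c ord0 *: y +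
      \sum_(i < m) c (lift ord0 i) *: e i)); first by rewrite ipZl ipZr hn !mulr0.
  rewrite scalerDr scalerA mulVf// scale1r; congr (_ + _).
  rewrite scaler_sumr -sumrN; apply: eq_bigr => i _.
  by rewrite mulNr scaleNr opprK scalerA.
pose A := \matrix_(i < m, j < m) B (e i) (e j).
have Au : A \in unitmx.
  rewrite -row_free_unit -kermx_eq0; apply/eqP/row_matrixP => k; rewrite row0.
  set r := row k _; have rA : r *m A = 0 by rewrite /r -row_mul mulmx_ker row0.
  clearbody r; have r_ := ie (fun i => r 0 i) _.
  apply/rowP => i; rewrite r_ ?mxE//.
  set x := \sum_i _; apply/le_anti; rewrite ip_ge0 andbT.
  rewrite -(ler_pM2l a0) mulr0 (le_trans (Bc x))// {2}/x Bsumr big1// => j _.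
  rewrite {1}/x Bsuml; have /rowP/(_ j) := rA; rewrite !mxE => rAj.
  rewrite [X in _ * X](_ : _ = 0) ?mulr0// -[RHS]rAj.
  by apply: eq_bigr => i' _; rewrite !mxE.
pose l : 'rV[R]_m := \row_j L (e j).
pose c := l *m invmx A.
have cA : c *m A = l by rewrite /c mulmxKV.
pose x := \sum_i c 0 i *: e i.
exists x => [|y Wy]; first exact: subspace_sum.
have Bxe j : B x (e j) = L (e j).
  rewrite /x Bsuml; have /rowP/(_ j) := cA; rewrite !mxE => <-.
  by apply: eq_bigr => i' _; rewrite !mxE.
have [d hd] := span y Wy.
set y' := \sum_i _ in hd.
have Wy' : W y' by exact: subspace_sum.
have : L (y - y') = 0.
  apply/eqP; rewrite -sqrf_eq0 eq_le sqr_ge0 andbT.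
  by rewrite (le_trans (LC _ _))// ?hd ?mulr0//; exact: subspaceB.
have : B x (y - y') = 0.
  apply/eqP; rewrite -sqrf_eq0 eq_le sqr_ge0 andbT.
  by rewrite (le_trans (BM _ _))// ?hd ?mulr0.
rewrite addrC -scaleN1r Br Ll// => b1 b2.
have : B x y' = L y'.
  by rewrite /y' Bsumr Lsum; apply: eq_bigr => j _; rewrite Bxe.
lra.
Qed.

End SemiInner.

Lemma lax_milgram {R : realType} {T : lmodType R} (ip : T -> T -> R) (W : set T)
    (B : T -> T -> R) (M alpha : R) (L : T -> R) :
  semi_inner ip -> subspace_set W -> complete_on ip W ->
  elliptic ip B M alpha -> linear_on W L -> bounded_on ip W L ->
  exists2 x, W x & forall y, W y -> B x y = L y.
Proof.
move=> ipS Wsub Wc [Bl Br M0 BM a0 Bc] Ll [C LC].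
have /choice[A hA] (y : T) : exists x, W x /\ forall z, W z -> ip x z = B z y.
  have [||x Wx hx] := @riesz _ _ _ ipS _ Wsub Wc (B^~ y).
  - by move=> a x z _ _; exact: Bl.
  - by exists (M * ip y y) => x _; rewrite (le_trans (BM x y))// mulrAC.
  by exists x.
(* [A] is linear up to null vectors, so [y, z |-> ip (A y) (A z)] is again a
   semi-inner product on [W], with an equivalent norm; Riesz for it solves
   the nonsymmetric problem. *)
have AW y : W (A y) by have [] := hA y.
have Ae y z : W z -> ip (A y) z = B z y by have [_] := hA y; apply.
have Alin a x y z : ip (A (a *: x + y)) (A z) = a * ip (A x) (A z) + ip (A y) (A z).
  by rewrite !Ae// Br.
have q : semi_inner (fun y z => ip (A y) (A z)).
  by split => // [x y|x]; [exact: (ipC ipS)|exact: (ip_ge0 ipS)].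
have AB x y : ip (A (x - y)) (A (x - y)) = ip (A x - A y) (A x - A y).
  have e z : W z -> ip (A (x - y)) z = ip (A x - A y) z.
    move=> Wz; rewrite (ipBl ipS) !Ae// addrC -scaleN1r Br; ring.
  rewrite e//.
  rewrite [LHS](ipC ipS) [LHS]e//; exact: subspaceB.
have lo x : W x -> alpha ^+ 2 * ip x x <= ip (A x) (A x).
  move=> Wx; have := ip_CS ipS (A x) x; rewrite Ae// => CS.
  have [z|z] := eqVneq (ip x x) 0; first by rewrite z mulr0 (ip_ge0 ipS).
  have xp : 0 < ip x x by rewrite lt_neqAle eq_sym z (ip_ge0 ipS).
  have h := Bc x.
  have : (alpha * ip x x) ^+ 2 <= B x x ^+ 2.
    by rewrite ler_pXn2r// ?nnegrE ?mulr_ge0 ?(ltW a0) ?(ip_ge0 ipS)//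
      (le_trans _ h)// mulr_ge0 ?(ltW a0)// (ip_ge0 ipS).
  move=> h1; have := le_trans h1 CS.
  by rewrite exprMn expr2 [_ ^+ 2]expr2 mulrA ler_pM2r// -expr2.
have up x : ip (A x) (A x) <= M * ip x x.
  have [z|z] := eqVneq (ip (A x) (A x)) 0.
    by rewrite z mulr_ge0 ?(ip_ge0 ipS).
  have xp : 0 < ip (A x) (A x) by rewrite lt_neqAle eq_sym z (ip_ge0 ipS).
  have := BM (A x) x; rewrite -Ae//.
  by rewrite expr2 -[M * _ * _]mulrA [X in M * X]mulrC mulrA ler_pM2r.
have a2 : 0 < alpha ^+ 2 by rewrite exprn_gt0.
have qc : complete_on (fun y z => ip (A y) (A z)) W.
  move=> u Wu cu; have [|x Wx hx] := Wc u Wu.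
    move=> e e0; have [N hN] := cu (alpha ^+ 2 * e) ltac:(by rewrite mulr_gt0).
    exists N => p r hp hr; rewrite -(ler_pM2l a2).
    by rewrite (le_trans (lo _ _)) ?hN//; exact: subspaceB.
  exists x => // e e0; have M1 : 0 < M + 1 by lra.
  have [N hN] := hx (e / (M + 1)) ltac:(by rewrite divr_gt0).
  exists N => n hn; rewrite (le_trans (up _))// (le_trans (ler_wpM2l M0 (hN _ hn)))//.
  by rewrite mulrA ler_pdivrMr// mulrC ler_wpM2l ?(ltW e0)//; lra.
have [|y Wy hy] := riesz q Wsub qc Ll.
  exists (`|C| / alpha ^+ 2) => x Wx; rewrite (le_trans (LC x Wx))//.
  rewrite (le_trans (ler_wpM2r (ip_ge0 ipS x) (ler_norm C)))//.
  by rewrite -mulrA ler_wpM2l// mulrC ler_pdivlMr// mulrC lo.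
(* The choice of [A] gives [B (A y) z = ip (A z) (A y)], which is [L z] by Riesz for the new
   product. *)
exists (A y) => // z Wz; rewrite -hy// (ipC ipS) Ae//.
Qed.

(** * Square-integrable fields *)

Section SquareIntegrable.
Context {d} {T : measurableType d} {R : realType}.
Variable mu : {measure set T -> \bar R}.
Implicit Types f g : T -> R.

Definition energy f : \bar R := (\int[mu]_x ((f x) ^+ 2)%:E)%E.

Lemma measurable_EFin_sqr f : measurable_fun setT f ->
  measurable_fun setT (fun x => ((f x) ^+ 2)%:E).
Proof. by move=> mf; apply/measurable_EFinP; exact: measurable_funX. Qed.

Lemma Lnorm2E f : ('N[mu]_2%:E[EFin \o f] = energy f `^ 2^-1)%E.
Proof.
rewrite unlock /energy; congr (_ `^ _)%E; apply: eq_integral => x _ /=.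
by rewrite powR_mulrn// real_normK// num_real.
Qed.

Lemma energy_ge0 f : (0 <= energy f)%E.
Proof. by apply: integral_ge0 => x _; rewrite lee_fin sqr_ge0. Qed.

Lemma Lfun2P f :
  (f \in Lfun mu 2%:E) <-> measurable_fun setT f /\ (energy f < +oo)%E.
Proof.
split=> [|[mf ef]].
  move=> /[dup] fL /Lfun2_integrable_sqr /integrableP[_ h]; split.
    by move: fL; rewrite inE => /andP[]; rewrite inE.
  move: h; under eq_integral => x _ do rewrite /= ger0_norm ?sqr_ge0//.
  by [].
rewrite inE; apply/andP; split; rewrite inE//=.
by rewrite /finite_norm Lnorm2E poweR_lty.
Qed.

Lemma energyD2 f g : measurable_fun setT f -> measurable_fun setT g ->
  (energy (f \+ g)%R <= 2%:E * energy f + 2%:E * energy g)%E.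
Proof.
move=> mf mg; have mf2 := measurable_EFin_sqr mf; have mg2 := measurable_EFin_sqr mg.
rewrite /energy -!ge0_integralZl ?lee_fin//; last 2 first.
- by move=> x _; rewrite lee_fin sqr_ge0.
- by move=> x _; rewrite lee_fin sqr_ge0.
rewrite -ge0_integralD//; last 4 first.
- by move=> x _; rewrite -EFinM lee_fin mulr_ge0// sqr_ge0.
- exact: measurable_funeM.
- by move=> x _; rewrite -EFinM lee_fin mulr_ge0// sqr_ge0.
- exact: measurable_funeM.
apply: ge0_le_integral => //.
- by move=> x _; rewrite lee_fin sqr_ge0.
- by apply: measurable_EFin_sqr; exact: measurable_funD.
- by apply: emeasurable_funD; exact: measurable_funeM.
move=> x _; rewrite -!EFinM -EFinD lee_fin -subr_ge0.
rewrite [X in 0 <= X](_ : _ = (f x - g x) ^+ 2) ?sqr_ge0//=; ring.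
Qed.

(** The increments are at most [Num.sqrt C * 2^-1 ^+ k], so the telescoping series is dominated by a
    geometric one. *)
Lemma cvg_of_geometric (u : nat -> R) (C : R) :
  (forall k, 4 ^+ k * (u k.+1 - u k) ^+ 2 <= C) -> cvgn u.
Proof.
move=> hC.
have C0 : 0 <= C by apply: le_trans (hC 0%N); rewrite mulr_ge0// sqr_ge0.
have hn k : `|u k.+1 - u k| <= geometric (Num.sqrt C) (2^-1) k.
  rewrite /geometric /= -(@ler_pXn2r _ 2) ?nnegrE ?mulr_ge0 ?sqrtr_ge0 ?exprn_ge0//.
  rewrite real_normK ?num_real// exprMn sqr_sqrtr// exprAC exprVn.
  rewrite (_ : (2 ^+ 2 : R) = 4); last by ring.
  by rewrite exprVn ler_pdivlMr ?exprn_gt0// mulrC.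
have cs : cvgn (series (telescope u)).
  apply: (@normed_cvg R R^o); apply: (@series_le_cvg _ _ (geometric (Num.sqrt C) 2^-1)) => //=.
  apply: is_cvg_geometric_series; rewrite ger0_norm ?invr_ge0//.
  by rewrite invf_lt1// ltr1n.
rewrite (_ : u = cst (u 0%N) \+ series (telescope u)).
  by apply: is_cvgD => //; exact: is_cvg_cst.
by apply/funext => n; rewrite /= [LHS]eq_sum_telescope.
Qed.

(* Riesz-Fischer: along a fast subsequence [g] of [u], the integral of
   [\sum_k 4 ^+ k * (g k.+1 - g k) ^+ 2] is finite, so [g] converges a.e. *)
Lemma square_integrable_complete (u : nat -> T -> R) :
  (forall n, measurable_fun setT (u n)) ->
  (forall e : R, 0 < e -> exists N : nat, forall m n, (N <= m)%N -> (N <= n)%N ->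
     (energy (u m \- u n)%R <= e%:E)%E) ->
  exists2 f, measurable_fun setT f &
    forall e : R, 0 < e -> exists N : nat, forall n, (N <= n)%N ->
      (energy (u n \- f)%R <= e%:E)%E.
Proof.
move=> mu_ cu.
(* [(4 ^+ k)^-1] cancels the weight in [h] below, and the remaining factors sum to 1. *)
pose e_ k : R := (4 ^+ k)^-1 * (1 / (2 ^ k.+1)%:R).
have e_gt0 k : 0 < e_ k.
  by rewrite /e_ mulr_gt0 ?invr_gt0 ?exprn_gt0// divr_gt0// ltr0n expn_gt0.
have /choice[N hN] := fun k => cu (e_ k) (e_gt0 k).
(* A sum, so that [phi] is nondecreasing while [phi k] stays above both [N k] and [k]. *)
pose phi k := (\sum_(i < k.+1) (N i).+1)%N.
have Nphi k : (N k <= phi k)%N by rewrite /phi big_ord_recr/= addnS (leqW (leq_addl _ _)).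
have kphi k : (k <= phi k)%N.
  rewrite /phi -[X in (X <= _)%N]card_ord -sum1_card big_ord_recr/=.
  by rewrite (leq_trans _ (leq_addr _ _))//; apply: leq_sum.
have phiS k : (phi k <= phi k.+1)%N by rewrite /phi [leqRHS]big_ord_recr leq_addr.
pose g k := u (phi k).
have mg k : measurable_fun setT (g k) by exact: mu_.
have eg k : (energy (g k.+1 \- g k)%R <= (e_ k)%:E)%E.
  by apply: hN => //; rewrite (leq_trans (Nphi k)).
pose h k x : \bar R := (4 ^+ k * (g k.+1 x - g k x) ^+ 2)%:E.
have mh k : measurable_fun setT (h k).
  apply/measurable_EFinP; apply: measurable_funM => //.
  by apply: measurable_funX; exact: measurable_funB.
have h0 k x : (0 <= h k x)%E by rewrite lee_fin pmulr_rge0 ?exprn_gt0// sqr_ge0.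
pose H x : \bar R := (\sum_(0 <= k <oo) h k x)%E.
have mH : measurable_fun setT H by exact: ge0_emeasurable_sum.
have H0 x : (0 <= H x)%E by exact: nneseries_ge0.
have iH : (\int[mu]_x H x <= 1)%E.
  rewrite integral_nneseries//.
  apply: (@le_trans _ _ (\sum_(0 <= k <oo) (1 / (2 ^ k.+1)%:R)%:E)%E).
    apply: lee_nneseries => [k _ _|k _]; first exact: integral_ge0.
    rewrite /h; under eq_integral do rewrite EFinM.
    rewrite ge0_integralZl ?lee_fin ?exprn_ge0//; last 2 first.
    - by apply: measurable_EFin_sqr; exact: measurable_funB.
    - by move=> x _; rewrite lee_fin sqr_ge0.
    have := eg k; rewrite /energy /= => egk.
    apply: (le_trans (lee_wpmul2l _ egk)); first by rewrite lee_fin exprn_ge0.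
    by rewrite -EFinM lee_fin /e_ mulVKf// gt_eqF// exprn_gt0.
  by rewrite epsilon_trick0.
pose E := [set x | H x \is a fin_num].
have mE : measurable E.
  by rewrite -[E]setTI; exact: emeasurable_fin_num.
have aeE : {ae mu, forall x, E x}.
  have : mu.-integrable setT H.
    apply/integrableP; split => //; under eq_integral do rewrite gee0_abs//.
    by rewrite (le_lt_trans iH)// ltry.
  by move=> /(integrable_ae measurableT); apply: filterS => x; apply.
have cg x : E x -> cvgn (g ^~ x).
  move=> Ex; apply: (@cvg_of_geometric _ (fine (H x))) => k.
  rewrite -lee_fin fineK//.
  apply: le_trans (nneseries_lim_ge k.+1 _) => //.
  by rewrite big_nat_recr//= leeDr// sume_ge0.
(* Truncating to [E] makes the limit exist at every point, so that [f] is measurable as a pointwise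
   limit. *)
pose f x := limn (fun k => (g k \_ E) x).
have cgE x : (g k \_ E) x @[k --> \oo] --> f x.
  rewrite /f; have [xE|xE] := pselect (E x).
    rewrite (_ : (fun k => (g k \_ E) x) = g ^~ x); last first.
      by apply/funext => k; rewrite patchE mem_set.
    exact: cg.
  rewrite (_ : (fun k => (g k \_ E) x) = cst 0); last first.
    by apply/funext => k; rewrite patchE memNset.
  exact: is_cvg_cst.
have mf : measurable_fun setT f.
  apply: (@measurable_fun_cvg _ _ _ setT (fun k => g k \_ E)) => // k.
  by apply/(measurable_restrictT _ mE); exact: measurable_funTS.
exists f => // e e0; have [M hM] := cu e e0; exists M => n Mn.
pose F k x : \bar R := ((u n x - g k x) ^+ 2)%:E.
have mF k : measurable_fun setT (F k).
  by apply: measurable_EFin_sqr; exact: measurable_funB.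
have F0 k x : (0 <= F k x)%E by rewrite lee_fin sqr_ge0.
(* Almost everywhere the integrand is the lower limit of [F k], so Fatou's lemma bounds its integral
   by the lower limit of the energies of [u n - g k], at most [e] as soon as [n] and [k] exceed
   [M]. *)
rewrite /energy (@ge0_ae_eq_integral _ _ _ _ _ _ (fun x => limn_einf (F ^~ x)))//; last 5 first.
- by apply: measurable_EFin_sqr; exact: measurable_funB.
- rewrite /limn_einf; apply: measurableT_comp => //.
  by apply: measurable_fun_limn_esup => k; exact: measurableT_comp.
- by move=> x _; rewrite lee_fin sqr_ge0.
- move=> x _; rewrite limn_einf_lim; apply: lime_ge; first exact: is_cvg_einfs.
  by apply: nearW => k; apply: le_ereal_inf_tmp => _ [p _ <-].
- apply: filterS aeE => x Ex _.
  have gf : (g k x) @[k --> \oo] --> f x.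
    have := cgE x; rewrite (_ : (fun k => (g k \_ E) x) = g ^~ x)//.
    by apply/funext => k; rewrite patchE mem_set.
  have : F k x @[k --> \oo] --> ((u n x - f x) ^+ 2)%:E.
    apply: cvg_EFin; first exact: nearW.
    have c : (u n x - g k x) @[k --> \oo] --> u n x - f x.
      by apply: cvgB => //; exact: cvg_cst.
    exact: (cvgM c c).
  by move/cvg_limn_einf_sup => [-> _].
apply: le_trans (fatou _ _ _ _) _ => //.
rewrite limn_einf_lim; apply: lime_le; first exact: is_cvg_einfs.
exists M => // p /= Mp; apply: (@le_trans _ _ (\int[mu]_x F (maxn p M) x)%E).
  by apply: ereal_inf_lbound; exists (maxn p M) => //=; exact: leq_maxl.
by apply: hM => //; apply: leq_trans (kphi _); exact: leq_maxr.
Qed.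

End SquareIntegrable.

#[global] Arguments leb3 : simpl never.

Lemma lee1n2 (R : realType) : (1 <= 2%:E :> \bar R)%E.
Proof. by rewrite lee_fin ler1n. Qed.

Notation M3 R := (measurableTypeR R * measurableTypeR R * measurableTypeR R)%type.

Definition mfun3 {R : realType} (h : E3 R -> R) : Prop :=
  measurable_fun (setT : set (M3 R)) (h : M3 R -> R).

(** * Integrals over the domain and the L^2 product of fields *)

Section Integ.
Context {R : realType}.
Implicit Types (Omega : set (E3 R)) (f g h : E3 R -> R) (u v w : E3 R -> E3 R).

Lemma aeS (P Q : set (E3 R)) : (forall x, P x -> Q x) ->
  {ae leb3, forall x, P x} -> {ae leb3, forall x, Q x}.
Proof. exact: (@filterS _ _ (ae_filter_ringOfSetsType leb3)). Qed.

Lemma aeS2 (P Q S : set (E3 R)) : (forall x, P x -> Q x -> S x) ->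
  {ae leb3, forall x, P x} -> {ae leb3, forall x, Q x} -> {ae leb3, forall x, S x}.
Proof. exact: (@filterS2 _ _ (ae_filter_ringOfSetsType leb3)). Qed.

Lemma aeW (P : set (E3 R)) : (forall x, P x) -> {ae leb3, forall x, P x}.
Proof. exact: (@filterE _ _ (ae_filter_ringOfSetsType leb3)). Qed.

Definition L1 Omega h : Prop := leb3.-integrable setT (EFin \o (h \_ Omega)).

Lemma patchD Omega f g : (fun x => f x + g x) \_ Omega = f \_ Omega \+ g \_ Omega.
Proof. by apply/funext => x; rewrite /= !patchE; case: ifP => // _; rewrite addr0. Qed.

Lemma patchM Omega f g : (fun x => f x * g x) \_ Omega = f \_ Omega \* g \_ Omega.
Proof. by apply/funext => x; rewrite /= !patchE; case: ifP => // _; rewrite mulr0. Qed.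

Lemma patchZ Omega (a : R) f : (fun x => a * f x) \_ Omega = a \*o (f \_ Omega).
Proof. by apply/funext => x; rewrite /= !patchE; case: ifP => // _; rewrite mulr0. Qed.

Lemma integE Omega h : integ Omega h = \int[leb3]_x (h \_ Omega) x.
Proof. exact: Rintegral_mkcond. Qed.

Lemma eq_integ Omega f g : (forall x, Omega x -> f x = g x) ->
  integ Omega f = integ Omega g.
Proof. by move=> fg; apply: eq_Rintegral => x; rewrite inE; exact: fg. Qed.

Lemma integD Omega f g : L1 Omega f -> L1 Omega g ->
  integ Omega (fun x => f x + g x) = integ Omega f + integ Omega g.
Proof. by move=> f1 g1; rewrite !integE patchD RintegralD. Qed.

Lemma integZ Omega (a : R) f : L1 Omega f ->
  integ Omega (fun x => a * f x) = a * integ Omega f.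
Proof. by move=> f1; rewrite !integE patchZ RintegralZl. Qed.

Lemma integ0 Omega : integ Omega (fun=> 0 : R) = 0.
Proof. rewrite integE (_ : _ \_ _ = cst 0) ?Rintegral_cst// ?mul0r//.
by apply/funext => x; rewrite patchE; case: ifP. Qed.

Lemma L1D Omega f g : L1 Omega f -> L1 Omega g -> L1 Omega (fun x => f x + g x).
Proof.
move=> f1 g1; rewrite /L1 patchD.
exact: (integrableD measurableT f1 g1).
Qed.

Lemma L1Z Omega (a : R) f : L1 Omega f -> L1 Omega (fun x => a * f x).
Proof.
move=> f1; rewrite /L1 patchZ.
exact: (integrableZl measurableT a f1).
Qed.

Lemma integ_ae Omega f g : L1 Omega f -> L1 Omega g ->
  f = g %[ae leb3 in Omega] -> integ Omega f = integ Omega g.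
Proof.
move=> f1 g1 fg; rewrite !integE; congr fine; apply: ae_eq_integral => //.
- by case/integrableP : f1.
- by case/integrableP : g1.
apply: aeS fg => x fg _; rewrite /= !patchE; case: ifPn => //.
by rewrite inE => /fg ->.
Qed.

Lemma L2_mul Omega f g : L2 Omega f -> L2 Omega g -> L1 Omega (fun x => f x * g x).
Proof.
by move=> f2 g2; rewrite /L1 patchM; apply/Lfun1_integrable/Lfun2_mul_Lfun1.
Qed.

Lemma L2P Omega f :
  L2 Omega f <-> mfun3 (f \_ Omega) /\ (energy leb3 (f \_ Omega) < +oo)%E.
Proof. exact: Lfun2P. Qed.

Lemma L2_lin Omega (a : R) f g : L2 Omega f -> L2 Omega g ->
  L2 Omega (fun x => a * f x + g x).
Proof.
move=> f2 g2; rewrite /L2 /= patchD patchZ.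
have [_ h] := Lfun_submod_closed leb3 (lee1n2 R).
exact: h.
Qed.

Lemma L2B Omega f g : L2 Omega f -> L2 Omega g -> L2 Omega (fun x => f x - g x).
Proof.
move=> f2 g2; rewrite (_ : (fun x => _) = (fun x => -1 * g x + f x)); first exact: L2_lin.
by apply/funext => x; rewrite mulN1r addrC.
Qed.

Lemma L2_0 Omega : L2 Omega (fun=> 0 : R).
Proof.
have [h _] := Lfun_submod_closed leb3 (lee1n2 R).
rewrite /L2 /= (_ : _ \_ _ = 0)//.
by apply/funext => x; rewrite patchE; case: ifP.
Qed.

Definition l2dot Omega u v : R := integ Omega (fun x => dot (u x) (v x)).

Lemma L2v_dot Omega u v : L2v Omega u -> L2v Omega v ->
  L1 Omega (fun x => dot (u x) (v x)).
Proof. by move=> [? ? ?] [? ? ?]; do ![apply: L1D => //]; exact: L2_mul. Qed.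

Lemma dotC (x y : E3 R) : dot x y = dot y x.
Proof. rewrite /dot; ring. Qed.

Lemma dotPl (a : R) (x y z : E3 R) : dot (a *: x + y) z = a * dot x z + dot y z.
Proof.
have -> : a *: x + y =
  (a * x.1.1 + y.1.1, a * x.1.2 + y.1.2, a * x.2 + y.2) by [].
rewrite /dot /=; ring.
Qed.

Lemma dot_ge0 (x : E3 R) : 0 <= dot x x.
Proof. by rewrite /dot !addr_ge0 // -expr2 sqr_ge0. Qed.

Lemma l2dotC Omega u v : l2dot Omega u v = l2dot Omega v u.
Proof. by apply: eq_integ => x _; exact: dotC. Qed.

Lemma l2dotPl Omega (a : R) u v w : L2v Omega u -> L2v Omega v -> L2v Omega w ->
  l2dot Omega (a *: u + v) w = a * l2dot Omega u w + l2dot Omega v w.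
Proof.
move=> hu hv hw; rewrite /l2dot -integZ -?integD//; last 3 first.
- by apply: L1Z; exact: L2v_dot.
- exact: L2v_dot.
- exact: L2v_dot.
by apply: eq_integ => x _; rewrite -dotPl.
Qed.

Lemma l2dot_ge0 Omega u : 0 <= l2dot Omega u u.
Proof. by apply: Rintegral_ge0 => x _; exact: dot_ge0. Qed.

Lemma L2v_submod Omega : submod_closed [pred u | `[< L2v Omega u >]].
Proof.
split; first by apply/asboolP; split; exact: L2_0.
move=> a u v /asboolP[u1 u2 u3] /asboolP[v1 v2 v3]; apply/asboolP.
by split; exact: L2_lin.
Qed.

Lemma norm2E Omega f : L2 Omega f -> norm2 Omega f = Num.sqrt (integ Omega (fun x => f x ^+ 2)).
Proof.
move=> /L2P[mf ef]; rewrite /norm2 Lnorm2E integE.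
rewrite (_ : (fun x => f x ^+ 2) \_ Omega = (fun x => (f \_ Omega) x ^+ 2)); last first.
  by apply/funext => x; rewrite !patchE; case: ifP => // _; rewrite expr0n.
rewrite /Rintegral -/(energy leb3 (f \_ Omega)).
rewrite -[energy _ _]fineK ?ge0_fin_numE ?energy_ge0//=.
by rewrite powR12_sqrt// fine_ge0// energy_ge0.
Qed.

Lemma norm2vE Omega u : L2v Omega u -> norm2v Omega u = Num.sqrt (l2dot Omega u u).
Proof.
move=> hu; rewrite /norm2v /norm2 Lnorm2E.
have -> : energy leb3 ((@enorm R \o u) \_ Omega) =
    (\int[leb3]_x (((fun x => dot (u x) (u x)) \_ Omega) x)%:E)%E.
  apply: eq_integral => x _; rewrite !patchE; case: ifP => _ /=.
    by rewrite sqr_sqrtr// dot_ge0.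
  by rewrite expr0n.
rewrite /l2dot integE /Rintegral.
have fn : (\int[leb3]_x (((fun x => dot (u x) (u x)) \_ Omega) x)%:E)%E \is a fin_num.
  exact: integrable_fin_num (L2v_dot hu hu).
rewrite -(fineK fn)//= powR12_sqrt// fine_ge0//; apply: integral_ge0 => x _.
by rewrite lee_fin patchE; case: ifP => // _; exact: dot_ge0.
Qed.

Lemma norm2v_sqr Omega u : L2v Omega u -> norm2v Omega u ^+ 2 = l2dot Omega u u.
Proof. by move=> hu; rewrite norm2vE// sqr_sqrtr// l2dot_ge0. Qed.

Lemma l2dot_ae Omega u v w : L2v Omega u -> L2v Omega v -> L2v Omega w ->
  u = v %[ae leb3 in Omega] -> l2dot Omega u w = l2dot Omega v w.
Proof.
move=> hu hv hw uv; apply: integ_ae; [exact: L2v_dot|exact: L2v_dot|].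
by apply: aeS uv => x uv Ox; rewrite uv.
Qed.

Lemma l2dot_eq0 Omega u : L2v Omega u -> l2dot Omega u u = 0 ->
  u = cst 0 %[ae leb3 in Omega].
Proof.
move=> hu; rewrite /l2dot integE => u0.
have i1 := L2v_dot hu hu.
have [mi _] := integrableP _ _ _ i1.
have /(ae_eq_integral_abs leb3 measurableT mi) :
    (\int[leb3]_x `|(EFin \o ((fun x => dot (u x) (u x)) \_ Omega)) x| = 0)%E.
  move: u0; rewrite /Rintegral => /eqP.
  rewrite fine_eq0; last exact: integrable_fin_num i1.
  move=> /eqP <-; apply: eq_integral => x _ /=.
  rewrite ger0_norm// patchE; case: ifP => // _; exact: dot_ge0.
apply: aeS => x /(_ I) /=; rewrite patchE => /[swap] Ox.
rewrite mem_set// => -[]; rewrite /dot => /eqP.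
rewrite paddr_eq0 ?addr_ge0// -?expr2 ?sqr_ge0//.
rewrite paddr_eq0 ?sqr_ge0// !sqrf_eq0.
move=> /andP[/andP[/eqP h1 /eqP h2] /eqP h3].
by rewrite [u x]surjective_pairing [(u x).1]surjective_pairing h1 h2 h3.
Qed.

End Integ.

(** * The semi-Hilbert space of square-integrable fields *)

Section L2Space.
Context {R : realType}.
Implicit Type Omega : set (E3 R).

Definition L2v_pred Omega : {pred E3 R -> E3 R} := [pred u | `[< L2v Omega u >]].

HB.instance Definition _ Omega :=
  GRing.isSubmodClosed.Build R (E3 R -> E3 R) (L2v_pred Omega) (L2v_submod Omega).

(** Functions, not classes: two fields equal almost everywhere remain distinct elements, and
    [l2ip u u = 0] only says that [u] vanishes almost everywhere on [Omega]. *)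
Record L2sp Omega := MkL2sp { l2val :> E3 R -> E3 R; _ : l2val \in L2v_pred Omega }.

HB.instance Definition _ Omega := [isSub for @l2val Omega].
HB.instance Definition _ Omega := gen_eqMixin (L2sp Omega).
HB.instance Definition _ Omega := gen_choiceMixin (L2sp Omega).
HB.instance Definition _ Omega := [SubChoice_isSubLmodule of L2sp Omega by <:].

Variable Omega : set (E3 R).

Lemma L2spP (u : L2sp Omega) : L2v Omega u.
Proof. by case: u => u /= /asboolP. Qed.

Definition mkL2 (u : E3 R -> E3 R) (hu : L2v Omega u) : L2sp Omega :=
  MkL2sp (introT (asboolP _) hu : u \in L2v_pred Omega).

Lemma l2val_lin (a : R) (u v : L2sp Omega) :
  (a *: u + v : L2sp Omega) = (a *: (u : E3 R -> E3 R) + v) :> (E3 R -> E3 R).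
Proof. by []. Qed.

Definition l2ip (u v : L2sp Omega) : R := l2dot Omega u v.

Lemma l2ip_semi : semi_inner l2ip.
Proof.
split=> [a x y z|x y|x]; last exact: l2dot_ge0.
- by rewrite /l2ip l2val_lin l2dotPl//; exact: L2spP.
- exact: l2dotC.
Qed.

Lemma integ_sqrE (f : E3 R -> R) : L2 Omega f ->
  ((integ Omega (fun x => f x ^+ 2))%:E = energy leb3 (f \_ Omega))%E.
Proof.
move=> /[dup] f2 /L2P[mf ef].
rewrite integE (_ : (fun x => f x ^+ 2) \_ Omega = (fun x => (f \_ Omega) x ^+ 2)); last first.
  by apply/funext => x; rewrite !patchE; case: ifP => // _; rewrite expr0n.
by rewrite /Rintegral fineK// ge0_fin_numE// energy_ge0.
Qed.

Hypothesis mO : measurable (Omega : set (M3 R)).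

(** The limit of the extensions by zero need not vanish off [Omega]; cutting it off there only
    decreases its distance to them. *)
Lemma L2_complete (f : nat -> E3 R -> R) :
  (forall n, L2 Omega (f n)) ->
  (forall e : R, 0 < e -> exists N : nat, forall m n, (N <= m)%N -> (N <= n)%N ->
     integ Omega (fun x => (f m x - f n x) ^+ 2) <= e) ->
  exists2 g, L2 Omega g & forall e : R, 0 < e -> exists N : nat, forall n, (N <= n)%N ->
     integ Omega (fun x => (f n x - g x) ^+ 2) <= e.
Proof.
move=> f2 cf.
have pB (g h : E3 R -> R) : (fun x => g x - h x) \_ Omega = (g \_ Omega) \- (h \_ Omega).
  by apply/funext => x; rewrite /= !patchE; case: ifP => // _; rewrite subr0.
have [||g mg hg] := @square_integrable_complete _ _ _ leb3 (fun n => f n \_ Omega).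
- by move=> n; case/L2P : (f2 n).
- move=> e e0; have [N hN] := cf e e0; exists N => m n mN nN.
  by rewrite -pB -integ_sqrE ?lee_fin ?hN//; exact: L2B.
have mfn n : mfun3 (f n \_ Omega) by case/L2P : (f2 n).
(* One term at finite distance from the limit suffices for the limit to have finite energy. *)
have [N1 hN1] := hg 1 ltr01.
have mgO : mfun3 (g \_ Omega).
  by apply/(measurable_restrictT _ mO); exact: measurable_funTS.
have le_n n : (energy leb3 ((f n \_ Omega) \- (g \_ Omega))%R
    <= energy leb3 ((f n \_ Omega) \- g)%R)%E.
  apply: ge0_le_integral => //.
  - by move=> x _; rewrite lee_fin sqr_ge0.
  - by apply: measurable_EFin_sqr; exact: (measurable_funB (mfn n) mgO).
  - by apply: measurable_EFin_sqr; exact: (measurable_funB (mfn n) mg).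
  move=> x _; rewrite lee_fin /= !patchE; case: ifP => // _.
  by rewrite subr0 expr0n sqr_ge0.
have g2 : L2 Omega g.
  apply/L2P; split => //.
  have -> : g \_ Omega = (f N1 \_ Omega) \+ \- ((f N1 \_ Omega) \- (g \_ Omega)).
    by apply/funext => x /=; ring.
  have mN : mfun3 (\- ((f N1 \_ Omega) \- (g \_ Omega))).
    by apply: measurableT_comp => //; exact: (measurable_funB (mfn N1) mgO).
  apply: (le_lt_trans (energyD2 leb3 (mfn N1) mN)).
  have -> : energy leb3 (\- ((f N1 \_ Omega) \- (g \_ Omega))) =
            energy leb3 ((f N1 \_ Omega) \- (g \_ Omega))%R.
    by apply: eq_integral => x _ /=; rewrite sqrrN.
  apply: lte_add_pinfty; apply: lte_mul_pinfty => //.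
    by case/L2P : (f2 N1).
  apply: (le_lt_trans (le_n N1)); apply: (le_lt_trans (hN1 N1 (leqnn _))).
  exact: ltry.
exists g => // e e0; have [N hN] := hg e e0; exists N => n nN.
rewrite -lee_fin integ_sqrE; last exact: L2B.
by rewrite pB (le_trans (le_n n))// hN.
Qed.

Lemma integ_ge0 (f : E3 R -> R) : (forall x, 0 <= f x) -> 0 <= integ Omega f.
Proof. by move=> f0; exact: Rintegral_ge0. Qed.

Lemma l2ip_complete : complete_on l2ip setT.
Proof.
move=> u _ cu.
have L1q (g h : E3 R -> R) : L2 Omega g -> L2 Omega h -> L1 Omega (fun x => (g x - h x) ^+ 2).
  by move=> g2 h2; apply: L2_mul; exact: L2B.
have ipB (a b : E3 R -> E3 R) : L2v Omega a -> L2v Omega b ->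
    l2dot Omega (a - b) (a - b) =
    integ Omega (fun x => ((a x).1.1 - (b x).1.1) ^+ 2) +
    integ Omega (fun x => ((a x).1.2 - (b x).1.2) ^+ 2) +
    integ Omega (fun x => ((a x).2 - (b x).2) ^+ 2).
  move=> [a1 a2 a3] [b1 b2 b3].
  rewrite -integD; [|exact: L1q|exact: L1q].
  rewrite -integD; [|by apply: L1D; exact: L1q|exact: L1q].
  by apply: eq_integ => x _; rewrite !expr2.
have cc (pr : E3 R -> R) : (forall n, L2 Omega (fun x => pr (u n x))) ->
    (forall m n, integ Omega (fun x => (pr (u m x) - pr (u n x)) ^+ 2) <=
       l2ip (u m - u n) (u m - u n)) ->
    exists2 g, L2 Omega g & forall e : R, 0 < e ->
      exists N : nat, forall n, (N <= n)%N ->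
        integ Omega (fun x => (pr (u n x) - g x) ^+ 2) <= e.
  move=> pr2 le; apply: L2_complete => // e e0; have [N hN] := cu e e0.
  by exists N => m n mN nN; rewrite (le_trans (le m n)) ?hN.
have sq0 (g h : E3 R -> R) : 0 <= integ Omega (fun x => (g x - h x) ^+ 2).
  by apply: integ_ge0 => x; exact: sqr_ge0.
have [|m n|g1 g12 h1] := cc (fun x => x.1.1).
- by move=> n; case: (L2spP (u n)).
- rewrite /l2ip ipB; [|exact: L2spP|exact: L2spP].
  by rewrite -addrA lerDl addr_ge0.
have [|m n|g2 g22 h2] := cc (fun x => x.1.2).
- by move=> n; case: (L2spP (u n)).
- rewrite /l2ip ipB; [|exact: L2spP|exact: L2spP].
  by rewrite addrAC lerDr addr_ge0.
have [|m n|g3 g32 h3] := cc (fun x => x.2).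
- by move=> n; case: (L2spP (u n)).
- rewrite /l2ip ipB; [|exact: L2spP|exact: L2spP].
  by rewrite lerDr addr_ge0.
have gL : L2v Omega (fun x => (g1 x, g2 x, g3 x)) by split.
exists (mkL2 gL) => // e e0.
have e3 : 0 < e / 3 by rewrite divr_gt0.
have [N1 hN1] := h1 _ e3; have [N2 hN2] := h2 _ e3; have [N3 hN3] := h3 _ e3.
exists (maxn N1 (maxn N2 N3)) => n; rewrite !geq_max => /and3P[n1 n2 n3].
rewrite /l2ip ipB//; last exact: L2spP.
by have := hN1 _ n1; have := hN2 _ n2; have := hN3 _ n3 => /=; lra.
Qed.

End L2Space.

(** * Products with essentially bounded fields *)

Section Cross.
Context {R : realType}.
Implicit Types (Omega : set (E3 R)) (f g : E3 R -> R) (u v beta : E3 R -> E3 R).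

Lemma integ_le_ae Omega f g : L1 Omega f -> L1 Omega g ->
  {ae leb3, forall x, Omega x -> f x <= g x} -> integ Omega f <= integ Omega g.
Proof.
move=> f1 g1 fg; pose h x := g x + (-1) * f x.
have h1 : L1 Omega h by apply: L1D => //; exact: L1Z.
have n1 : L1 Omega (fun x => `|h x|).
  have := integrable_abse h1; apply: eq_integrable => // x _ /=.
  by rewrite !patchE; case: ifP => // _; rewrite normr0.
have : integ Omega h = integ Omega (fun x => `|h x|).
  apply: integ_ae => //; apply: aeS fg => x fg Ox.
  by rewrite ger0_norm// /h mulN1r subr_ge0 fg.
rewrite integD//; last exact: L1Z.
rewrite integZ// => e; rewrite -subr_ge0 -mulN1r e.
by apply: Rintegral_ge0 => x _.
Qed.

Lemma Linf_bound Omega g : Linf Omega g ->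
  {ae leb3, forall x, Omega x -> `|g x| <= norm_inf Omega g}.
Proof.
rewrite /Linf /norm_inf /= inE => /andP[_]; rewrite inE /= /finite_norm unlock.
case: ifPn => [m0 fin|m0 _].
  have := ess_sup_ge leb3 (abse \o (EFin \o (g \_ Omega))).
  have : ess_sup leb3 (abse \o (EFin \o (g \_ Omega))) \is a fin_num.
    rewrite ge0_fin_numE//; apply: ess_sup_gee => //.
    by apply: aeW => x /=; rewrite lee_fin.
  move=> fn; apply: aeS => x /=; rewrite -{1}(fineK fn) lee_fin patchE.
  by move=> + Ox; rewrite mem_set.
(* The remaining case is that of a null whole space, where the norm is 0 by convention and [setT]
   itself serves as exceptional set. *)
exists setT; split => //; apply/eqP; rewrite -measure_le0 leNgt //.
Qed.

Lemma L2_Linf_mul Omega f g : L2 Omega f -> Linf Omega g ->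
  L2 Omega (fun x => f x * g x).
Proof.
move=> /[dup] f2 /L2P[mf ef] /[dup] gi; rewrite /Linf /= inE => /andP[mg _].
have {}mg : mfun3 (g \_ Omega) by move: mg; rewrite inE.
apply/L2P; rewrite patchM; split; first exact: (measurable_funM mf mg).
pose B := norm_inf Omega g.
apply: (@le_lt_trans _ _ ((B ^+ 2)%:E * energy leb3 (f \_ Omega))%E); last first.
  by apply: lte_mul_pinfty => //; rewrite lee_fin sqr_ge0.
rewrite /energy -ge0_integralZl//; last 3 first.
- exact: measurable_EFin_sqr.
- by move=> x _; rewrite lee_fin sqr_ge0.
- by rewrite lee_fin sqr_ge0.
apply: ae_ge0_le_integral => //.
- by move=> x _; rewrite lee_fin sqr_ge0.
- by apply: measurable_EFin_sqr; exact: (measurable_funM mf mg).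
- by move=> x _; rewrite mule_ge0// lee_fin sqr_ge0.
- by apply: measurable_funeM; exact: measurable_EFin_sqr.
apply: aeS (Linf_bound gi) => x h _; rewrite -EFinM lee_fin /= !patchE.
case: ifPn => [|_]; last by rewrite mul0r expr0n mulr0.
rewrite inE => /h h'; rewrite exprMn mulrC ler_wpM2r ?sqr_ge0//.
by rewrite -[leLHS]real_normK ?num_real// ler_pXn2r ?nnegrE// (le_trans _ h').
Qed.

(** Lagrange's identity: the difference of the two sides is [dot x y ^+ 2]. *)
Lemma cross_sqr (x y : E3 R) : dot (cross x y) (cross x y) <= dot x x * dot y y.
Proof.
rewrite -subr_ge0 [X in 0 <= X](_ : _ = dot x y ^+ 2) ?sqr_ge0//.
rewrite /dot /cross /=; ring.
Qed.

Lemma L2v_cross Omega u beta : L2v Omega u -> Linfv Omega beta ->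
  L2v Omega (fun x => cross (u x) (beta x)).
Proof.
by move=> [u1 u2 u3] [b1 b2 b3]; split; apply: L2B; exact: L2_Linf_mul.
Qed.

Lemma norm_inf_ge0 Omega g : 0 <= norm_inf Omega g.
Proof. by rewrite /norm_inf fine_ge0//; exact: Lnorm_ge0. Qed.

Lemma norm_infv_ge0 Omega beta : 0 <= norm_infv Omega beta.
Proof. by rewrite /norm_infv !le_max norm_inf_ge0. Qed.

(* The factor 3 accounts for [norm_infv] being a maximum over components. *)
Lemma l2dot_cross_le Omega u beta : L2v Omega u -> Linfv Omega beta ->
  l2dot Omega (fun x => cross (u x) (beta x)) (fun x => cross (u x) (beta x)) <=
  3 * norm_infv Omega beta ^+ 2 * l2dot Omega u u.
Proof.
move=> hu hb; have hc := L2v_cross hu hb; rewrite -integZ; last exact: L2v_dot.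
apply: integ_le_ae; [exact: L2v_dot|by apply: L1Z; exact: L2v_dot|].
case: hb => b1 b2 b3.
apply: (aeS2 _ (Linf_bound b1)) => [x h1 h23|]; last first.
  by apply: (aeS2 _ (Linf_bound b2) (Linf_bound b3)) => x h2 h3; exact: conj h2 h3.
move=> Ox; case: h23 => /(_ Ox) h2 /(_ Ox) h3; move/(_ Ox) : h1 => h1.
apply: (le_trans (cross_sqr _ _)); rewrite mulrC ler_wpM2r ?dot_ge0//.
set B := norm_infv _ _; have B0 : 0 <= B by exact: norm_infv_ge0.
have sq (t : R) : `|t| <= B -> t * t <= B ^+ 2.
  by move=> tB; rewrite -expr2 -[leLHS]real_normK ?num_real// ler_pXn2r ?nnegrE.
have : (beta x).1.1 * (beta x).1.1 <= B ^+ 2.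
  by apply: sq; rewrite (le_trans h1)// /B /norm_infv !le_max lexx.
have : (beta x).1.2 * (beta x).1.2 <= B ^+ 2.
  by apply: sq; rewrite (le_trans h2)// /B /norm_infv !le_max lexx orbT.
have : (beta x).2 * (beta x).2 <= B ^+ 2.
  by apply: sq; rewrite (le_trans h3)// /B /norm_infv !le_max lexx !orbT.
rewrite /dot; lra.
Qed.

End Cross.

(** * Boxes, bump functions and the fundamental lemma *)

Section Boxes.
Context {R : realType}.
Implicit Types (a b x : E3 R) (U : set (E3 R)).

Definition box a b : set (E3 R) :=
  [set x | [/\ a.1.1 < x.1.1 < b.1.1, a.1.2 < x.1.2 < b.1.2 & a.2 < x.2 < b.2]].

Definition cbox a b : set (E3 R) :=
  [set x | [/\ a.1.1 <= x.1.1 <= b.1.1, a.1.2 <= x.1.2 <= b.1.2 & a.2 <= x.2 <= b.2]].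

Lemma sub_box_cbox a b : box a b `<=` cbox a b.
Proof.
by move=> x [/andP[? ?] /andP[? ?] /andP[? ?]]; split; apply/andP; split; exact: ltW.
Qed.

Lemma boxE a b : box a b = ((`]a.1.1, b.1.1[%classic `*` `]a.1.2, b.1.2[%classic)
   `*` `]a.2, b.2[%classic).
Proof.
by apply/seteqP; split => x /=; rewrite !in_itv /=; [case|case=> [[]]].
Qed.

Lemma cboxE a b : cbox a b = ((`[a.1.1, b.1.1]%classic `*` `[a.1.2, b.1.2]%classic)
   `*` `[a.2, b.2]%classic).
Proof.
by apply/seteqP; split => x /=; rewrite !in_itv /=; [case|case=> [[]]].
Qed.

Lemma measurable_box a b : measurable (box a b : set (M3 R)).
Proof. by rewrite boxE; apply: measurableX => //; exact: measurableX. Qed.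

Definition rat3 (q : rat * rat * rat) : E3 R := (ratr q.1.1, ratr q.1.2, ratr q.2).

(** Rational corners leave countably many boxes. The closed box is required in [U], since the bump
    functions of a box have their support in its closure. *)
Lemma open_box_sub U x : open U -> U x ->
  exists q : (rat * rat * rat) * (rat * rat * rat),
    cbox (rat3 q.1) (rat3 q.2) `<=` U /\ box (rat3 q.1) (rat3 q.2) x.
Proof.
move=> oU Ux; have : nbhs x U by exact: open_nbhs_nbhs.
rewrite -nbhs_ballE => -[e /= e0 eU].
have lo (t : R) : exists q : rat, t - e < ratr q < t.
  have := @rat_in_itvoo R (t - e) t; rewrite ltrBlDr ltrDl => /(_ e0)[q].
  by rewrite in_itv => h; exists q.
have hi (t : R) : exists q : rat, t < ratr q < t + e.
  have := @rat_in_itvoo R t (t + e); rewrite ltrDl => /(_ e0)[q].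
  by rewrite in_itv => h; exists q.
have [a1 /andP[a11 a12]] := lo x.1.1; have [a2 /andP[a21 a22]] := lo x.1.2.
have [a3 /andP[a31 a32]] := lo x.2.
have [b1 /andP[b11 b12]] := hi x.1.1; have [b2 /andP[b21 b22]] := hi x.1.2.
have [b3 /andP[b31 b32]] := hi x.2.
exists ((a1, a2, a3), (b1, b2, b3)); split; last by split; rewrite /= ?a12 ?a22 ?a32.
move=> y [/= /andP[h1 h2] /andP[h3 h4] /andP[h5 h6]]; apply: eU.
by split => /=; [split => /=|]; rewrite /ball /= ltr_norml; lra.
Qed.

Lemma open_box_cover U : open U -> U =
  \bigcup_(q : (rat * rat * rat) * (rat * rat * rat))
    (if `[< cbox (rat3 q.1) (rat3 q.2) `<=` U >] then box (rat3 q.1) (rat3 q.2) else set0).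
Proof.
move=> oU; apply/seteqP; split => [x Ux|x [q _]].
  by have [q [qU qx]] := open_box_sub oU Ux; exists q => //; rewrite asboolT.
by case: asboolP => // qU /sub_box_cbox; exact: qU.
Qed.

Lemma open_measurable3 U : open U -> measurable (U : set (M3 R)).
Proof.
move=> /open_box_cover ->; apply: countable_bigcupT_measurable => // q.
by case: ifP => _; [exact: measurable_box|exact: measurable0].
Qed.

Definition boxes : set (set (E3 R)) := [set B | exists a b, B = box a b].

Lemma box_setI a b a' b' : box a b `&` box a' b' =
  box (Num.max a.1.1 a'.1.1, Num.max a.1.2 a'.1.2, Num.max a.2 a'.2)
      (Num.min b.1.1 b'.1.1, Num.min b.1.2 b'.1.2, Num.min b.2 b'.2).
Proof.
rewrite /box; apply/seteqP; split => x /=; rewrite !gt_max !lt_min.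
  by move=> [[/andP[-> ->] /andP[-> ->] /andP[-> ->]] [/andP[-> ->] /andP[-> ->] /andP[-> ->]]].
by move=> [/andP[/andP[-> ->] /andP[-> ->]] /andP[/andP[-> ->] /andP[-> ->]]
  /andP[/andP[-> ->] /andP[-> ->]]].
Qed.

Lemma coord1_continuous : continuous (fun x : E3 R => x.1.1).
Proof. by move=> x; apply: cvg_comp; exact: cvg_fst. Qed.

Lemma coord2_continuous : continuous (fun x : E3 R => x.1.2).
Proof. by move=> x; apply: cvg_comp; [exact: cvg_fst|exact: cvg_snd]. Qed.

Lemma coord3_continuous : continuous (fun x : E3 R => x.2).
Proof. by move=> x; exact: cvg_snd. Qed.

Lemma affine_continuous (n : E3 R) (c : R) : continuous (fun x => dot n x + c).
Proof.
move=> x; apply: cvgD; last exact: cvg_cst.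
apply: cvgD; first apply: cvgD; apply: cvgM; try exact: cvg_cst.
- exact: coord1_continuous.
- exact: coord2_continuous.
- exact: coord3_continuous.
Qed.

(** An open set is a countable union of rational boxes, so the coordinates are measurable for the
    sigma-algebra generated by boxes; the product sigma-algebra is the smallest one with this
    property. *)
Lemma measurable_boxes : @measurable _ (M3 R) = <<s boxes >>.
Proof.
apply/seteqP; split; last first.
  apply: smallest_sub; first exact: sigma_algebra_measurable.
  by move=> _ [a [b ->]]; exact: measurable_box.
have openG U : open U -> <<s boxes >> U.
  move=> /open_box_cover ->.
  apply: (@countable_bigcupT_measurable _ (g_sigma_algebraType boxes)) => // q.
  case: ifP => _; last exact: (@measurable0 _ (g_sigma_algebraType boxes)).
  by apply: sub_gen_smallest; exists (rat3 q.1), (rat3 q.2).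
have pr (p : E3 R -> R) : continuous p ->
    measurable_fun (setT : set (g_sigma_algebraType boxes)) p.
  move=> cp; apply: (measurability _ (RGenOInfty.measurableE R)) => _ [_ [c ->] <-].
  rewrite setTI; apply: openG; apply: open_comp; last exact: rray_open.
  by move=> x _; exact: cp.
suff h : measurable_fun (setT : set (g_sigma_algebraType boxes)) (id : _ -> M3 R).
  by move=> A mA; have := h measurableT _ mA; rewrite setTI preimage_id.
apply/measurable_fun_pairP; split; first (apply/measurable_fun_pairP; split).
- exact: (pr _ coord1_continuous).
- exact: (pr _ coord2_continuous).
- exact: (pr _ coord3_continuous).
Qed.

Lemma continuous_mfun3 (f : E3 R -> R) : continuous f -> mfun3 f.
Proof.
move=> cf; apply: (measurability _ (RGenOInfty.measurableE R)) => _ [_ [c ->] <-].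
rewrite setTI; apply: open_measurable3; apply: open_comp; last exact: rray_open.
by move=> x _; exact: cf.
Qed.

(* By Dynkin, as the boxes are stable under intersection. *)
Lemma box_integral_eq0 (h : M3 R -> R) :
  leb3.-integrable setT (EFin \o h) ->
  (\int[leb3]_x (h x)%:E = 0)%E ->
  (forall a b, \int[leb3]_(x in box a b) (h x)%:E = 0)%E ->
  h = cst 0 %[ae leb3].
Proof.
move=> ih hT hb.
have E0 : forall S : set (M3 R), <<s boxes >> S -> (\int[leb3]_(x in S) (h x)%:E = 0)%E.
  apply: (dynkin_induction measurable_boxes) => //.
  - move=> _ _ [a [b ->]] [a' [b' ->]]; rewrite box_setI.
    by do 2 eexists.
  - by move=> _ [a [b ->]]; exact: hb.
  - move=> S mS S0; have := hT; rewrite -(setvU S) integral_setU_EFin//; last 3 first.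
    + exact: measurableC.
    + by rewrite setvU; case/integrableP: ih => /measurable_EFinP.
    + by rewrite disj_set2E setICl.
    by rewrite S0 adde0.
  - move=> F mF tF F0; rewrite integral_bigcup//.
      by rewrite eseries0// => k _ _; exact: F0.
    by apply: (integrableS _ _ _ ih) => //; exact: bigcup_measurable.
have := @integral_ae_eq _ _ _ leb3 setT measurableT (cst 0) (EFin \o h) ih.
have m0 : measurable_fun (setT : set (M3 R)) (cst 0 : M3 R -> \bar R) by [].
move=> /(_ m0) H.
have : ae_eq leb3 setT (EFin \o h) (cst 0%E).
  apply: H => E _ mE; rewrite integral0; apply: E0.
  by rewrite -measurable_boxes.
by apply: aeS => x /(_ I) [].
Qed.

End Boxes.

(** * Smooth bump functions and the fundamental lemma *)

Section Smooth.
Context {R : realType}.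
Implicit Types (x v : E3 R) (f g : E3 R -> R).

Lemma is_derive_line (V : normedModType R) (f : V -> R) (x v : V) (d : R) :
  is_derive (0 : R) (1 : R) (fun h : R => f (h *: v + x)) d -> is_derive x v f d.
Proof.
have e : (fun h : R => h^-1 *: ((f \o shift x) (h *: v) - f x)) =
    (fun h : R => h^-1 *: (((fun h : R => f (h *: v + x)) \o shift 0) (h *: 1) -
      f (0 *: v + x))).
  apply/funext => h; congr (_ *: (f _ - f _)); last by rewrite scale0r add0r.
  by rewrite /= addr0 [h *: 1]mulr1.
by move=> [dh <-]; split; [rewrite /derivable e|rewrite /derive e].
Qed.

Lemma is_derive_comp_line (phi : R -> R) (l : E3 R -> R) (x v : E3 R) (c d : R) :
  (forall h : R, l (h *: v + x) = l x + h * c) ->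
  is_derive (l x) (1 : R) phi d -> is_derive x v (phi \o l) (c * d).
Proof.
move=> hl hd; apply: is_derive_line.
rewrite (_ : (fun h => _) = phi \o (fun h : R => l x + h * c)); last first.
  by apply/funext => h /=; rewrite hl.
have hd' : is_derive (l x + 0 * c) (1 : R) phi d by rewrite mul0r addr0.
have dl : is_derive (0 : R) (1 : R) (fun h : R => l x + h * c) c.
  have := is_deriveD (is_derive_cst (l x) (0 : R) (1 : R))
    (is_deriveM (is_derive_id (0 : R) (1 : R)) (is_derive_cst c (0 : R) (1 : R))).
  by move=> h; apply: (is_derive_eq h); rewrite scaler0 !add0r [c *: 1]mulr1.
by have := @is_derive1_comp _ phi (fun h : R => l x + h * c) 0 _ _ hd' dl; rewrite mulrC.
Qed.

(** The invariant behind iterated derivatives: once the directional derivatives of the generators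
    lie in the algebra, so do those of all its members, by the sum and product rules. *)
Inductive smooth_alg (B : set (E3 R -> R)) : (E3 R -> R) -> Prop :=
| smooth_alg_base f : B f -> smooth_alg B f
| smooth_alg_cst (c : R) : smooth_alg B (cst c)
| smooth_alg_add f g : smooth_alg B f -> smooth_alg B g -> smooth_alg B (f \+ g)
| smooth_alg_mul f g : smooth_alg B f -> smooth_alg B g -> smooth_alg B (f \* g).

Lemma smooth_algP (B : set (E3 R -> R)) :
  (forall f, B f -> continuous f /\
     forall v, exists2 g, smooth_alg B g & forall x, is_derive x v f (g x)) ->
  forall f, smooth_alg B f -> smooth f.
Proof.
move=> hB.
have step f : smooth_alg B f -> continuous f /\
    forall v, exists2 g, smooth_alg B g & forall x, is_derive x v f (g x).
  elim=> [{}f /hB//|c|{}f g _ [cf df] ag [cg dg]|{}f g af [cf df] ag [cg dg]].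
  - split; first exact: cst_continuous.
    move=> v; exists (cst 0); first exact: smooth_alg_cst.
    by move=> x; exact: is_derive_cst.
  - split; first by move=> x; apply: continuousD; [exact: cf|exact: cg].
    move=> v; have [f' af' df'] := df v; have [g' ag' dg'] := dg v.
    exists (f' \+ g'); first exact: smooth_alg_add.
    by move=> x; exact: is_deriveD.
  - split; first by move=> x; apply: continuousM; [exact: cf|exact: cg].
    move=> v; have [f' af' df'] := df v; have [g' ag' dg'] := dg v.
    exists ((f \* g') \+ (g \* f')).
      by apply: smooth_alg_add; exact: smooth_alg_mul.
    by move=> x; exact: is_deriveM.
have it f s : smooth_alg B f -> smooth_alg B (iter_derive s f).
  move=> af; elim: s => [//|v s IH] /=.
  have [_ /(_ v)[g ag dg]] := step _ IH.
  rewrite (_ : (fun x => _) = g)//; apply/funext => x.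
  by have [] := dg x.
move=> f af s; have [cs ds] := step _ (it _ s af); split => // x v.
by have [g _ /(_ x)[]] := ds v.
Qed.

(* [flat 0] is the classical flat function; the family is closed under
   differentiation up to linear combinations. *)
Definition flat (n : nat) (t : R) : R :=
  if 0 < t then t^-1 ^+ n * expR (- t^-1) else 0.

(** From [exp s >= s ^ n.+1 / n.+1!] at [s = 1 / t]. The linear rate, used for [flat n.+1], is what
    gives [flat n] the derivative 0 at 0. *)
Lemma flat_bound n (t : R) : 0 <= t -> `|flat n t| <= n.+1`!%:R * t.
Proof.
rewrite le_eqVlt => /orP[/eqP <-|t0].
  by rewrite /flat ltxx normr0 mulr0.
have ti : 0 < t^-1 by rewrite invr_gt0.
rewrite /flat t0 ger0_norm; last by rewrite mulr_ge0 ?expR_ge0// exprn_ge0// ltW.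
rewrite expRN ler_pdivrMr ?expR_gt0//.
have := expR_ge1Dxn n (ltW ti).
set E := expR _ => h.
have : t^-1 ^+ n.+1 / n.+1`!%:R <= E by apply: le_trans h; rewrite lerDr.
rewrite ler_pdivrMr ?ltr0n ?fact_gt0// exprSr => h2.
have tn : t != 0 by rewrite gt_eqF.
move: h2; rewrite ler_pdivrMr// => h2; apply: (le_trans h2); rewrite le_eqVlt.
by apply/orP; left; apply/eqP; ring.
Qed.

Lemma flatS n (t : R) : 0 < t -> t^-1 * flat n t = flat n.+1 t.
Proof. by move=> t0; rewrite /flat t0 exprS mulrA. Qed.

Lemma is_derive_flat n (t : R) :
  is_derive t 1 (flat n) (flat n.+2 t - n%:R * flat n.+1 t).
Proof.
have [t0|t0|t0] := ltgtP t 0.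
- have e : {near t, cst 0 =1 flat n}.
    near=> y; rewrite /flat ifF//; apply/negbTE; rewrite -leNgt ltW//.
    by near: y; exact: lt_nbhsl.
  rewrite /flat !ifF ?(lt_gtF t0)// mulr0 subr0.
  apply: (near_eq_is_derive e); exact: is_derive_cst.
- have e : {near t, (fun y : R => y^-1 ^+ n * expR (- y^-1)) =1 flat n}.
    by near=> y; rewrite /flat ifT//; near: y; exact: lt_nbhsr.
  rewrite /flat !t0.
  apply: (near_eq_is_derive e) => //.
  have tn : t != 0 by rewrite gt_eqF.
  have d1 : is_derive t 1 (fun y : R => y^-1) (- t^-1 ^+ 2).
    have := is_deriveV tn (is_derive_id t 1).
    by move=> h; apply: (is_derive_eq h); rewrite [_ *: _]mulr1 exprVn.
  have d2 : is_derive t 1 (fun y : R => expR (- y^-1)) (expR (- t^-1) * t^-1 ^+ 2).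
    have := @is_derive1_comp _ expR (fun y : R => - y^-1) t _ _
      (is_derive_expR (- t^-1)) (is_deriveN d1).
    by rewrite opprK.
  have := is_deriveM (is_deriveX n d1) d2.
  rewrite exprfctE => h; apply: (is_derive_eq h); rewrite -![_ *: _]/(_ * _).
  case: n {e h} => [|n]; rewrite /= ?expr0 ?mul0r ?mulr0 ?exprS; ring.
(* At 0 the difference quotient is [flat n.+1 h] for positive [h] and 0 otherwise. *)
have lim0 : h^-1 *: ((flat n \o shift t) (h *: 1) - flat n t) @[h --> 0^'] --> (0 : R).
  rewrite t0; apply/cvgrPdist_le => e e0.
  near=> h; have hn : h != 0 by near: h; exact: nbhs_dnbhs_neq.
  rewrite sub0r normrN /= addr0 [h *: 1]mulr1 {2}/flat ltxx subr0.
  have [h0|h0] := ltP 0 h; last first.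
    by rewrite /flat ifF ?scaler0 ?normr0 ?(ltW e0)//; apply/negbTE; rewrite -leNgt.
  rewrite [_ *: _]flatS// (le_trans (flat_bound _ (ltW h0)))//.
  rewrite mulrC -ler_pdivlMr ?ltr0n ?fact_gt0// -[h]ger0_norm ?(ltW h0)//.
  near: h; apply: dnbhs0_le; rewrite divr_gt0// ltr0n fact_gt0//.
rewrite [X in is_derive _ _ _ X](_ : _ = 0); last first.
  by rewrite t0 /flat ltxx mulr0 subr0.
split; first by apply/cvg_ex; exists 0.
exact/cvg_lim.
Unshelve. all: by end_near.
Qed.

Lemma flat_continuous n : continuous (flat n).
Proof.
move=> t; apply: differentiable_continuous; apply/derivable1_diffP.
by have [] := is_derive_flat n t.
Qed.

Lemma flat_le1 (t : R) : 0 <= flat 0 t <= 1.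
Proof.
rewrite /flat; case: ifP => t0; last by rewrite lexx ler01.
by rewrite expr0 mul1r expR_ge0 expR_le1 oppr_le0 invr_ge0 ltW.
Qed.

Lemma flat_neq0 (t : R) : (flat 0 t != 0) = (0 < t).
Proof.
rewrite /flat; case: ifP => t0; last by rewrite eqxx.
by rewrite expr0 mul1r gt_eqF// expR_gt0.
Qed.

Lemma flat_cvg (t : R) :
  flat 0 (n.+1%:R * t) @[n --> \oo] --> (if 0 < t then 1 else 0 : R).
Proof.
case: ifPn => [t0|t0]; last first.
  rewrite (_ : (fun n => _) = cst 0); first exact: cvg_cst.
  apply/funext => n; rewrite /flat ifF//; apply/negbTE.
  by rewrite pmulr_rgt0 ?ltr0n.
rewrite (_ : (fun n => _) = (fun n => expR (- (t^-1 * n.+1%:R^-1)))); last first.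
  apply/funext => n; rewrite /flat pmulr_rgt0 ?ltr0n// t0 expr0 mul1r invfM.
  by rewrite mulrC.
rewrite -[X in _ --> X](@expR0 R); apply: continuous_cvg; first exact: continuous_expR.
rewrite -[X in _ --> X]oppr0 -[X in _ --> - X](mulr0 (t^-1)).
apply: cvgN; apply: cvgM; first exact: cvg_cst.
exact: cvg_harmonic.
Qed.

(** One flat factor per face of the box, positive exactly on its inner side. The growing slope makes
    [hat N] tend to the indicator of the open box, and the successor keeps the slope positive at
    [N = 0]. *)
Definition hat (N : nat) (a b : E3 R) (x : E3 R) : R :=
  flat 0 (N.+1%:R * (x.1.1 - a.1.1)) * flat 0 (N.+1%:R * (b.1.1 - x.1.1)) *
  (flat 0 (N.+1%:R * (x.1.2 - a.1.2)) * flat 0 (N.+1%:R * (b.1.2 - x.1.2))) *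
  (flat 0 (N.+1%:R * (x.2 - a.2)) * flat 0 (N.+1%:R * (b.2 - x.2))).

Lemma smooth_hat N a b : smooth (hat N a b).
Proof.
(* Flat functions of affine forms, for all [n] at once: differentiation raises [n] but leaves the
   affine form unchanged. *)
pose B : set (E3 R -> R) := [set f | exists n (c : R) (w : E3 R),
  f = flat n \o (fun x => c + dot w x)].
apply: (@smooth_algP B) => [_ [n [c [w ->]]]|].
  have hl x v (h : R) : c + dot w (h *: v + x) = c + dot w x + h * dot w v.
    have -> : h *: v + x =
      (h * v.1.1 + x.1.1, h * v.1.2 + x.1.2, h * v.2 + x.2) by [].
    rewrite /dot /=; ring.
  split.
    have ca : continuous (fun x => c + dot w x).
      by under eq_fun do rewrite addrC; exact: affine_continuous.
    by move=> x; apply: continuous_comp; [exact: ca|exact: flat_continuous].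
  move=> v; exists (fun x => dot w v * (flat n.+2 (c + dot w x) -
     n%:R * flat n.+1 (c + dot w x))).
    rewrite (_ : (fun _ => _) = cst (dot w v) \* ((flat n.+2 \o (fun x => c + dot w x)) \+
       cst (- n%:R) \* (flat n.+1 \o (fun x => c + dot w x)))); last first.
      by apply/funext => x /=; rewrite mulNr.
    apply: smooth_alg_mul; first exact: smooth_alg_cst.
    apply: smooth_alg_add.
      by apply: smooth_alg_base; exists n.+2, c, w.
    apply: smooth_alg_mul; first exact: smooth_alg_cst.
    by apply: smooth_alg_base; exists n.+1, c, w.
  by move=> x; apply: is_derive_comp_line => // ; exact: is_derive_flat.
have bs (t : E3 R -> R) (c : R) (w : E3 R) : (forall x, t x = c + dot w x) ->
    smooth_alg B (fun x => flat 0 (t x)).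
  move=> ht; apply: smooth_alg_base; exists 0%N, c, w.
  by apply/funext => x /=; rewrite ht.
pose M : R := N.+1%:R.
rewrite /hat; apply: smooth_alg_mul; first apply: smooth_alg_mul; apply: smooth_alg_mul.
- by apply: (bs _ (- (M * a.1.1)) (M, 0, 0)) => x; rewrite /dot/= /M; ring.
- by apply: (bs _ (M * b.1.1) (- M, 0, 0)) => x; rewrite /dot/= /M; ring.
- by apply: (bs _ (- (M * a.1.2)) (0, M, 0)) => x; rewrite /dot/= /M; ring.
- by apply: (bs _ (M * b.1.2) (0, - M, 0)) => x; rewrite /dot/= /M; ring.
- by apply: (bs _ (- (M * a.2)) (0, 0, M)) => x; rewrite /dot/= /M; ring.
- by apply: (bs _ (M * b.2) (0, 0, - M)) => x; rewrite /dot/= /M; ring.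
Qed.

Lemma hat_neq0 N a b x : (hat N a b x != 0) -> box a b x.
Proof.
rewrite /hat !mulf_eq0 !negb_or !flat_neq0 !pmulr_rgt0 ?ltr0n// !subr_gt0.
by move=> /andP[/andP[h1 h2] h3]; split.
Qed.

Lemma cbox_compact a b : compact (cbox a b : set (E3 R)).
Proof.
by rewrite cboxE; apply: compact_setX; [apply: compact_setX|]; exact: segment_compact.
Qed.

Lemma testfun_hat (U : set (E3 R)) N a b : cbox a b `<=` U -> testfun U (hat N a b).
Proof.
move=> abU; have sub : supp (hat N a b) `<=` cbox a b.
  have cc : closed (cbox a b : set (E3 R)).
    by apply: compact_closed; [exact: norm_hausdorff|exact: cbox_compact].
  rewrite /supp [X in _ `<=` X](closure_id _).1//; apply: closure_subset => x.
  by move=> /hat_neq0; exact: sub_box_cbox.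
split; first exact: smooth_hat.
- apply: (@subclosed_compact _ _ (cbox a b : set (E3 R))) => //; last exact: cbox_compact.
  exact: closed_closure.
- exact: subset_trans sub abU.
Qed.

Lemma hat_le1 N a b x : 0 <= hat N a b x <= 1.
Proof.
have m (s t : R) : 0 <= s <= 1 -> 0 <= t <= 1 -> 0 <= s * t <= 1.
  by move=> /andP[s0 s1] /andP[t0 t1]; rewrite mulr_ge0//= mulr_ile1.
by rewrite /hat; apply: (m); [apply: (m)|]; apply: (m); exact: flat_le1.
Qed.

Lemma hat_cvg a b x : hat N a b x @[N --> \oo] --> (\1_(box a b) x : R).
Proof.
rewrite indicE (_ : _%:R = (if 0 < x.1.1 - a.1.1 then 1 else 0 : R) *
    (if 0 < b.1.1 - x.1.1 then 1 else 0) *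
   ((if 0 < x.1.2 - a.1.2 then 1 else 0) * (if 0 < b.1.2 - x.1.2 then 1 else 0)) *
   ((if 0 < x.2 - a.2 then 1 else 0) * (if 0 < b.2 - x.2 then 1 else 0))).
  by rewrite /hat; do ![apply: cvgM]; exact: flat_cvg.
have -> : (x \in box a b) = [&& a.1.1 < x.1.1 < b.1.1, a.1.2 < x.1.2 < b.1.2 & a.2 < x.2 < b.2].
  by apply/idP/idP; rewrite inE => /and3P.
rewrite !subr_gt0.
by do ![case: ifP => _]; rewrite /= ?(mulr0, mul0r, mulr1).
Qed.

(** Bump functions tend to indicators, so by dominated convergence [g] has zero integral over every
    box whose closure lies in [Omega]. Inside such a box [g] then vanishes almost everywhere, and
    countably many of them cover [Omega]. *)
Lemma fundamental_lemma (Omega : set (E3 R)) (g : E3 R -> R) :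
  open Omega -> L1 Omega g ->
  (forall phi, testfun Omega phi -> integ Omega (fun x => g x * phi x) = 0) ->
  g = cst 0 %[ae leb3 in Omega].
Proof.
move=> oO g1 hg.
pose G : M3 R -> R := g \_ Omega.
have iG : leb3.-integrable setT (EFin \o G) by [].
have mG : measurable_fun setT G by case/integrableP: iG => /measurable_EFinP.
have box0 a b : cbox a b `<=` Omega -> (\int[leb3]_(x in box a b) (G x)%:E = 0)%E.
  move=> abO.
  have mhat N : measurable_fun setT (hat N a b : M3 R -> R).
    have [ch _] := smooth_hat N a b [::].
    exact: (continuous_mfun3 ch).
  have hatG N x : (`|(G x * hat N a b x)%:E| <= `|(G x)%:E|)%E.
    rewrite lee_fin normrM ler_piMr//.
    by have /andP[h0 h1] := hat_le1 N a b x; rewrite ger0_norm.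
  have [|||||_ _] := @dominated_convergence _ _ _ leb3 setT measurableT
     (fun N x => (G x * hat N a b x)%:E) (fun x => (G x * \1_(box a b) x)%:E)
     (fun x => `|G x|%:E).
  - by move=> N; apply/measurable_EFinP; exact: measurable_funM.
  - apply/measurable_EFinP; apply: measurable_funM => //.
    by apply: measurable_indic; exact: measurable_box.
  - apply: aeW => x _; apply: cvg_EFin; first exact: nearW.
    by apply: cvgM; [exact: cvg_cst|exact: hat_cvg].
  - exact: integrable_abse iG.
  - by apply: aeW => x N _; exact: hatG.
  rewrite (_ : (fun N => _) = cst 0%E); last first.
    apply/funext => N /=; have := hg _ (testfun_hat N abO).
    have bd : leb3.-integrable setT (EFin \o (fun x => G x * hat N a b x)).
      apply: le_integrable iG => //; last by move=> x _; exact: hatG.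
      by apply/measurable_EFinP; exact: measurable_funM.
    rewrite integE (_ : _ \_ _ = fun x => G x * hat N a b x); last first.
      by apply/funext => x; rewrite /G !patchE; case: ifP => // _; rewrite mul0r.
    rewrite /Rintegral => /eqP; rewrite fine_eq0 => [/eqP //|].
    exact: integrable_fin_num bd.
  move=> /(cvg_unique (@ereal_hausdorff R)) /(_ (cvg_cst _)) /esym.
  move=> e0; rewrite [RHS]e0 [LHS]integral_mkcond; apply: eq_integral => x _.
  by rewrite !patchE indicE; case: ifP => _; rewrite (mulr1, mulr0).
have cover (q : (rat * rat * rat) * (rat * rat * rat)) :
    cbox (rat3 q.1) (rat3 q.2) `<=` Omega ->
    {ae leb3, forall x, box (rat3 q.1) (rat3 q.2) x -> g x = 0}.
  move=> qO; set a := rat3 q.1 in qO *; set b := rat3 q.2 in qO *.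
  have e D : (\int[leb3]_(x in D) ((G \_ (box a b)) x)%:E =
      \int[leb3]_(x in D `&` box a b) (G x)%:E)%E.
    by rewrite integral_mkcondr; apply: eq_integral => x _; rewrite !patchE; case: ifP.
  have : G \_ (box a b) = cst 0 %[ae leb3].
    apply: box_integral_eq0.
    - apply: le_integrable iG => //.
        apply/measurable_EFinP; apply/(measurable_restrictT _ (measurable_box a b)).
        exact: measurable_funTS.
      by move=> x _; rewrite /= lee_fin patchE; case: ifP; rewrite ?normr0.
    - by rewrite e setTI box0.
    - move=> a' b'; rewrite e setIC box_setI box0// => x [/=].
      rewrite !ge_max !le_min => /andP[/andP[h1 _] /andP[h2 _]].
      move=> /andP[/andP[h3 _] /andP[h4 _]] /andP[/andP[h5 _] /andP[h6 _]].
      by apply: qO; split; apply/andP.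
  apply: aeS => x + xb; rewrite patchE mem_set// /G patchE mem_set; first by apply.
  by apply: qO; exact: sub_box_cbox.
(* Numbering the rational boxes reduces the uncountable-looking quantifier to a countable
   intersection of full sets. *)
have : {ae leb3, forall x (n : nat),
    if unpickle n is Some q then cbox (rat3 q.1) (rat3 q.2) `<=` Omega ->
      box (rat3 q.1) (rat3 q.2) x -> g x = 0 else True}.
  apply/ae_foralln => n; case: unpickle => [q|]; last exact: aeW.
  have [qO|nqO] := pselect (cbox (rat3 q.1) (rat3 q.2) `<=` Omega); last exact: aeW.
  by apply: aeS (cover _ qO).
apply: aeS => x gx Ox; have [q [qO qx]] := open_box_sub oO Ox.
by have := gx (pickle q); rewrite pickleK; apply.
Qed.

End Smooth.

(** * Integration by parts against test functions *)

Section Plane.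
Context {R : realType}.
Notation mu1 := (@lebesgue_measure R).

(* [mu1 \x mu1] has no canonical structure of sigma-finite measure (the
   instance for subprobabilities shadows the general one). *)
Definition leb2 : set (measurableTypeR R * measurableTypeR R)%type -> \bar R :=
  (mu1 \x mu1)%E.

HB.instance Definition _ := Measure.copy leb2 (mu1 \x mu1)%E.

Lemma leb2_sigma_finite : sigma_finite setT leb2.
Proof.
have /sigma_finiteP[F [TF ndF Foo]] := sigma_finiteT mu1.
exists (fun n => F n `*` F n).
  rewrite -setXTT TF predeqE => -[x y]; split.
    move=> [/= [n _ Fnx] [k _ Gky]]; exists (maxn n k) => //; split.
    - by move: x Fnx; exact/subsetPset/ndF/leq_maxl.
    - by move: y Gky; exact/subsetPset/ndF/leq_maxr.
  by move=> [n _ []/= ? ?]; split; exists n.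
move=> k; have [? ?] := Foo k; split; first exact: measurableX.
have -> : leb2 (F k `*` F k) = (mu1 (F k) * mu1 (F k))%E by exact: product_measure1E.
by apply: lte_mul_pinfty => //; rewrite ge0_fin_numE.
Qed.

HB.instance Definition _ := Measure_isSigmaFinite.Build _ _ _ leb2 leb2_sigma_finite.

Lemma fubini_plane_line (f : M3 R -> \bar R) : leb3.-integrable setT f ->
  (\int[leb3]_x f x = \int[leb2]_p \int[mu1]_z f (p, z))%E.
Proof.
move=> fi; have h : (leb2 \x mu1)%E.-integrable setT f by exact: fi.
exact: (esym (integral12_prod_meas1 h)).
Qed.

Lemma fubini_line_plane (f : M3 R -> \bar R) : leb3.-integrable setT f ->
  (\int[leb3]_x f x = \int[mu1]_z \int[leb2]_p f (p, z))%E.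
Proof.
move=> fi; have h : (leb2 \x mu1)%E.-integrable setT f by exact: fi.
exact: (esym (integral21_prod_meas1 h)).
Qed.

Lemma fubini_plane1 (f : measurableTypeR R * measurableTypeR R -> \bar R) :
  leb2.-integrable setT f ->
  (\int[leb2]_x f x = \int[mu1]_z \int[mu1]_p f (z, p))%E.
Proof.
move=> fi; have h : (mu1 \x mu1)%E.-integrable setT f by exact: fi.
exact: (esym (integral12_prod_meas1 h)).
Qed.

Lemma fubini_plane2 (f : measurableTypeR R * measurableTypeR R -> \bar R) :
  leb2.-integrable setT f ->
  (\int[leb2]_x f x = \int[mu1]_z \int[mu1]_p f (p, z))%E.
Proof.
move=> fi; have h : (mu1 \x mu1)%E.-integrable setT f by exact: fi.
exact: (esym (integral21_prod_meas1 h)).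
Qed.
End Plane.

Section IntegrationByParts.
Context {R : realType}.
Implicit Types (x v : E3 R) (f g : E3 R -> R).

Notation mu1 := (@lebesgue_measure R).

Lemma line_is_derive (V : normedModType R) (f : V -> R) (x v : V) (t d : R) :
  is_derive (t *: v + x) v f d -> is_derive t (1 : R) (fun h : R => f (h *: v + x)) d.
Proof.
have e : (fun h : R => h^-1 *: ((f \o shift (t *: v + x)) (h *: v) - f (t *: v + x))) =
    (fun h : R => h^-1 *: (((fun h : R => f (h *: v + x)) \o shift t) (h *: 1) -
      f (t *: v + x))).
  apply/funext => h; congr (_ *: (f _ - f _)).
  by rewrite /= [h *: 1]mulr1 scalerDl addrA.
by move=> [dh <-]; split; [rewrite /derivable -e|rewrite /derive -e].
Qed.

(** The fundamental theorem of calculus on [[-M, M]], where both end values vanish. *)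
Lemma integral_derive_eq0 (M : R) (f g : R -> R) :
  0 < M -> continuous g -> (forall t : R, is_derive t (1 : R) f (g t)) ->
  (forall t, M <= `|t| -> f t = 0 /\ g t = 0) ->
  (\int[mu1]_t (g t)%:E = 0)%E.
Proof.
move=> M0 cg dfg z.
have cf : continuous f.
  move=> t; apply: differentiable_continuous; apply/derivable1_diffP.
  by have [] := dfg t.
have NM : - M < M by lra.
have h : (\int[mu1]_(t in `[(- M)%R, M]) (g t)%:E = (f M)%:E - (f (- M))%:E)%E.
  apply: continuous_FTC2 => //.
  - exact: continuous_subspaceT.
  - split.
    + by move=> t _; have [] := dfg t.
    + by apply: cvg_at_right_filter; exact: cf.
    + by apply: cvg_at_left_filter; exact: cf.
  - by move=> t _; rewrite derive1E; have [_ ->] := dfg t.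
have [fM _] := z M (ler_norm _).
have [fNM _] := z (- M) ltac:(by rewrite normrN ler_norm).
rewrite fM fNM subee// in h.
rewrite -h [RHS]integral_mkcond; apply: eq_integral => t _; rewrite patchE.
case: ifPn => // /negP tM; have [|_ ->//] := z t.
rewrite leNgt; apply/negP => tM'; apply: tM; rewrite inE /= in_itv /=.
by rewrite -ler_norml ltW.
Qed.

Definition supp_in (M : R) f : Prop := forall x : E3 R,
  (M <= `|x.1.1|) || (M <= `|x.1.2|) || (M <= `|x.2|) -> f x = 0.

Lemma compact_supp_bound f : continuous f -> compact (supp f) ->
  exists M C : R, [/\ 0 < M, supp_in M f & forall x, `|f x| <= C].
Proof.
move=> cf ck; have [M0 [_ hM]] := compact_bounded ck.
(* The last [+ 1] makes the bound on the support strict, as [supp_in] asks for zero already at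
   distance [M]. *)
pose M := Num.max (M0 + 1) 1 + 1.
have sM : supp_in M f.
  move=> x xM; apply: contrapT => /eqP fx.
  have : supp f x by apply: subset_closure.
  move=> /(hM (Num.max (M0 + 1) 1)) /=.
  have -> : M0 < Num.max (M0 + 1) 1 by rewrite lt_max ltrDl ltr01.
  move=> /(_ isT) nx; have lt : `|x| < M by rewrite (le_lt_trans nx)// /M ltrDl.
  move: lt; rewrite prod_normE /= prod_normE /= !gt_max => /andP[/andP[h1 h2] h3].
  by move: xM; rewrite !leNgt h1 h2 h3.
have cfk : compact (f @` supp f).
  by apply: continuous_compact => //; exact: continuous_subspaceT.
have [C0 [_ hC]] := compact_bounded cfk.
pose C := Num.max (C0 + 1) 0.
exists M, C; split => //.
  by rewrite /M ltr_wpDl// le_max ler01 orbT.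
move=> x; have [->|fx] := eqVneq (f x) 0; first by rewrite normr0 le_max lexx orbT.
apply: (hC C); first by rewrite /C lt_max ltrDl ltr01.
by exists x => //; apply: subset_closure.
Qed.

Lemma leb3_cbox_lty a b : (leb3 (cbox a b : set (M3 R)) < +oo)%E.
Proof.
have fin (s t : R) : (mu1 `[s, t]%classic < +oo)%E.
  by rewrite lebesgue_measure_itv /=; case: ifP => // _; rewrite -EFinB ltry.
have e : leb3 (cbox a b : set (M3 R)) = ((mu1 `[a.1.1, b.1.1]%classic *
    mu1 `[a.1.2, b.1.2]%classic) * mu1 `[a.2, b.2]%classic)%E.
  rewrite cboxE; etransitivity.
    by apply: (product_measure1E (mu1 \x mu1)%E mu1) => //; exact: measurableX.
  by congr (_ * _)%E; exact: product_measure1E.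
have p := lte_mul_pinfty.
have f2 : (mu1 `[a.1.1, b.1.1]%classic * mu1 `[a.1.2, b.1.2]%classic < +oo)%E.
  by apply: p => //; rewrite ge0_fin_numE.
by rewrite e; apply: p => //; [exact: mule_ge0|rewrite ge0_fin_numE// mule_ge0].
Qed.

Lemma measurable_cbox a b : measurable (cbox a b : set (M3 R)).
Proof. by rewrite cboxE; apply: measurableX => //; exact: measurableX. Qed.

Lemma supp_in_integrable (M C : R) f : continuous f -> supp_in M f ->
  (forall x, `|f x| <= C) -> leb3.-integrable setT (EFin \o (f : M3 R -> R)).
Proof.
move=> cf sf fC; pose K : set (M3 R) := cbox (- M, - M, - M) (M, M, M).
have mK : measurable K by exact: measurable_cbox.
have fK : f \_ K = f.
  apply/funext => x; rewrite patchE; case: ifPn => // /negP xK.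
  rewrite sf//; apply: contrapT => /negP; rewrite !negb_or -!ltNge !ltr_norml.
  move=> /andP[/andP[h1 h2] h3]; apply: xK; rewrite inE; apply: sub_box_cbox.
  by split.
have -> : EFin \o f = (EFin \o (f : M3 R -> R)) \_ K by rewrite restrict_EFin fK.
apply/(integrable_mkcond (EFin \o (f : M3 R -> R)) mK).
apply: measurable_bounded_integrable => //.
- exact: leb3_cbox_lty.
- by apply: measurable_funTS; exact: continuous_mfun3.
exists C; split; first exact: num_real.
by move=> y Cy x _ /=; rewrite (le_trans (fC x))// ltW.
Qed.

Lemma continuous_mul_supp f g : continuous f -> continuous g -> compact (supp g) ->
  exists M C : R, [/\ 0 < M, supp_in M (fun x => f x * g x) &
    forall x, `|f x * g x| <= C].
Proof.
move=> cf cg kg; apply: compact_supp_bound.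
  by move=> x; apply: cvgM; [exact: cf|exact: cg].
apply: subclosed_compact kg _; first exact: closed_closure.
apply: closure_subset => x /=; rewrite mulf_eq0 negb_or => /andP[]//.
Qed.

Definition axis (i : 'I_3) : E3 R :=
  if i == 0 then (1, 0, 0) else if i == 1 then (0, 1, 0) else (0, 0, 1).

Lemma integral_slice (M C : R) (g : E3 R -> R) (z : R) : continuous g ->
  supp_in M g -> (forall x, `|g x| <= C) ->
  leb2.-integrable setT
    (fun p : (measurableTypeR R * measurableTypeR R)%type => (g (p, z))%:E).
Proof.
move=> cg sg gC.
pose K : set (measurableTypeR R * measurableTypeR R) := `[- M, M]%classic `*` `[- M, M]%classic.
have mK : measurable K by exact: measurableX.
have gK : (fun p => (g (p, z))%:E) =
    (fun p : (measurableTypeR R * measurableTypeR R)%type => (g (p, z))%:E) \_ K.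
  apply/funext => p; rewrite patchE; case: ifPn => // /negP pK.
  rewrite sg//; apply: contrapT => /negP; rewrite !negb_or -!ltNge !ltr_norml.
  move=> /andP[/andP[/andP[h1 h2] /andP[h3 h4]] _]; apply: pK; rewrite inE.
  by split; rewrite /= in_itv /= !ltW.
rewrite gK; apply/(integrable_mkcond _ mK); apply: measurable_bounded_integrable => //.
- have e : leb2 K = (mu1 `[(- M)%R, M]%classic * mu1 `[(- M)%R, M]%classic)%E.
    exact: product_measure1E.
  apply: (@le_lt_trans _ _ (mu1 `[(- M)%R, M]%classic * mu1 `[(- M)%R, M]%classic)%E).
    by rewrite -e.
  rewrite !lebesgue_measure_itv /=.
  by case: ifP => _; rewrite ?mul0e// -EFinB -EFinM ltry.
- apply: measurable_funTS.
  exact: (measurable_fun_pair1 z (continuous_mfun3 cg)).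
exists C; split; first exact: num_real.
by move=> y Cy p _ /=; rewrite (le_trans (gC _))// ltW.
Qed.

(** Fubini with the innermost integral along [axis i], which vanishes by the one-dimensional case.
    As points are nested pairs, the third axis splits off at once; the other two need a second
    Fubini inside a horizontal slice. *)
Lemma integral_axis_derive_eq0 (i : 'I_3) (M C : R) f g : 0 < M ->
  continuous g -> (forall x, is_derive x (axis i) f (g x)) ->
  supp_in M f -> supp_in M g -> (forall x, `|g x| <= C) ->
  (\int[leb3]_x (g x)%:E = 0)%E.
Proof.
move=> M0 cg dfg sf sg gC.
have ig := supp_in_integrable cg sg gC.
have line (p : E3 R) : (forall t, M <= `|t| -> f (t *: axis i + p) = 0 /\ g (t *: axis i + p) = 0) ->
   (\int[mu1]_t (g (t *: axis i + p))%:E = 0)%E.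
  move=> h; apply: (@integral_derive_eq0 M (fun t => f (t *: axis i + p))) => //.
    move=> t; apply: continuous_comp; last exact: cg.
    apply: cvgD; last exact: cvg_cst.
    by apply: cvgZr_tmp; exact: cvg_id.
  by move=> t; apply: line_is_derive.
have iz z := integral_slice z cg sg gC.
have [i0|i0] := eqVneq i 0.
  rewrite (fubini_line_plane ig); apply: integral0_eq => z _.
  rewrite (fubini_plane2 (iz z)); apply: integral0_eq => y _.
  have lE (t : R) : t *: axis i + (0, y, z) = (t, y, z).
    rewrite i0 /axis /=; congr (_, _, _) => /=.
    - by rewrite [_ *: _]mulr1 addr0.
    - by rewrite [_ *: _]mulr0 add0r.
    - by rewrite [_ *: _]mulr0 add0r.
  have := line (0, y, z); under eq_integral do rewrite lE; apply => t Mt.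
  by rewrite lE; split; [apply: sf|apply: sg]; rewrite /= Mt.
have [i1|i1] := eqVneq i 1.
  rewrite (fubini_line_plane ig); apply: integral0_eq => z _.
  rewrite (fubini_plane1 (iz z)); apply: integral0_eq => x _.
  have lE (t : R) : t *: axis i + (x, 0, z) = (x, t, z).
    rewrite i1 /axis /=; congr (_, _, _) => /=.
    - by rewrite [_ *: _]mulr0 add0r.
    - by rewrite [_ *: _]mulr1 addr0.
    - by rewrite [_ *: _]mulr0 add0r.
  have := line (x, 0, z); under eq_integral do rewrite lE; apply => t Mt.
  by rewrite lE; split; [apply: sf|apply: sg]; rewrite /= Mt orbT.
rewrite (fubini_plane_line ig); apply: integral0_eq => p _.
have lE (t : R) : t *: axis i + (p, 0) = (p, t).
  rewrite /axis (negbTE i0) (negbTE i1); congr (_, _) => /=.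
    by rewrite [p]surjective_pairing; congr (_, _); rewrite /= [_ *: _]mulr0 add0r.
  by rewrite [_ *: _]mulr1 addr0.
have := line (p, 0); under eq_integral do rewrite lE; apply => t Mt.
by rewrite lE; split; [apply: sf|apply: sg]; rewrite /= Mt orbT.
Qed.

Lemma integ_supp (Omega : set (E3 R)) (h : E3 R -> R) :
  (forall x, ~ Omega x -> h x = 0) -> integ Omega h = \int[leb3]_x h x.
Proof.
move=> h0; rewrite integE; congr (Rintegral _ _ _); apply/funext => x.
rewrite patchE; case: ifPn => // /negP xO.
by rewrite h0// => Ox; apply: xO; rewrite inE.
Qed.

Lemma testfun_continuous (U : set (E3 R)) phi : testfun U phi -> continuous phi.
Proof. by case=> /(_ [::])[]. Qed.

Lemma testfun_derive (U : set (E3 R)) phi v : testfun U phi -> testfun U (fun x => 'D_v phi x).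
Proof.
move=> [sm ck sU]; have sub : supp (fun x => 'D_v phi x) `<=` supp phi.
  rewrite /supp [X in _ `<=` X](closure_id _).1; last exact: closed_closure.
  apply: closure_subset => x /= dx; apply: contrapT => nx; move/eqP : dx; apply.
  have : nbhs x (~` closure [set x | phi x != 0]).
    by apply: open_nbhs_nbhs; split => //; exact/closed_openC/closed_closure.
  move=> nb; have e : {near x, cst 0 =1 phi}.
    apply: filterS nb => y ny /=; apply/esym/eqP; apply: contrapT => /negP h.
    by apply: ny; exact: subset_closure.
  by have [_ ->] := near_eq_is_derive e (is_derive_cst 0 x v).
split.
(* [iter_derive] applies the last direction of the sequence first, so differentiating along [v]
   beforehand amounts to appending [v]. *)
- move=> s; have := sm (rcons s v).
  by rewrite /iter_derive foldr_rcons.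
- by apply: subclosed_compact ck sub; exact: closed_closure.
- exact: subset_trans sub sU.
Qed.

Lemma testfun_out (U : set (E3 R)) phi x : testfun U phi -> ~ U x -> phi x = 0.
Proof.
move=> [_ _ sU] nUx; apply: contrapT => /eqP h; apply: nUx; apply: sU.
exact: subset_closure.
Qed.

Lemma testfun_is_derive (U : set (E3 R)) phi x v : testfun U phi ->
  is_derive x v phi ('D_v phi x).
Proof. by case=> /(_ [::])[_ /(_ x v)] d _ _; exact: derivableP. Qed.

(** The derivative of [f * phi] has zero integral over the whole space: [f] is arbitrary at
    infinity, but [phi] has compact support in [Omega], so every integrand also extends by zero. *)
Lemma integ_by_parts (Omega : set (E3 R)) (i : 'I_3) f f' phi :
  continuous f -> continuous f' -> (forall x, is_derive x (axis i) f (f' x)) ->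
  testfun Omega phi ->
  L1 Omega (fun x => f x * 'D_(axis i) phi x) /\
  integ Omega (fun x => f x * 'D_(axis i) phi x) = - integ Omega (fun x => f' x * phi x).
Proof.
move=> cf cf' df tphi; have tphi' := testfun_derive (axis i) tphi.
have cphi := testfun_continuous tphi; have cphi' := testfun_continuous tphi'.
have kphi : compact (supp phi) by case: tphi.
have kphi' : compact (supp (fun x => 'D_(axis i) phi x)) by case: tphi'.
have [M1 [C1 [M10 s1 b1]]] := continuous_mul_supp cf cphi kphi.
have [M2 [C2 [M20 s2 b2]]] := continuous_mul_supp cf cphi' kphi'.
have [M3 [C3 [M30 s3 b3]]] := continuous_mul_supp cf' cphi kphi.
have out (h : E3 R -> R) : (forall x, ~ Omega x -> h x = 0) -> h \_ Omega = h.
  move=> h0; apply/funext => x; rewrite patchE; case: ifPn => // /negP xO.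
  by rewrite h0// => Ox; apply: xO; rewrite inE.
have o2 : (fun x => f x * 'D_(axis i) phi x) \_ Omega = (fun x => f x * 'D_(axis i) phi x).
  by apply: out => x xO; rewrite (testfun_out tphi')// mulr0.
have o3 : (fun x => f' x * phi x) \_ Omega = (fun x => f' x * phi x).
  by apply: out => x xO; rewrite (testfun_out tphi)// mulr0.
have c2 : continuous (fun x => f x * 'D_(axis i) phi x).
  by move=> x; apply: cvgM; [exact: cf|exact: cphi'].
have c3 : continuous (fun x => f' x * phi x).
  by move=> x; apply: cvgM; [exact: cf'|exact: cphi].
have i2 := supp_in_integrable c2 s2 b2.
have i3 := supp_in_integrable c3 s3 b3.
have L2' : L1 Omega (fun x => f x * 'D_(axis i) phi x) by rewrite /L1 o2.
have L3' : L1 Omega (fun x => f' x * phi x) by rewrite /L1 o3.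
split => //; apply/eqP; rewrite -addr_eq0 -integD//; apply/eqP.
have o4 : (fun x => f x * 'D_(axis i) phi x + f' x * phi x) \_ Omega =
    (fun x => f x * 'D_(axis i) phi x + f' x * phi x).
  by rewrite patchD o2 o3.
rewrite integE o4 /Rintegral.
suff -> : (\int[leb3]_x (f x * 'D_(axis i) phi x + f' x * phi x)%:E = 0)%E by [].
apply: (@integral_axis_derive_eq0 i (Num.max M1 (Num.max M2 M3)) (C2 + C3)
  (fun x => f x * phi x)).
- by rewrite lt_max M10.
- by move=> x; apply: cvgD; [exact: c2|exact: c3].
- move=> x; have := is_deriveM (df x) (testfun_is_derive x (axis i) tphi).
  move=> h; apply: (is_derive_eq h).
  by rewrite -![_ *: _]/(_ * _) [phi x * _]mulrC.
- move=> x h; apply: s1; move: h; rewrite !ge_max.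
  by move=> /orP[/orP[/andP[->]|/andP[->]]|/andP[->]]; rewrite ?orbT.
- move=> x h; have [h2 h3] : f x * 'D_(axis i) phi x = 0 /\ f' x * phi x = 0.
    split; [apply: s2|apply: s3]; move: h; rewrite !ge_max;
    by move=> /orP[/orP[/and3P[h1 h2 h3]|/and3P[h1 h2 h3]]|/and3P[h1 h2 h3]]; rewrite ?h2 ?h3 ?orbT.
  by rewrite h2 h3 addr0.
- by move=> x; rewrite (le_trans (ler_normD _ _))// lerD.
Qed.

Lemma testfun_L2 (Omega U : set (E3 R)) phi : measurable (Omega : set (M3 R)) ->
  testfun U phi -> L2 Omega phi.
Proof.
move=> mO t; have c := testfun_continuous t; have k : compact (supp phi) by case: t.
have [M [C [M0 s b]]] := continuous_mul_supp c c k.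
have c2 : continuous (fun x => phi x * phi x) by move=> x; apply: cvgM; exact: c.
have i := supp_in_integrable c2 s b.
have mp : mfun3 (phi \_ Omega).
  by apply/(measurable_restrictT _ mO); apply: measurable_funTS; exact: continuous_mfun3.
apply/L2P; split => //.
have [mi ley] := integrableP _ _ _ i.
apply: le_lt_trans ley; apply: ge0_le_integral => //.
- by move=> x _; rewrite lee_fin sqr_ge0.
- exact: measurable_EFin_sqr.
- exact: measurableT_comp.
move=> x _ /=; rewrite lee_fin patchE; case: ifP => _; last by rewrite expr0n /= normr_ge0.
by rewrite expr2 ler_norm.
Qed.

End IntegrationByParts.

(** * Symmetry of second derivatives *)

Section Schwarz.
Context {R : realType} {V : normedModType R}.
Implicit Types (x v w : V) (f : V -> R).

Lemma mean_value_line f (f' : V -> R) x v (t : R) : 0 < t ->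
  (forall y, is_derive y v f (f' y)) ->
  exists2 c : R, 0 < c < t & f (t *: v + x) - f x = t * f' (c *: v + x).
Proof.
move=> t0 df; pose F (s : R) := f (s *: v + x).
have dF (s : R) : is_derive s (1 : R) F (f' (s *: v + x)) by exact: line_is_derive.
have [|c + e] := @MVT R F (fun s => f' (s *: v + x)) 0 t t0.
  by apply: derivable_within_continuous => s _; have [] := dF s.
rewrite in_itv => ct; exists c => //.
by move: e; rewrite /F scale0r add0r subr0 mulrC.
Qed.

(** The mean value theorem twice: along [v] for the increment of [f] in the direction [w], then
    along [w] for [fv]. Only directional derivatives are available, so no Taylor expansion is
    used. *)
Lemma second_difference f (fv fvw : V -> R) x v w (t : R) : 0 < t ->
  (forall y, is_derive y v f (fv y)) -> (forall y, is_derive y w fv (fvw y)) ->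
  exists a b : R, [/\ 0 < a < t, 0 < b < t &
    f (t *: v + (t *: w + x)) - f (t *: w + x) - (f (t *: v + x) - f x) =
      t ^+ 2 * fvw (a *: w + (b *: v + x))].
Proof.
move=> t0 dv dw.
pose g y := f (t *: w + y) - f y.
have dg y : is_derive y v g (fv (t *: w + y) - fv y).
  apply: is_deriveB; apply: is_derive_line.
  rewrite (_ : (fun h => _) = (fun h : R => f (h *: v + (t *: w + y)))); last first.
    by apply/funext => h; rewrite addrCA.
  by apply: line_is_derive; rewrite scale0r add0r.
have [b b0t hb] := mean_value_line x t0 dg.
have [a a0t ha] := mean_value_line (b *: v + x) t0 dw.
exists a, b; split => //; rewrite expr2 -mulrA -ha -hb /g.
rewrite [t *: v + (_ + _)]addrCA; ring.
Qed.

(** Taken in either order, the second difference is the same number. Hence [fvw] and [fwv] agree at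
    two points as close to [x] as desired, and continuity concludes. *)
Lemma schwarz f (fv fw fvw fwv : V -> R) x v w :
  (forall y, is_derive y v f (fv y)) -> (forall y, is_derive y w fv (fvw y)) ->
  (forall y, is_derive y w f (fw y)) -> (forall y, is_derive y v fw (fwv y)) ->
  continuous fvw -> continuous fwv -> fvw x = fwv x.
Proof.
move=> dv dvw dw dwv cvw cwv; apply/eqP; rewrite -subr_eq0 -normr_le0.
apply/ler_addgt0Pl => e e0; rewrite addr0.
have e2 : 0 < e / 2 by rewrite divr_gt0.
have /cvgrPdist_le/(_ _ e2)/nbhs_ballP[r1 /= r10 h1] := cvw x.
have /cvgrPdist_le/(_ _ e2)/nbhs_ballP[r2 /= r20 h2] := cwv x.
(* With [t = min r1 r2 / K], a displacement by less than [t] along each of [v] and [w] stays in both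
   balls; the [+ 1] keeps [K] positive. *)
pose K := `|v| + `|w| + 1.
have K0 : 0 < K by rewrite ltr_wpDl// addr_ge0.
pose t := Num.min r1 r2 / K.
have t0 : 0 < t by rewrite divr_gt0// lt_min r10.
have small (a b : R) : 0 < a < t -> 0 < b < t -> forall v' w' : V,
    `|v'| + `|w'| + 1 = K -> ball x (Num.min r1 r2) (a *: w' + (b *: v' + x)).
  move=> /andP[a0 at_] /andP[b0 bt] v' w' hK; rewrite -ball_normE /ball_ /=.
  rewrite addrA opprD addrCA subrr addr0 normrN.
  rewrite (le_lt_trans (ler_normD _ _))// !normrZ !gtr0_norm//.
  have : t * K = Num.min r1 r2 by rewrite /t divfK// gt_eqF.
  move=> <-; rewrite -hK !mulrDr mulr1.
  apply: (@le_lt_trans _ _ (t * `|v'| + t * `|w'|)); last by rewrite ltrDl.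
  by rewrite addrC lerD// ler_wpM2r// ltW.
have [a1 [b1 [ha1 hb1 E1]]] := second_difference x t0 dv dvw.
have [a2 [b2 [ha2 hb2 E2]]] := second_difference x t0 dw dwv.
have E : fvw (a1 *: w + (b1 *: v + x)) = fwv (a2 *: v + (b2 *: w + x)).
  have tn : t ^+ 2 != 0 by rewrite expf_eq0 /= gt_eqF.
  apply: (mulfI tn); rewrite -E1 -E2 addrCA; ring.
have B1 := small _ _ ha1 hb1 v w erefl.
have B2 := small _ _ ha2 hb2 w v ltac:(by rewrite /K [`|w| + _]addrC).
have m1 : Num.min r1 r2 <= r1 by rewrite ge_min lexx.
have m2 : Num.min r1 r2 <= r2 by rewrite ge_min lexx orbT.
have n1 := h1 _ (le_ball m1 B1).
have n2 := h2 _ (le_ball m2 B2).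
rewrite [fvw x - _](_ : _ = (fvw x - fvw (a1 *: w + (b1 *: v + x))) -
  (fwv x - fwv (a2 *: v + (b2 *: w + x)))); last by rewrite E; ring.
rewrite (le_trans (ler_normB _ _))//; move: n1 n2 => /=; lra.
Qed.

End Schwarz.

Section TestFunctions.
Context {R : realType}.
Implicit Types (U : set (E3 R)) (phi : E3 R -> R).

Lemma testfun_schwarz U phi (v w x : E3 R) : testfun U phi ->
  'D_v (fun y => 'D_w phi y) x = 'D_w (fun y => 'D_v phi y) x.
Proof.
move=> t; have tv := testfun_derive v t; have tw := testfun_derive w t.
have dw y := testfun_is_derive y w t; have dv y := testfun_is_derive y v t.
have dwv y := testfun_is_derive y v tw; have dvw y := testfun_is_derive y w tv.
have cwv := testfun_continuous (testfun_derive v tw).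
have cvw := testfun_continuous (testfun_derive w tv).
exact: (schwarz x dw dwv dv dvw cwv cvw).
Qed.

Lemma testfun_grad U phi : testfun U phi -> compwise (testfun U) (grad phi).
Proof. by move=> t; split; exact: testfun_derive. Qed.

Lemma curl_grad U phi x : testfun U phi -> curl (grad phi) x = 0.
Proof.
move=> t; rewrite /curl /grad /pd1 /pd2 /pd3 /=.
congr (_, _, _); apply/eqP; rewrite subr_eq0; apply/eqP; exact: testfun_schwarz t.
Qed.

End TestFunctions.

(** * Weak derivatives and the spaces X and Z *)

Section WeakDerivatives.
Context {R : realType}.
Implicit Types (Omega U : set (E3 R)) (phi f g : E3 R -> R)
  (psi u v w q : E3 R -> E3 R).

Lemma L1_mul_testfun Omega f phi : continuous f -> testfun Omega phi ->
  L1 Omega (fun x => f x * phi x).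
Proof.
move=> cf t; have k : compact (supp phi) by case: t.
have [M [C [M0 s b]]] := continuous_mul_supp cf (testfun_continuous t) k.
have c : continuous (fun x => f x * phi x).
  by move=> x; apply: cvgM; [exact: cf|exact: (testfun_continuous t)].
have o : (fun x => f x * phi x) \_ Omega = (fun x => f x * phi x).
  apply/funext => x; rewrite patchE; case: ifPn => // /negP xO.
  by rewrite (testfun_out t) ?mulr0// => Ox; apply: xO; rewrite inE.
by rewrite /L1 o; exact: (supp_in_integrable c s b).
Qed.

Definition C1fun f : Prop := continuous f /\ forall i : 'I_3,
  continuous (fun x => 'D_(axis i) f x) /\ forall x, derivable f x (axis i).

(** The identity comes with the integrability that is needed to split the integrals of sums in which
    it occurs. *)
Definition by_parts Omega (f phi' f' phi : E3 R -> R) : Prop :=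
  [/\ L1 Omega (fun x => f x * phi' x), L1 Omega (fun x => f' x * phi x) &
      integ Omega (fun x => f x * phi' x) = - integ Omega (fun x => f' x * phi x)].

Lemma C1fun_by_parts Omega f phi i : C1fun f -> testfun Omega phi ->
  by_parts Omega f (fun x => 'D_(axis i) phi x) (fun x => 'D_(axis i) f x) phi.
Proof.
move=> [cf /(_ i)[cd df]] t.
have [h1 h2] := integ_by_parts cf cd (fun x => derivableP (df x)) t.
by split => //; exact: L1_mul_testfun.
Qed.

Lemma smooth_C1fun f : smooth f -> C1fun f.
Proof.
move=> sf; split; first by case: (sf [::]).
by move=> i; split; [case: (sf [:: axis i])|move=> x; case: (sf [::]) => _; apply].
Qed.

Lemma integB Omega f g : L1 Omega f -> L1 Omega g ->
  integ Omega (fun x => f x - g x) = integ Omega f - integ Omega g.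
Proof.
move=> f1 g1; rewrite -mulN1r -integZ// -integD//; last exact: L1Z.
by apply: eq_integ => x _; rewrite mulN1r.
Qed.

Lemma L1B Omega f g : L1 Omega f -> L1 Omega g -> L1 Omega (fun x => f x - g x).
Proof.
move=> f1 g1; rewrite (_ : (fun x => _) = (fun x => f x + -1 * g x)).
  by apply: L1D => //; exact: L1Z.
by apply/funext => x; rewrite mulN1r.
Qed.

Lemma integ_sum3B Omega f1 g1 f2 g2 f3 g3 :
  L1 Omega f1 -> L1 Omega g1 -> L1 Omega f2 -> L1 Omega g2 ->
  L1 Omega f3 -> L1 Omega g3 ->
  integ Omega (fun x => (f1 x - g1 x) + (f2 x - g2 x) + (f3 x - g3 x)) =
  (integ Omega f1 - integ Omega g1) + (integ Omega f2 - integ Omega g2) +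
  (integ Omega f3 - integ Omega g3).
Proof.
move=> h1 h2 h3 h4 h5 h6.
rewrite integD; [|by apply: L1D; exact: L1B|exact: L1B].
by rewrite integD; [rewrite !integB|exact: L1B|exact: L1B].
Qed.

Lemma by_parts_curl Omega (q1 q2 q3 p1 p2 p3 d2q1 d3q1 d3q2 d1q2 d1q3 d2q3
    d2p3 d3p2 d3p1 d1p3 d1p2 d2p1 : E3 R -> R) :
  by_parts Omega q1 d2p3 d2q1 p3 -> by_parts Omega q1 d3p2 d3q1 p2 ->
  by_parts Omega q2 d3p1 d3q2 p1 -> by_parts Omega q2 d1p3 d1q2 p3 ->
  by_parts Omega q3 d1p2 d1q3 p2 -> by_parts Omega q3 d2p1 d2q3 p1 ->
  integ Omega (fun x => q1 x * (d2p3 x - d3p2 x) + q2 x * (d3p1 x - d1p3 x)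
     + q3 x * (d1p2 x - d2p1 x)) =
  integ Omega (fun x => (d2q3 x - d3q2 x) * p1 x + (d3q1 x - d1q3 x) * p2 x
     + (d1q2 x - d2q1 x) * p3 x).
Proof.
move=> [a12 b12 e12] [a13 b13 e13] [a21 b21 e21] [a23 b23 e23] [a31 b31 e31] [a32 b32 e32].
under eq_integ do rewrite !mulrBr.
under [RHS]eq_integ do rewrite !mulrBl.
rewrite (integ_sum3B a12 a13 a21 a23 a31 a32) (integ_sum3B b32 b21 b13 b31 b23 b12).
rewrite e12 e13 e21 e23 e31 e32; ring.
Qed.

Lemma by_parts_div Omega f p1 p2 p3 d1f d2f d3f d1p1 d2p2 d3p3 :
  by_parts Omega f d1p1 d1f p1 -> by_parts Omega f d2p2 d2f p2 ->
  by_parts Omega f d3p3 d3f p3 ->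
  integ Omega (fun x => f x * (d1p1 x + d2p2 x + d3p3 x)) =
  - integ Omega (fun x => d1f x * p1 x + d2f x * p2 x + d3f x * p3 x).
Proof.
move=> [a1 b1 e1] [a2 b2 e2] [a3 b3 e3].
under eq_integ do rewrite !mulrDr.
rewrite !integD// ?e1 ?e2 ?e3; [by rewrite !opprD|exact: L1D|exact: L1D].
Qed.

Lemma integ_curl_C1 Omega q psi : compwise C1fun q -> compwise (testfun Omega) psi ->
  integ Omega (fun x => dot (q x) (curl psi x)) =
  integ Omega (fun x => dot (curl q x) (psi x)).
Proof.
move=> [q1 q2 q3] [p1 p2 p3].
exact: (by_parts_curl (C1fun_by_parts 1 q1 p3) (C1fun_by_parts 2 q1 p2)
  (C1fun_by_parts 2 q2 p1) (C1fun_by_parts 0 q2 p3)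
  (C1fun_by_parts 0 q3 p2) (C1fun_by_parts 1 q3 p1)).
Qed.

Lemma integ_div_C1 Omega f psi : C1fun f -> compwise (testfun Omega) psi ->
  integ Omega (fun x => f x * divergence psi x) =
  - integ Omega (fun x => dot (grad f x) (psi x)).
Proof.
move=> f1 [p1 p2 p3].
exact: (by_parts_div (C1fun_by_parts 0 f1 p1) (C1fun_by_parts 1 f1 p2)
  (C1fun_by_parts 2 f1 p3)).
Qed.

End WeakDerivatives.

Section Spaces.
Context {R : realType}.
Implicit Types (U : set (E3 R)) (phi f g P : E3 R -> R)
  (psi u v w th q : E3 R -> E3 R).

Variable Omega : set (E3 R).
Hypotheses (oO : open Omega) (bO : bounded_set Omega).

Lemma leb3_bounded_lty : (leb3 (Omega : set (M3 R)) < +oo)%E.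
Proof.
have [M0 [_ hM]] := bO; pose M := Num.max M0 0 + 1.
have := leb3_cbox_lty ((- M, - M, - M) : E3 R) (M, M, M).
apply: le_lt_trans.
apply: le_measure; rewrite ?inE; [exact: open_measurable3|exact: measurable_cbox|].
move=> x Ox; have := hM M; rewrite /M ltr_pwDr// ?le_max ?lexx// => /(_ isT x Ox) /=.
rewrite prod_normE /= prod_normE /= !ge_max !ler_norml => /andP[/andP[h1 h2] h3].
by split.
Qed.

Lemma L2_cst (c : R) : L2 Omega (cst c).
Proof.
apply/L2P; have e x : ((cst c \_ Omega) x ^+ 2)%:E = (((cst (c ^+ 2)) \_ Omega) x)%:E.
  by rewrite !patchE; case: ifP => // _; rewrite expr0n.
split; first by apply/(measurable_restrictT _ (open_measurable3 oO)).
rewrite /energy; under eq_integral do rewrite e.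
have -> : (\int[leb3]_x ((cst (c ^+ 2) \_ Omega) x)%:E =
    \int[leb3]_(x in Omega) (c ^+ 2)%:E)%E.
  by rewrite [RHS]integral_mkcond; apply: eq_integral => x _; rewrite !patchE; case: ifP.
rewrite integral_cst//; last exact: open_measurable3.
by apply: lte_mul_pinfty; rewrite ?lee_fin ?sqr_ge0//; exact: leb3_bounded_lty.
Qed.

Lemma L2_L1 f : L2 Omega f -> L1 Omega f.
Proof.
move=> f2; have := L2_mul f2 (L2_cst 1); congr L1.
by apply/funext => x; rewrite mulr1.
Qed.

Lemma weak_eq0 g : L2 Omega g ->
  (forall phi, testfun Omega phi -> integ Omega (fun x => g x * phi x) = 0) ->
  g = cst 0 %[ae leb3 in Omega].
Proof. by move=> g2; apply: fundamental_lemma => //; exact: L2_L1. Qed.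

Lemma testfun0 U : testfun U (cst 0).
Proof.
have e s : iter_derive s (cst (0 : R) : E3 R -> R) = cst 0.
  elim: s => [//|v s IH]; apply/funext => x; rewrite /= IH.
  exact: derive_cst.
have s0 : supp (cst (0 : R) : E3 R -> R) = set0.
  rewrite /supp (_ : [set x | _] = set0) ?closure0//.
  by apply/seteqP; split => x //=; rewrite eqxx.
split; last by rewrite s0.
- move=> s; rewrite e; split; first exact: cst_continuous.
  by move=> x v; exact: derivable_cst.
- by rewrite s0; exact: compact0.
Qed.

Lemma weak_eq0v w : L2v Omega w ->
  (forall psi, compwise (testfun Omega) psi -> l2dot Omega w psi = 0) ->
  w = cst 0 %[ae leb3 in Omega].
Proof.
move=> [w1 w2 w3] hw; have t0 := testfun0 Omega.
have e1 : (fun x => (w x).1.1) = cst 0 %[ae leb3 in Omega].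
  apply: weak_eq0 => // phi t; rewrite -(hw (fun x => (phi x, 0, 0)))//.
  by apply: eq_integ => x _; rewrite /dot /= !mulr0 !addr0.
have e2 : (fun x => (w x).1.2) = cst 0 %[ae leb3 in Omega].
  apply: weak_eq0 => // phi t; rewrite -(hw (fun x => (0, phi x, 0)))//.
  by apply: eq_integ => x _; rewrite /dot /= !mulr0 add0r addr0.
have e3 : (fun x => (w x).2) = cst 0 %[ae leb3 in Omega].
  apply: weak_eq0 => // phi t; rewrite -(hw (fun x => (0, 0, phi x)))//.
  by apply: eq_integ => x _; rewrite /dot /= !mulr0 !add0r.
apply: (aeS2 _ e1 (aeS2 (fun x h1 h2 => conj h1 h2) e2 e3)) => x h1 [h2 h3] Ox.
rewrite [w x]surjective_pairing [(w x).1]surjective_pairing.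
by rewrite (h1 Ox) (h2 Ox) (h3 Ox).
Qed.

Lemma L2v_lin (a : R) u v : L2v Omega u -> L2v Omega v -> L2v Omega (a *: u + v).
Proof. by move=> [u1 u2 u3] [v1 v2 v3]; split; exact: L2_lin. Qed.

Lemma L2vB u v : L2v Omega u -> L2v Omega v -> L2v Omega (u - v).
Proof. by move=> [u1 u2 u3] [v1 v2 v3]; split; exact: L2B. Qed.

Lemma L2v0 : L2v Omega (cst 0).
Proof. by split; exact: L2_0. Qed.

Lemma testfun_L2v U psi : compwise (testfun U) psi -> L2v Omega psi.
Proof.
move=> [p1 p2 p3].
by split; apply: (testfun_L2 (open_measurable3 oO)); [exact: p1|exact: p2|exact: p3].
Qed.

Lemma curl_L2v U psi : compwise (testfun U) psi -> L2v Omega (curl psi).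
Proof.
move=> [p1 p2 p3].
have d phi (e : E3 R) (t : testfun U phi) :=
  testfun_L2 (open_measurable3 oO) (testfun_derive e t).
split; [exact: L2B (d _ _ p3) (d _ _ p2)|exact: L2B (d _ _ p1) (d _ _ p3)|
  exact: L2B (d _ _ p2) (d _ _ p1)].
Qed.

Lemma l2dotBl u v w : L2v Omega u -> L2v Omega v -> L2v Omega w ->
  l2dot Omega (u - v) w = l2dot Omega u w - l2dot Omega v w.
Proof.
move=> hu hv hw; rewrite addrC -scaleN1r l2dotPl//; ring.
Qed.

Lemma l2dot0l w : l2dot Omega (cst 0) w = 0.
Proof.
rewrite -(integ0 Omega); apply: eq_integ => x _; rewrite /dot /= !mul0r !addr0//.
Qed.

Lemma ae_subr0 u v : (u - v : E3 R -> E3 R) = cst 0 %[ae leb3 in Omega] ->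
  u = v %[ae leb3 in Omega].
Proof. by apply: aeS => x h Ox; apply/eqP; rewrite -subr_eq0; apply/eqP/h. Qed.

Lemma is_wcurl_unique th w1 w2 : is_wcurl Omega th w1 -> is_wcurl Omega th w2 ->
  w1 = w2 %[ae leb3 in Omega].
Proof.
move=> [l1 h1] [l2 h2]; apply: ae_subr0; apply: weak_eq0v; first exact: L2vB.
move=> psi t; rewrite l2dotBl//; last exact: testfun_L2v t.
by rewrite -[l2dot _ w1 _]h1// -[l2dot _ w2 _]h2// subrr.
Qed.

Lemma is_wgrad_unique P w1 w2 : is_wgrad Omega P w1 -> is_wgrad Omega P w2 ->
  w1 = w2 %[ae leb3 in Omega].
Proof.
move=> [l1 h1] [l2 h2]; apply: ae_subr0; apply: weak_eq0v; first exact: L2vB.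
move=> psi t; rewrite l2dotBl//; last exact: testfun_L2v t.
apply/eqP; rewrite subr_eq0 -eqr_opp; apply/eqP.
by rewrite -[- l2dot _ w1 _]h1// -[- l2dot _ w2 _]h2.
Qed.

Lemma is_wdiv_unique v g1 g2 : is_wdiv Omega v g1 -> is_wdiv Omega v g2 ->
  g1 = g2 %[ae leb3 in Omega].
Proof.
move=> [l1 h1] [l2 h2].
have : (fun x => g1 x - g2 x) = cst 0 %[ae leb3 in Omega].
  apply: weak_eq0; first exact: L2B.
  move=> phi t; under eq_integ do rewrite mulrBl.
  have p2 := testfun_L2 (open_measurable3 oO) t; rewrite integB; [|exact: L2_mul|exact: L2_mul].
  apply/eqP; rewrite subr_eq0 -eqr_opp -(h1 _ t) -(h2 _ t)//.
by apply: aeS => x h Ox; apply/eqP; rewrite -subr_eq0; apply/eqP/h.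
Qed.

Lemma wcurlP th : Hcurl Omega th -> is_wcurl Omega th (wcurl Omega th).
Proof. by move=> [_ h]; exact: getPex. Qed.

Lemma wgradP P : H1 Omega P -> is_wgrad Omega P (wgrad Omega P).
Proof. by move=> [_ h]; exact: getPex. Qed.

Lemma wdivP v : Hdiv Omega v -> is_wdiv Omega v (wdiv Omega v).
Proof. by move=> [_ h]; exact: getPex. Qed.

Variable Gam : set (E3 R).

(** Once the divergence vanishes, Green's formula reduces to orthogonality to gradients: those of
    interior test functions for the divergence, those of functions allowed to be nonzero on [Gam]
    for the normal trace. The chosen representative [wdiv] disappears and the conditions become
    linear in [u]. *)
Lemma spaceXP u : spaceX Omega Gam u <->
  [/\ L2v Omega u, forall phi, testfun Omega phi -> l2dot Omega u (grad phi) = 0 &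
      forall phi, testfun (away Omega Gam) phi -> l2dot Omega u (grad phi) = 0].
Proof.
have z phi (U : set (E3 R)) g : testfun U phi -> L2 Omega g -> g = cst 0 %[ae leb3 in Omega] ->
    integ Omega (fun x => g x * phi x) = 0.
  move=> t g2 g0; rewrite -(integ0 Omega); apply: integ_ae.
  - by apply: L2_mul => //; exact: (testfun_L2 (open_measurable3 oO) t).
  - exact: L2_L1 (L2_0 _).
  - by apply: aeS g0 => x h Ox; rewrite h// mul0r.
have split_ phi (U : set (E3 R)) : testfun U phi -> L2v Omega u -> L2 Omega (wdiv Omega u) ->
    wdiv Omega u = cst 0 %[ae leb3 in Omega] ->
    integ Omega (fun x => dot (u x) (grad phi x) + wdiv Omega u x * phi x) =
    l2dot Omega u (grad phi).
  move=> t u2 d2 d0; rewrite integD ?(z _ _ _ t d2 d0) ?addr0//.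
    by apply: L2v_dot => //; exact: (testfun_L2v (testfun_grad t)).
  by apply: L2_mul => //; exact: (testfun_L2 (open_measurable3 oO) t).
split=> [[[/[dup] hd [u2 _] n0] d0]|[u2 hO hG]].
  have [d2 hd'] := wdivP hd; split => // phi t.
    by rewrite [LHS]hd'// (z _ _ _ t)// oppr0.
  by rewrite -(split_ _ _ t)// n0.
have d : is_wdiv Omega u (cst 0).
  split; first exact: L2_0.
  by move=> phi t; rewrite [LHS]hO// (z _ _ _ t) ?oppr0//; [exact: L2_0|exact: aeW].
have hd : Hdiv Omega u by split => //; exists (cst 0).
have d0 := is_wdiv_unique (wdivP hd) d; have [d2 _] := wdivP hd.
split => //; split => // phi t.
by rewrite (split_ _ _ t)// hG.
Qed.

(** The weak curl and the vanishing tangential trace are one identity tested on two classes of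
    fields. With an arbitrary weak curl [w] instead of [wcurl], it is linear in the pair
    [(th, w)]. *)
Lemma spaceZP th w : spaceZ Omega Gam th /\ is_wcurl Omega th w <->
  [/\ L2v Omega th, L2v Omega w,
      forall psi, compwise (testfun Omega) psi ->
        l2dot Omega th (curl psi) = l2dot Omega w psi &
      forall psi, compwise (testfun (away Omega Gam)) psi ->
        l2dot Omega th (curl psi) = l2dot Omega w psi].
Proof.
have e psi (U : set (E3 R)) w' : compwise (testfun U) psi -> L2v Omega th -> L2v Omega w' ->
    integ Omega (fun x => dot (w' x) (psi x) - dot (th x) (curl psi x)) =
    l2dot Omega w' psi - l2dot Omega th (curl psi).
  move=> t t2 w2; rewrite integB//; apply: L2v_dot => //.
    exact: testfun_L2v t.
  exact: curl_L2v t.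
split=> [[[hc tg] hw]|[t2 w2 hO hG]].
  have [t2 _] := hc; have [w2 hw'] := hw; split => // psi t.
  have c := wcurlP hc; have [c2 _] := c.
  have := tg _ t; rewrite (e _ _ _ t)// => /eqP; rewrite subr_eq0 => /eqP <-.
  by apply: l2dot_ae => //; [exact: testfun_L2v t|exact: is_wcurl_unique c hw].
have hw : is_wcurl Omega th w by split.
have hc : Hcurl Omega th by split => //; exists w.
split => //; split => // psi t.
have c := wcurlP hc; have [c2 _] := c.
rewrite (e _ _ _ t)//; apply/eqP; rewrite subr_eq0; apply/eqP; rewrite hG//.
by apply: l2dot_ae => //; [exact: testfun_L2v t|exact: is_wcurl_unique c hw].
Qed.

Lemma curl_spaceX th w : spaceZ Omega Gam th -> is_wcurl Omega th w ->
  spaceX Omega Gam w.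
Proof.
move=> hz hw; have [t2 w2 hO hG] := (spaceZP th w).1 (conj hz hw).
have c0 phi (U : set (E3 R)) : testfun U phi -> l2dot Omega th (curl (grad phi)) = 0.
  move=> t; rewrite -(integ0 Omega); apply: eq_integ => x _.
  by rewrite (curl_grad _ t) /dot !mulr0 !addr0.
apply/spaceXP; split => // phi t.
  by rewrite -hO ?(c0 _ _ t)//; exact: testfun_grad.
by rewrite -hG ?(c0 _ _ t)//; exact: testfun_grad.
Qed.

End Spaces.

(** * The pairing of normal traces with the pressure datum *)

Section Pairing.
Context {R : realType}.
Implicit Types (U : set (E3 R)) (phi f g P Q : E3 R -> R) (u v w : E3 R -> E3 R).

Variables (Omega Gam Sig : set (E3 R)).
Hypotheses (oO : open Omega) (bO : bounded_set Omega).
Hypothesis GamSig : boundary_partition Omega Gam Sig.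

Lemma l2dot_CSn u v : L2v Omega u -> L2v Omega v ->
  `|l2dot Omega u v| <= norm2v Omega u * norm2v Omega v.
Proof.
move=> hu hv; rewrite !norm2vE//.
exact: (ip_CSn (@l2ip_semi R Omega) (mkL2 hu) (mkL2 hv)).
Qed.

Lemma l2dotBr u v w : L2v Omega u -> L2v Omega v -> L2v Omega w ->
  l2dot Omega w (u - v) = l2dot Omega w u - l2dot Omega w v.
Proof. by move=> hu hv hw; rewrite l2dotC (l2dotBl hu hv hw) !(l2dotC _ w). Qed.

Lemma norm2v_ge0 u : 0 <= norm2v Omega u.
Proof. by rewrite /norm2v /norm2 fine_ge0//; exact: Lnorm_ge0. Qed.

Lemma l2dotr_ae u v w : L2v Omega u -> L2v Omega v -> L2v Omega w ->
  v = w %[ae leb3 in Omega] -> l2dot Omega u v = l2dot Omega u w.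
Proof. by move=> hu hv hw vw; rewrite !(l2dotC _ u); exact: l2dot_ae. Qed.

Lemma norm2v_ae u v : L2v Omega u -> L2v Omega v ->
  u = v %[ae leb3 in Omega] -> norm2v Omega u = norm2v Omega v.
Proof.
move=> hu hv uv; rewrite !norm2vE//; congr Num.sqrt.
by rewrite (l2dot_ae hu hv hu uv) (l2dotr_ae hv hu hv uv).
Qed.

Lemma norm2v_cst0 : norm2v Omega (cst 0) = 0.
Proof. by rewrite norm2vE ?l2dot0l ?sqrtr0//; exact: L2v0. Qed.

Lemma norm2_cst0 : norm2 Omega (cst 0) = 0.
Proof.
rewrite norm2E; last exact: L2_0.
rewrite (_ : (fun x => _) = (fun=> 0)) ?integ0 ?sqrtr0//.
by apply/funext => x; rewrite expr0n.
Qed.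

Lemma testfun_is_wgrad U phi : testfun U phi -> is_wgrad Omega phi (grad phi).
Proof.
move=> t; split; first exact: (testfun_L2v oO (testfun_grad t)).
by move=> psi tp; apply: integ_div_C1 => //; apply: smooth_C1fun; case: t.
Qed.

Lemma div_L2 U psi : compwise (testfun U) psi -> L2 Omega (divergence psi).
Proof.
move=> [p1 p2 p3].
have d phi (e : E3 R) (t : testfun U phi) :=
  testfun_L2 (open_measurable3 oO) (testfun_derive e t).
have L2D f g : L2 Omega f -> L2 Omega g -> L2 Omega (fun x => f x + g x).
  move=> f2 g2; have := L2_lin 1 f2 g2; congr L2.
  by apply/funext => x; rewrite mul1r.
exact: L2D (L2D _ _ (d _ _ p1) (d _ _ p2)) (d _ _ p3).
Qed.

Lemma is_wgradB P Q w1 w2 : L2 Omega P -> L2 Omega Q ->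
  is_wgrad Omega P w1 -> is_wgrad Omega Q w2 -> is_wgrad Omega (P \- Q) (w1 - w2).
Proof.
move=> P2 Q2 [l1 h1] [l2 h2]; split; first exact: L2vB.
move=> psi t; have d2 := div_L2 t; have t2 := testfun_L2v oO t.
rewrite [X in - X](_ : _ = l2dot Omega (w1 - w2) psi)// l2dotBl//.
transitivity (integ Omega (fun x => P x * divergence psi x) -
    integ Omega (fun x => Q x * divergence psi x)).
  rewrite -integB; [|exact: L2_mul|exact: L2_mul].
  by apply: eq_integ => x _; rewrite /= mulrBl.
rewrite (h1 _ t) (h2 _ t) -/(l2dot Omega w1 psi) -/(l2dot Omega w2 psi); ring.
Qed.

Lemma H1B P Q : H1 Omega P -> H1 Omega Q -> H1 Omega (P \- Q).
Proof.
move=> hP hQ; have [P2 _] := hP; have [Q2 _] := hQ; split; first exact: L2B.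
by exists (wgrad Omega P - wgrad Omega Q); apply: is_wgradB => //; exact: wgradP.
Qed.

Lemma wgrad_L2v P : H1 Omega P -> L2v Omega (wgrad Omega P).
Proof. by move=> /wgradP[]. Qed.

Lemma wgradB P Q : H1 Omega P -> H1 Omega Q ->
  wgrad Omega (P \- Q) = wgrad Omega P - wgrad Omega Q %[ae leb3 in Omega].
Proof.
move=> hP hQ; have [P2 _] := hP; have [Q2 _] := hQ.
apply: (is_wgrad_unique oO bO (wgradP (H1B hP hQ))).
by apply: is_wgradB => //; exact: wgradP.
Qed.

Lemma testfun_H1 U phi : testfun U phi -> H1 Omega phi.
Proof.
move=> t; split; first exact: (testfun_L2 (open_measurable3 oO) t).
by exists (grad phi); exact: testfun_is_wgrad t.
Qed.

Lemma away_Gam : away Omega Gam = ~` closure Sig.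
Proof.
rewrite /away; congr (~` closure _); case: GamSig => <- h.
apply/seteqP; split => x; first by move=> [[//|//]].
move=> Sx; split; first by right.
by move=> Gx; have : (Gam `&` Sig) x by []; rewrite h.
Qed.

Lemma norm2v_wgrad_le P : norm2v Omega (wgrad Omega P) <= normH1 Omega P.
Proof.
rewrite /normH1 -[leLHS]ger0_norm ?norm2v_ge0// -sqrtr_sqr ler_wsqrtr//.
by rewrite lerDr sqr_ge0.
Qed.

(** For test functions vanishing near [Sig] this is part of the membership in X; Cauchy-Schwarz
    carries it to their H^1-closure. It makes the pairing independent of the lifting. *)
Lemma wgrad_H1_0 v P : spaceX Omega Gam v -> H1_0 Omega Sig P ->
  l2dot Omega v (wgrad Omega P) = 0.
Proof.
move=> /(spaceXP oO bO)[v2 _ vG] [hP hap].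
apply/eqP; rewrite -normr_le0; apply/ler_addgt0Pl => e e0; rewrite addr0.
have N0 : 0 < norm2v Omega v + 1 by rewrite ltr_wpDl// norm2v_ge0.
have [phi t hphi] := hap _ (divr_gt0 e0 N0).
have h1 := testfun_H1 t; have D1 := H1B hP h1.
have e1 : wgrad Omega (P \- phi) = wgrad Omega P - grad phi %[ae leb3 in Omega].
  have [P2 _] := hP; have [p2 _] := h1.
  apply: (is_wgrad_unique oO bO (wgradP D1)); apply: is_wgradB => //.
    exact: wgradP.
  exact: testfun_is_wgrad t.
have g2 := testfun_L2v oO (testfun_grad t).
have wP2 := wgrad_L2v hP.
have : l2dot Omega v (wgrad Omega (P \- phi)) = l2dot Omega v (wgrad Omega P).
  rewrite (l2dotr_ae v2 (wgrad_L2v D1) (L2vB wP2 g2) e1).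
  rewrite (l2dotBr wP2 g2 v2) vG ?subr0//.
  by rewrite away_Gam.
move=> <-; rewrite (le_trans (l2dot_CSn v2 (wgrad_L2v D1)))//.
apply: (@le_trans _ _ ((norm2v Omega v + 1) * (e / (norm2v Omega v + 1)))).
  apply: ler_pM; rewrite ?norm2v_ge0// ?lerDl//.
  by rewrite (le_trans (norm2v_wgrad_le _))// ltW.
by rewrite mulrC divfK// gt_eqF.
Qed.

(** The class of [P] contains [P] because the zero function belongs to [H1_0]; so [get] returns a
    genuine lifting. *)
Lemma H12_get p : H12 Omega Sig p -> p (get p).
Proof.
move=> [P hP ->]; apply: getPex; exists P; split => //.
have -> : P \- P = cst 0 by apply/funext => x; rewrite /= subrr.
have t0 U := @testfun0 R U.
split; first exact: testfun_H1 (t0 setT).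
move=> e e0; exists (cst 0); first exact: t0.
have -> : cst (0 : R) \- cst 0 = cst 0 :> (E3 R -> R) by apply/funext => x; rewrite /= subrr.
have h0 := testfun_H1 (t0 setT).
have g0 : wgrad Omega (cst 0) = cst 0 %[ae leb3 in Omega].
  have [g2 h] := testfun_is_wgrad (t0 setT).
  apply: (is_wgrad_unique oO bO (wgradP h0)); split; first exact: L2v0.
  move=> psi t; rewrite [X in - X](_ : _ = l2dot Omega (cst 0) psi)// l2dot0l oppr0.
  by rewrite -[RHS](integ0 Omega); apply: eq_integ => x _; rewrite mul0r.
rewrite /normH1 norm2_cst0 (norm2v_ae (wgrad_L2v h0) (L2v0 _) g0) norm2v_cst0.
by rewrite expr0n addr0 sqrtr0.
Qed.

Lemma normal_pairingE v p Q : spaceX Omega Gam v -> H12 Omega Sig p -> p Q ->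
  normal_pairing Omega v p = l2dot Omega v (wgrad Omega Q).
Proof.
move=> Xv Hp pQ; have pg := H12_get Hp; rewrite /normal_pairing.
have [P hP pE] := Hp.
have inp Q' : p Q' -> H1 Omega Q' /\ H1_0 Omega Sig (Q' \- P) by rewrite pE.
have [h1 z1] := inp _ pg; have [hQ zQ] := inp _ pQ.
have [v2 _ _] := (spaceXP oO bO _ v).1 Xv.
have [[hv _] d0] := Xv; have [d2 _] := wdivP hv.
have wE P' : H1 Omega P' -> H1_0 Omega Sig (P' \- P) ->
    l2dot Omega v (wgrad Omega P') = l2dot Omega v (wgrad Omega P).
  move=> h' z'; have := wgrad_H1_0 Xv z'; have [hD _] := z'.
  rewrite (l2dotr_ae v2 (wgrad_L2v hD) (L2vB (wgrad_L2v h') (wgrad_L2v hP)) (wgradB h' hP)).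
  rewrite (l2dotBr (wgrad_L2v h') (wgrad_L2v hP) v2) => /eqP.
  by rewrite subr_eq0 => /eqP.
rewrite (wE _ hQ zQ) -(wE _ h1 z1); have [P12 _] := h1.
rewrite integD; [|exact: L2v_dot v2 (wgrad_L2v h1)|exact: L2_mul].
rewrite [X in _ + X](_ : _ = 0) ?addr0// -(integ0 Omega); apply: integ_ae.
- exact: L2_mul.
- exact: (L2_L1 oO bO (L2_0 _)).
- by apply: aeS d0 => x h Ox; rewrite h// mul0r.
Qed.

Lemma norm12_ge0 p : 0 <= norm12 Omega p.
Proof.
rewrite /norm12; have [->|/set0P ne] := eqVneq p set0; first by rewrite image_set0 inf0.
apply: lb_le_inf; first by case: ne => Q pQ; exists (normH1 Omega Q), Q.
by move=> _ [Q _ <-]; exact: sqrtr_ge0.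
Qed.

(** [norm12] is an infimum over liftings and the pairing may be computed with any of them, so the
    estimate for one lifting passes to the infimum. *)
Lemma normal_pairing_le v p : spaceX Omega Gam v -> H12 Omega Sig p ->
  `|normal_pairing Omega v p| <= norm2v Omega v * norm12 Omega p.
Proof.
move=> Xv Hp; have pg := H12_get Hp; have [v2 _ _] := (spaceXP oO bO _ v).1 Xv.
have bd Q : p Q -> `|normal_pairing Omega v p| <= norm2v Omega v * normH1 Omega Q.
  move=> pQ; rewrite (normal_pairingE Xv Hp pQ).
  have hQ : H1 Omega Q by move: Hp pQ => [P _ ->] [].
  rewrite (le_trans (l2dot_CSn v2 (wgrad_L2v hQ)))// ler_wpM2l ?norm2v_ge0//.
  exact: norm2v_wgrad_le.
have [v0|v0] := eqVneq (norm2v Omega v) 0.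
  by have := bd _ pg; rewrite v0 !mul0r.
have vp : 0 < norm2v Omega v by rewrite lt_neqAle eq_sym v0 norm2v_ge0.
rewrite mulrC -ler_pdivrMr//; apply: lb_le_inf.
  by exists (normH1 Omega (get p)), (get p).
by move=> _ [Q pQ <-]; rewrite ler_pdivrMr// mulrC bd.
Qed.

Lemma normal_pairing_lin (a : R) u v p : spaceX Omega Gam u -> spaceX Omega Gam v ->
  spaceX Omega Gam (a *: u + v) -> H12 Omega Sig p ->
  normal_pairing Omega (a *: u + v) p =
  a * normal_pairing Omega u p + normal_pairing Omega v p.
Proof.
move=> Xu Xv Xuv Hp; have pg := H12_get Hp.
have hQ : H1 Omega (get p) by move: Hp pg => [P _ ->] [].
rewrite !(normal_pairingE _ Hp pg)// l2dotPl//; last exact: wgrad_L2v.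
  by have [] := (spaceXP oO bO _ u).1 Xu.
by have [] := (spaceXP oO bO _ v).1 Xv.
Qed.

End Pairing.

(** * Piecewise polynomial fields on tetrahedra *)

Section Polynomials.
Context {R : realType}.
Implicit Types (f g p : E3 R -> R) (q : E3 R -> E3 R).

Definition mono (i j l : nat) (x : E3 R) : R := x.1.1 ^+ i * x.1.2 ^+ j * x.2 ^+ l.

Lemma fun_sum_ind (I : finType) (D : pred I) (F : I -> E3 R -> R)
    (P : (E3 R -> R) -> Prop) :
  P (fun=> 0) -> (forall f g, P f -> P g -> P (fun x => f x + g x)) ->
  (forall i, D i -> P (F i)) -> P (fun x => \sum_(i | D i) F i x).
Proof.
move=> P0 PD PF; elim: (index_enum I) => [|i s IH].
  by rewrite (_ : (fun x => _) = (fun=> 0))//; apply/funext => x; rewrite big_nil.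
have [Di|Di] := boolP (D i).
  rewrite (_ : (fun x => _) = (fun x => F i x + \sum_(i <- s | D i) F i x)).
    by apply: PD => //; exact: PF.
  by apply/funext => x; rewrite big_cons Di.
by rewrite (_ : (fun x => _) = (fun x => \sum_(i <- s | D i) F i x))//;
  apply/funext => x; rewrite big_cons (negbTE Di).
Qed.

Lemma monomial_sum_ind k (D : nat -> bool) c (P : (E3 R -> R) -> Prop) :
  P (fun=> 0) -> (forall f g, P f -> P g -> P (fun x => f x + g x)) ->
  (forall (a : R) f, P f -> P (fun x => a * f x)) ->
  (forall i j l : nat, (i <= k)%N -> (j <= k)%N -> (l <= k)%N -> D (i + j + l)%N ->
     P (mono i j l)) ->
  P (monomial_sum k D c).
Proof.
move=> P0 PD PZ Pm; rewrite /monomial_sum.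
apply: fun_sum_ind => // i _; apply: fun_sum_ind => // j _; apply: fun_sum_ind => // l Dl.
rewrite (_ : (fun x => _) = (fun x => c i j l * mono i j l x)).
  by apply: PZ; apply: Pm => //; rewrite -ltnS.
by apply/funext => x; rewrite /mono !mulrA.
Qed.

Lemma monomial_sum_lin k D c c' (a : R) x :
  monomial_sum k D (fun i j l => a * c i j l + c' i j l) x =
  a * monomial_sum k D c x + monomial_sum k D c' x.
Proof.
rewrite /monomial_sum mulr_sumr -big_split; apply: eq_bigr => i _ /=.
rewrite mulr_sumr -big_split; apply: eq_bigr => j _ /=.
rewrite mulr_sumr -big_split; apply: eq_bigr => l _ /=.
by rewrite !mulrDl !mulrA.
Qed.

Lemma monomial_sum0 k D x : monomial_sum k D (fun _ _ _ => 0 : R) x = 0.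
Proof.
rewrite /monomial_sum; apply: big1 => i _; apply: big1 => j _; apply: big1 => l _.
by rewrite !mul0r.
Qed.

(** The common form of [poly_le], [poly_homog] and [box_poly], which differ only in the filter [D]
    on total degrees. *)
Definition polyD k (D : nat -> bool) f : Prop :=
  exists c, forall x, f x = monomial_sum k D c x.

Lemma polyD_lin k D (a : R) f g : polyD k D f -> polyD k D g ->
  polyD k D (fun x => a * f x + g x).
Proof.
move=> [c hc] [c' hc']; exists (fun i j l => a * c i j l + c' i j l) => x.
by rewrite monomial_sum_lin hc hc'.
Qed.

Lemma polyD0 k D : polyD k D (fun=> 0).
Proof. by exists (fun _ _ _ => 0) => x; rewrite monomial_sum0. Qed.

Lemma polyDD k D f g : polyD k D f -> polyD k D g -> polyD k D (fun x => f x + g x).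
Proof.
move=> hf hg; have := polyD_lin 1 hf hg; congr polyD.
by apply/funext => x; rewrite mul1r.
Qed.

Lemma polyDZ k D (a : R) f : polyD k D f -> polyD k D (fun x => a * f x).
Proof.
move=> hf; have := polyD_lin a hf (polyD0 k D); congr polyD.
by apply/funext => x; rewrite addr0.
Qed.

Lemma polyD_mono k (D : nat -> bool) (i j l : nat) : (i <= k)%N -> (j <= k)%N -> (l <= k)%N ->
  D (i + j + l)%N -> polyD k D (mono i j l).
Proof.
move=> ik jk lk Dl.
exists (fun i' j' l' => ([&& i' == i, j' == j & l' == l])%:R) => x.
rewrite /monomial_sum (bigD1 (Ordinal (n := k.+1) ik))//= [X in _ + X]big1 ?addr0.
  rewrite (bigD1 (Ordinal (n := k.+1) jk))//= [X in _ + X]big1 ?addr0.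
    rewrite (bigD1 (Ordinal (n := k.+1) lk))//= [X in _ + X]big1 ?addr0.
      by rewrite !eqxx mul1r.
    move=> l' /andP[_ nl]; rewrite eqxx eqxx /= (_ : (l' == l :> nat) = false) ?mul0r//.
    by apply/negbTE; apply: contra nl => /eqP e; apply/eqP/val_inj.
  move=> j' nj; apply: big1 => l' _; rewrite eqxx (_ : (j' == j :> nat) = false) ?mul0r//.
  by apply/negbTE; apply: contra nj => /eqP e; apply/eqP/val_inj.
move=> i' ni; apply: big1 => j' _; apply: big1 => l' _.
rewrite (_ : (i' == i :> nat) = false) ?mul0r//.
by apply/negbTE; apply: contra ni => /eqP e; apply/eqP/val_inj.
Qed.

Lemma polyD_sub k k' (D D' : nat -> bool) f : (k <= k')%N -> (forall m, D m -> D' m) ->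
  polyD k D f -> polyD k' D' f.
Proof.
move=> kk DD [c hc]; rewrite (_ : f = monomial_sum k D c); last exact/funext.
apply: monomial_sum_ind.
- exact: polyD0.
- by move=> ? ?; exact: polyDD.
- by move=> ? ?; exact: polyDZ.
by move=> i j l ik jk lk /DD; apply: polyD_mono; apply: leq_trans kk.
Qed.

Definition poly_C1 k f : Prop := continuous f /\
  forall i : 'I_3, exists2 g, poly_le k g & forall x, is_derive x (axis i) f (g x).

Lemma is_derive_coord (pr : E3 R -> R) (x v : E3 R) :
  (forall (h : R), pr (h *: v + x) = pr x + h * pr v) -> is_derive x v pr (pr v).
Proof.
move=> hl; have := is_derive_comp_line hl (is_derive_id (pr x) (1 : R)).
by rewrite mulr1.
Qed.

Lemma mono_C1 k i j l : (i + j + l <= k.+1)%N -> poly_C1 k (mono i j l).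
Proof.
move=> ijl.
have cX (t : E3 R -> R) n : continuous t -> continuous (fun x => t x ^+ n).
  by move=> ct x; exact: (continuous_comp (ct x) (@exprn_continuous _ n _)).
split.
  move=> x; apply: cvgM; first apply: cvgM.
  - exact: (cX _ _ coord1_continuous).
  - exact: (cX _ _ coord2_continuous).
  - exact: (cX _ _ coord3_continuous).
move=> a; pose e := axis a : E3 R.
(* For a zero exponent the truncated [.-1] is harmless, since the coefficient in front is then 0. *)
exists (fun x => (i%:R * e.1.1) * mono i.-1 j l x + (j%:R * e.1.2) * mono i j.-1 l x +
  (l%:R * e.2) * mono i j l.-1 x).
  have Z (n i' j' l' : nat) (t : R) : (n == 0%N) || (i' + j' + l' <= k)%N ->
      poly_le k (fun x => (n%:R * t) * mono i' j' l' x).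
    move=> /orP[/eqP ->|h].
      rewrite (_ : (fun x => _) = (fun=> 0)); first exact: polyD0.
      by apply/funext => x; rewrite !mul0r.
    apply: polyDZ; apply: polyD_mono => //; apply: leq_trans h.
    - by rewrite -addnA leq_addr.
    - by rewrite addnAC leq_addl.
    - exact: leq_addl.
  by apply: polyDD; first apply: polyDD; apply: Z;
    [case: i ijl|case: j ijl|case: l ijl] => //= n; rewrite ?addSn ?addnS ?addSn ltnS.
move=> x.
have d1 : is_derive x e (fun x => x.1.1) e.1.1.
  by apply: (is_derive_coord (pr := fun x => x.1.1)) => h; rewrite addrC.
have d2 : is_derive x e (fun x => x.1.2) e.1.2.
  by apply: (is_derive_coord (pr := fun x => x.1.2)) => h; rewrite addrC.
have d3 : is_derive x e (fun x => x.2) e.2.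
  by apply: (is_derive_coord (pr := fun x => x.2)) => h; rewrite addrC.
have := is_deriveM (is_deriveM (is_deriveX i d1) (is_deriveX j d2)) (is_deriveX l d3).
rewrite !exprfctE => h; apply: (is_derive_eq h).
rewrite /mono.
change ((x.1.1 ^+ i * x.1.2 ^+ j) * ((l%:R * x.2 ^+ l.-1) * e.2) +
  x.2 ^+ l * (x.1.1 ^+ i * ((j%:R * x.1.2 ^+ j.-1) * e.1.2) +
    x.1.2 ^+ j * ((i%:R * x.1.1 ^+ i.-1) * e.1.1)) =
  i%:R * e.1.1 * (x.1.1 ^+ i.-1 * x.1.2 ^+ j * x.2 ^+ l) +
  j%:R * e.1.2 * (x.1.1 ^+ i * x.1.2 ^+ j.-1 * x.2 ^+ l) +
  l%:R * e.2 * (x.1.1 ^+ i * x.1.2 ^+ j * x.2 ^+ l.-1)).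
ring.
Qed.

Lemma poly_C1_sum k K (D : nat -> bool) f : (forall m, D m -> (m <= k.+1)%N) ->
  polyD K D f -> poly_C1 k f.
Proof.
move=> Dk [c hc]; rewrite (_ : f = monomial_sum K D c); last exact/funext.
apply: monomial_sum_ind.
- split; first exact: cst_continuous.
  by move=> i; exists (fun=> 0) => [|x]; [exact: polyD0|exact: is_derive_cst].
- move=> f1 f2 [c1 d1] [c2 d2]; split; first by move=> x; apply: cvgD; [exact: c1|exact: c2].
  move=> i; have [g1 p1 h1] := d1 i; have [g2 p2 h2] := d2 i.
  by exists (fun x => g1 x + g2 x) => [|x]; [exact: polyDD|exact: is_deriveD].
- move=> a f1 [c1 d1]; split; first by move=> x; apply: cvgM; [exact: cvg_cst|exact: c1].
  move=> i; have [g1 p1 h1] := d1 i.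
  by exists (fun x => a * g1 x) => [|x]; [exact: polyDZ|exact: is_deriveZ].
- by move=> i j l _ _ _ /Dk; exact: mono_C1.
Qed.

Lemma poly_C1_C1fun k f : poly_C1 k f -> C1fun f.
Proof.
move=> [cf df]; split => // i; have [g pg hg] := df i.
have e : (fun x => 'D_(axis i) f x) = g by apply/funext => x; have [_ ->] := hg x.
split; last by move=> x; have [] := hg x.
rewrite e; have [] // := @poly_C1_sum k k (fun m => m <= k)%N g _ pg.
by move=> m mk; exact: leqW.
Qed.

Lemma poly_C1_derive k f i : poly_C1 k f -> poly_le k (fun x => 'D_(axis i) f x).
Proof.
move=> [_ /(_ i)[g pg hg]]; rewrite (_ : (fun x => _) = g)//.
by apply/funext => x; have [_ ->] := hg x.
Qed.

Lemma poly_leB k f g : poly_le k f -> poly_le k g -> poly_le k (fun x => f x - g x).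
Proof.
move=> hf hg; have := polyD_lin (-1) hg hf; congr polyD.
by apply/funext => x; rewrite mulN1r addrC.
Qed.

Lemma nedelec_C1 k q : nedelec k q -> compwise (poly_C1 k) q.
Proof.
have add (f g : E3 R -> R) : poly_le k f -> poly_homog k.+1 g ->
    poly_C1 k (fun x => f x + g x).
  move=> hf hg; apply: (@poly_C1_sum k k.+1 (fun m => m <= k.+1)%N) => //; apply: polyDD.
    by apply: polyD_sub hf => // m /leqW.
  by apply: polyD_sub hg => // m /eqP ->.
move=> [p [r [[p1 p2 p3] [r1 r2 r3] _ qE]]].
by split; under eq_fun do rewrite qE; exact: add.
Qed.

(** Nedelec fields have degree at most [k.+1], so the curl has degree at most [k] and lies in the
    full polynomial part of the Raviart-Thomas space; the radial part is taken to be 0. *)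
Lemma curl_nedelec k q : nedelec k q -> raviart_thomas k (curl q).
Proof.
move=> /nedelec_C1[q1 q2 q3]; exists (curl q), (fun=> 0); split.
- split; apply: poly_leB.
  + exact: (poly_C1_derive 1 q3).
  + exact: (poly_C1_derive 2 q2).
  + exact: (poly_C1_derive 2 q1).
  + exact: (poly_C1_derive 0 q3).
  + exact: (poly_C1_derive 0 q2).
  + exact: (poly_C1_derive 1 q1).
- exact: polyD0.
- by move=> x; rewrite scale0r addr0.
Qed.

Lemma raviart_thomas_lin k (a : R) q q' : raviart_thomas k q -> raviart_thomas k q' ->
  raviart_thomas k (a *: q + q').
Proof.
move=> [p [r [[p1 p2 p3] hr qE]]] [p' [r' [[p1' p2' p3'] hr' qE']]].
exists (a *: p + p'), (fun x => a * r x + r' x); split.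
- by split; exact: polyD_lin.
- exact: polyD_lin.
- move=> x; have -> : (a *: q + q') x = a *: q x + q' x by [].
  rewrite qE qE' scalerDr scalerDl scalerA.
  by rewrite addrACA.
Qed.

Lemma nedelec_lin k (a : R) q q' : nedelec k q -> nedelec k q' ->
  nedelec k (a *: q + q').
Proof.
move=> [p [r [[p1 p2 p3] [r1 r2 r3] hr qE]]] [p' [r' [[p1' p2' p3'] [r1' r2' r3'] hr' qE']]].
exists (a *: p + p'), (a *: r + r'); split.
- by split; exact: polyD_lin.
- by split; exact: polyD_lin.
- by move=> x; rewrite dotPl hr hr' mulr0 addr0.
- move=> x; have -> : (a *: q + q') x = a *: q x + q' x by [].
  by rewrite qE qE' scalerDr addrACA.
Qed.

Lemma raviart_thomas0 k : raviart_thomas k (cst 0 : E3 R -> E3 R).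
Proof.
exists (cst 0), (fun=> 0); split; [by split; exact: polyD0|exact: polyD0|].
by move=> x; rewrite scale0r addr0.
Qed.

Lemma nedelec0 k : nedelec k (cst 0 : E3 R -> E3 R).
Proof.
exists (cst 0), (cst 0); split; [by split; exact: polyD0|by split; exact: polyD0| |].
- by move=> x; rewrite /dot !mul0r !addr0.
- by move=> x; rewrite addr0.
Qed.

(** Degree at most [K] in each variable separately: a crude space that contains both local spaces
    for [K = k.+1], used to see that the discrete spaces are finite-dimensional. *)
Definition box_poly K f : Prop := polyD K xpredT f.

Lemma nedelec_box k q : nedelec k q -> compwise (box_poly k.+1) q.
Proof.
have add (f g : E3 R -> R) : poly_le k f -> poly_homog k.+1 g ->
    box_poly k.+1 (fun x => f x + g x).
  by move=> hf hg; apply: polyDD; [apply: polyD_sub hf|apply: polyD_sub hg].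
move=> [p [r [[p1 p2 p3] [r1 r2 r3] _ qE]]].
by split; under eq_fun do rewrite qE; exact: add.
Qed.

Lemma raviart_thomas_box k q : raviart_thomas k q -> compwise (box_poly k.+1) q.
Proof.
move=> [p [r [[p1 p2 p3] [c hr] qE]]].
have add (f pr : E3 R -> R) : poly_le k f ->
    (forall i j l, (i <= k)%N -> (j <= k)%N -> (l <= k)%N ->
       box_poly k.+1 (fun x => mono i j l x * pr x)) ->
    box_poly k.+1 (fun x => f x + r x * pr x).
  move=> hf hm; apply: polyDD; first exact: polyD_sub hf.
  rewrite (_ : r = monomial_sum k (fun m => m == k) c); last exact/funext.
  apply: (@monomial_sum_ind k _ c (fun g => box_poly k.+1 (fun x => g x * pr x))).
  - rewrite (_ : (fun x => _) = (fun=> 0)); first exact: polyD0.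
    by apply/funext => x; rewrite mul0r.
  - move=> g1 g2 h1 h2; under eq_fun do rewrite mulrDl; exact: polyDD.
  - move=> a g1 h1; under eq_fun do rewrite -mulrA; exact: polyDZ.
  - by move=> i j l ik jk lk _; exact: hm.
split.
- under eq_fun do rewrite qE; apply: (add _ (fun x => x.1.1)) => // i j l ik jk lk.
  rewrite (_ : (fun x => _) = mono i.+1 j l).
    by apply: polyD_mono => //; exact: leqW.
  by apply/funext => x; rewrite /mono exprS; ring.
- under eq_fun do rewrite qE; apply: (add _ (fun x => x.1.2)) => // i j l ik jk lk.
  rewrite (_ : (fun x => _) = mono i j.+1 l).
    by apply: polyD_mono => //; exact: leqW.
  by apply/funext => x; rewrite /mono exprS; ring.
- under eq_fun do rewrite qE; apply: (add _ (fun x => x.2)) => // i j l ik jk lk.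
  rewrite (_ : (fun x => _) = mono i j l.+1).
    by apply: polyD_mono => //; exact: leqW.
  by apply/funext => x; rewrite /mono exprS; ring.
Qed.

End Polynomials.

(** * Barycentric coordinates and null faces *)

Section Tetrahedra.
Context {R : realType}.
Implicit Types (x : E3 R) (V : 'I_4 -> E3 R) (T : set (E3 R)).

Notation mu1 := (@lebesgue_measure R).

Lemma affine_graph_null d (S : measurableType d) (m : {measure set S -> \bar R})
    (f : S -> R) (b : R) : b != 0 ->
  ((m \x mu1)%E [set x : S * measurableTypeR R | (b * x.2 + f x.1 = 0)%R] = 0)%E.
Proof.
move=> b0; apply: integral0_eq => x _ /=.
rewrite (_ : xsection _ _ = [set - f x / b]%R); first exact: lebesgue_measure_set1.
apply/seteqP; split => t; rewrite /xsection /= ?inE /=.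
  by move=> h; rewrite -(mulKf b0 t) (_ : b * t = - f x) 1?mulrC//; lra.
by move=> ->; rewrite mulrC divfK//; lra.
Qed.

(** Along a coordinate in which the normal does not vanish, the plane meets each line in one point;
    the three cases follow the nesting of the product measure. *)
Lemma plane_negligible (n : E3 R) (c : R) : n != 0 ->
  {ae leb3, forall x, dot n x + c != 0}.
Proof.
move=> n0; exists [set x | dot n x + c = 0]; split => //.
- have m : mfun3 (fun x => dot n x + c).
    by apply: continuous_mfun3; exact: affine_continuous.
  have := m measurableT [set 0] (measurable_set1 _); rewrite setTI; exact.
- have [n2|n2] := eqVneq n.2 0; last first.
    have := affine_graph_null leb2 (fun p => n.1.1 * p.1 + n.1.2 * p.2 + c) n2.
    congr (leb3 _ = _); apply/seteqP; split => x /=; rewrite /dot; lra.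
  pose B := [set p : measurableTypeR R * measurableTypeR R |
    n.1.1 * p.1 + n.1.2 * p.2 + c = 0].
  have -> : [set x | dot n x + c = 0] = B `*` setT.
    by apply/seteqP; split => x; rewrite /B /= /dot n2 mul0r addr0 => // -[].
  have mB : measurable B.
    have m : measurable_fun setT (fun p : measurableTypeR R * measurableTypeR R =>
        n.1.1 * p.1 + n.1.2 * p.2 + c : R).
      apply: measurable_funD => //; apply: measurable_funD; apply: measurable_funM => //.
    by have := m measurableT [set 0] (measurable_set1 _); rewrite setTI.
  suff B0 : leb2 B = 0%E.
    have -> : leb3 (B `*` setT : set (M3 R)) = (leb2 \x mu1)%E (B `*` setT) by [].
    apply: eq_trans (product_measure1E leb2 mu1 mB measurableT) _.
    apply: eq_trans (mul0e (mu1 setT)); congr (_ * _)%E; exact: B0.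
  have [n1|n1] := eqVneq n.1.2 0; last first.
    have := affine_graph_null mu1 (fun p => n.1.1 * p + c) n1.
    congr (leb2 _ = _); apply/seteqP; split => x /=; rewrite /B /=; lra.
  have n11 : n.1.1 != 0.
    apply: contra n0 => /eqP n11; apply/eqP.
    by rewrite [n]surjective_pairing [n.1]surjective_pairing n11 n1 n2.
  have -> : B = [set - c / n.1.1] `*` setT.
    apply/seteqP; split => p; rewrite /B /= n1 mul0r addr0.
      move=> h; split => //; rewrite -(mulKf n11 p.1) mulrC; congr (_ * _); lra.
    by move=> [-> _]; rewrite mulrC divfK//; lra.
  apply: eq_trans (product_measure1E mu1 mu1 (measurable_set1 _) measurableT) _.
  by apply: eq_trans (mul0e (mu1 setT)); congr (_ * _)%E; exact: lebesgue_measure_set1.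
- by move=> x /= /negP; rewrite negbK => /eqP.
Qed.

(** Inverts the matrix whose rows are the vertices completed by a 1, which affine independence makes
    nonsingular. Coordinate [i] is 1 at vertex [i] and 0 at the others, so it is not constant and
    its gradient [n i] is nonzero. *)
Lemma barycentric V : affine_indep V ->
  exists (n : 'I_4 -> E3 R) (c : 'I_4 -> R), (forall i, n i != 0) /\
    forall x t, \sum_i t i = 1 /\ x = \sum_i t i *: V i <->
      forall i, t i = dot (n i) x + c i.
Proof.
move=> indV.
pose hom (a : R) x : 'rV[R]_4 := \row_j [:: x.1.1; x.1.2; x.2; a]`_j.
pose M : 'M[R]_4 := \matrix_(i, j) hom 1 (V i) 0 j.
have MP t a x : (\row_i t i) *m M = hom a x <->
    \sum_i t i = a /\ x = \sum_i t i *: V i.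
  split => [/matrixP h|[h1 h2]].
    have h0 := h 0 0; have h1 := h 0 1; have h2 := h 0 2%:R; have h3 := h 0 3%:R.
    move: h0 h1 h2 h3; rewrite !mxE !big_ord_recl !big_ord0 !mxE /= => h0 h1 h2 h3.
    rewrite !mulr1 in h3; split => //.
    by rewrite [LHS]surjective_pairing [x.1]surjective_pairing -h0 -h1 -h2.
  apply/rowP => j; rewrite !mxE -h1 h2 !big_ord_recl !big_ord0 !mxE.
  case: j => -[|[|[|[|//]]]] ? //=; rewrite !mulr1//.
have uM : M \in unitmx.
  rewrite -row_free_unit; apply/inj_row_free => v v0.
  have [|s0 x0] := (MP (fun i => v 0 i) 0 0).1.
    rewrite (_ : \row_i _ = v); last by apply/rowP => i; rewrite mxE.
    by rewrite v0; apply/rowP => j; rewrite !mxE; case: j => -[|[|[|[|//]]]].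
  by apply/rowP => i; rewrite (indV (fun i => v 0 i))// mxE.
pose N := invmx M.
pose n i : E3 R := (N 0 i, N 1 i, N 2%:R i); pose c i := N 3%:R i.
have nP x i : (hom 1 x *m N) 0 i = dot (n i) x + c i.
  rewrite mxE !big_ord_recl big_ord0 !mxE /= /dot /n /c /=.
  rewrite !(mulrC (N _ _)) mul1r addr0 -!addrA.
  by congr (_ * N _ _ + (_ * N _ _ + (_ * N _ _ + N _ _))); exact: val_inj.
have bP x t : \sum_i t i = 1 /\ x = \sum_i t i *: V i <->
    forall i, t i = dot (n i) x + c i.
  rewrite -MP; split => [h i|h].
    by rewrite -nP -h mulmxK// mxE.
  rewrite -[RHS](mulmxKV uM); congr (_ *m _); apply/rowP => i.
  by rewrite mxE h nP.
exists n, c; split => // i; apply/eqP => n0.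
have vtx j : dot (n i) (V j) + c i = (i == j)%:R.
  symmetry; move: i {n0}; apply/bP.
  split; first by rewrite (bigD1 j)//= eqxx big1 ?addr0// => i /negbTE ->.
  rewrite (bigD1 j)//= eqxx scale1r big1 ?addr0// => i /negbTE ->.
  by rewrite scale0r.
have e0 j : c i = (i == j)%:R by rewrite -vtx n0 /dot !mul0r !add0r.
(* [ord_pred] is cyclic, so it always yields a vertex different from [i]. *)
have := e0 i; rewrite eqxx; have := e0 (ord_pred i) => ->.
case: (i == _) / eqP => [h _|_]; last by move/eqP; rewrite eq_sym oner_eq0.
by move: h => /(congr1 val); case: i {n0 vtx e0} => -[|[|[|[|//]]]].
Qed.

Lemma tetrahedron_halfspaces T : tetrahedron T ->
  exists (n : 'I_4 -> E3 R) (c : 'I_4 -> R), (forall i, n i != 0) /\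
    T = [set x | forall i, 0 <= dot (n i) x + c i].
Proof.
move=> [V [/barycentric[n [c [n0 nP]]] ->]]; exists n, c; split => //.
have inE (F : 'I_4 -> E3 R) (f : 'I_4 -> R) :
    (\sum_(i in [set: 'I_4]%SET) f i = \sum_i f i) /\
    (\sum_(i in [set: 'I_4]%SET) F i = \sum_i F i).
  by split; apply: eq_bigl => i; rewrite inE.
apply/seteqP; split => x /=.
  move=> [t [t0 t1 xE]] i; rewrite -((nP x t).1 _ i)//.
  by rewrite -(inE (fun i => t i *: V i) t).1 -(inE (fun i => t i *: V i) t).2.
move=> h; exists (fun i => dot (n i) x + c i).
have [h1 h2] := (nP x (fun i => dot (n i) x + c i)).2 (fun=> erefl).
by split => //; rewrite ?(inE (fun i => (dot (n i) x + c i) *: V i) _).2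
  ?(inE (fun=> 0) _).1.
Qed.

(** Off the four planes of its faces, a point of [T] has positive barycentric coordinates, and this
    is an open condition. *)
Lemma tetrahedron_ae_interior T : tetrahedron T ->
  {ae leb3, forall x, T x -> T° x}.
Proof.
move=> /tetrahedron_halfspaces[n [c [n0 ->]]].
have : {ae leb3, forall x, forall i, dot (n i) x + c i != 0}.
  have P i := plane_negligible (c i) (n0 i).
  apply: aeS2 (P 0) (aeS2 (fun _ a b => conj a b) (P 1)
    (aeS2 (fun _ a b => conj a b) (P 2%:R) (P 3%:R))) => x h0 [h1 [h2 h3]] i.
  have : i \in [:: 0; 1; 2%:R; 3%:R : 'I_4] by case: i => -[|[|[|[|//]]]] ?.
  by rewrite !inE => /orP[/eqP ->|/orP[/eqP ->|/orP[/eqP ->|/eqP ->]]].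
apply: aeS => x h hx.
have pos i : 0 < dot (n i) x + c i by rewrite lt_def h hx.
rewrite /interior.
have : \forall y \near x, forall i : 'I_4, 0 < dot (n i) y + c i.
  apply: (@filter_forall _ _ (fun i y => 0 < dot (n i) y + c i) (nbhs x) _) => i.
  by have /cvgr_gt := @affine_continuous R (n i) (c i) x; apply.
by apply: filterS => y hy i; exact: ltW.
Qed.

End Tetrahedra.

(** * Open subsets of the closure of a Lipschitz domain *)

Section LipschitzBoundary.
Context {R : realType}.
Implicit Types (x y : E3 R) (U Omega : set (E3 R)).

Lemma dotZl (a : R) x y : dot (a *: x) y = a * dot x y.
Proof. by rewrite -[a *: x]addr0 dotPl /dot !mul0r !addr0. Qed.

Lemma continuous_dot x (c : E3 R) : continuous (fun y : E3 R => dot (y - x) c).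
Proof.
rewrite (_ : (fun y => _) = (fun y => dot c y + - dot c x)).
  exact: affine_continuous.
by apply/funext => y; rewrite addrC -scaleN1r dotPl !(dotC c) mulN1r addrC.
Qed.

(* At a boundary point the outward direction of the local frame leaves the
   closure of Omega, so an open subset of that closure misses the boundary. *)
Lemma open_sub_lipschitz Omega U : open Omega -> lipschitz_boundary Omega ->
  open U -> U `<=` closure Omega -> U `<=` Omega.
Proof.
move=> oO lO oU UO x Ux; apply: contrapT => nOx.
have [|a [b [c [L [r [g [[aa bb cc] [ab ac bc] r0 Lg gO]]]]]]] := lO x.
  by split; [exact: UO|move/interior_subset].
(* Otherwise the hypograph would contain [x], the origin of the local frame. *)
have g0 : g (0, 0) <= 0.
  rewrite leNgt; apply/negP => g0; apply: nOx; apply/gO.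
    by rewrite subrr /enorm /dot !mul0r !addr0 sqrtr0.
  by rewrite subrr /dot !mul0r !addr0.
have line t : enorm (t *: c + x - x) = `|t| /\ dot (t *: c + x - x) a = 0 /\
   dot (t *: c + x - x) b = 0 /\ dot (t *: c + x - x) c = t.
  rewrite addrK /enorm !dotZl (dotC c (t *: c)) dotZl cc mulr1 -expr2 sqrtr_sqr.
  by rewrite (dotC c a) ac (dotC c b) bc !mulr0.
have [t [Ut [tr t0]]] : exists t, U (t *: c + x) /\ (t < r /\ 0 < t).
  apply: (@filter_ex _ (0 : R)^'+); near=> t; split; last first.
    by split; [near: t; exact: nbhs_right_lt|near: t; exact: nbhs_right_gt].
  near: t; apply: cvg_within.
  have : (fun t : R => t *: c + x) t @[t --> (0 : R)] --> x.
    rewrite -[X in _ --> X]add0r -(scale0r c).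
    by apply: cvgD; [apply: cvgZr_tmp; exact: cvg_id|exact: cvg_cst].
  by apply; exact: open_nbhs_nbhs.
have [ey [ya [yb yc]]] := line t.
pose p (z : E3 R) : R * R := (dot (z - x) a, dot (z - x) b).
have ch : {for t *: c + x, continuous (fun z : E3 R => dot (z - x) c - L * `|p z|)}.
  apply: cvgB; first exact: continuous_dot.
  apply: cvgM; first exact: cvg_cst.
  have cp : {for t *: c + x, continuous p}.
    exact: (cvg_pair (@continuous_dot x a (t *: c + x)) (@continuous_dot x b (t *: c + x))).
  exact: (cvg_norm cp).
have cn : {for t *: c + x, continuous (fun z : E3 R => enorm (z - x))}.
  pose q (z : E3 R) := dot (z - x) (z - x).
  have cq : {for t *: c + x, continuous q}.
    have c1 : {for t *: c + x, continuous (fun z : E3 R => (z - x).1.1)}.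
      by apply: cvgB; [exact: coord1_continuous|exact: cvg_cst].
    have c2 : {for t *: c + x, continuous (fun z : E3 R => (z - x).1.2)}.
      by apply: cvgB; [exact: coord2_continuous|exact: cvg_cst].
    have c3 : {for t *: c + x, continuous (fun z : E3 R => (z - x).2)}.
      by apply: cvgB; [exact: coord3_continuous|exact: cvg_cst].
    by apply: cvgD; first apply: cvgD; apply: cvgM.
  exact: (continuous_comp cq (@sqrt_continuous R _)).
(* Near [t *: c + x] all points lie above the graph, because [g (p z) <= g (0, 0) + L * |p z| < dot
   (z - x) c]; but this point is in the closure of [Omega], so one of them belongs to [Omega]. *)
have /UO/(_ [set z : E3 R | enorm (z - x) < r /\
  0 < dot (z - x) c - L * `|p z|])[|z [Oz [zr zp]]] := Ut.
  near=> z; split; near: z.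
    by move/cvgr_lt: cn; apply; rewrite ey gtr0_norm.
  by move/cvgr_gt: ch; apply; rewrite yc /p ya yb [`|_|]normr0 mulr0 subr0.
have := (gO z zr).1 Oz; apply/negP; rewrite -leNgt.
have /(_ (p z, (0, 0)) (conj I I)) /= := Lg.
rewrite [p z - _]subr0 => /(le_trans (ler_norm _)); lra.
Unshelve. all: by end_near.
Qed.

End LipschitzBoundary.

(** * Weak curls on subdomains *)

Section Localization.
Context {R : realType}.
Implicit Types (Omega U V : set (E3 R)) (f g : E3 R -> R) (u v w th q : E3 R -> E3 R).

Lemma L2_dominated U V f g : mfun3 (f \_ U) ->
  (forall x, `|(f \_ U) x| <= `|(g \_ V) x|) -> L2 V g -> L2 U f.
Proof.
move=> mf fg /L2P[mg eg]; apply/L2P; split => //; apply: le_lt_trans eg.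
apply: ge0_le_integral => //.
- by move=> x _; rewrite lee_fin sqr_ge0.
- exact: measurable_EFin_sqr.
- exact: measurable_EFin_sqr.
- move=> x _; rewrite lee_fin -(real_normK (num_real ((f \_ U) x))).
  by rewrite -(real_normK (num_real ((g \_ V) x))) ler_pXn2r ?nnegrE.
Qed.

Lemma mfun3_patch U f : measurable (U : set (M3 R)) -> mfun3 f -> mfun3 (f \_ U).
Proof.
move=> mU mf; apply/(measurable_restrictT _ mU).
by apply: measurable_funS mf => //.
Qed.

Lemma patch_sub U V f : U `<=` V -> (f \_ V) \_ U = f \_ U.
Proof.
move=> UV; apply/funext => x; rewrite !patchE; case: ifPn => // /[!inE] /UV Vx.
by rewrite mem_set.
Qed.

Lemma L2_sub U V f : measurable (U : set (M3 R)) -> U `<=` V -> L2 V f -> L2 U f.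
Proof.
move=> mU UV fV; have /L2P[mf _] := fV; apply: L2_dominated fV.
  by rewrite -(patch_sub f UV); exact: mfun3_patch.
move=> x; rewrite !patchE; case: ifPn => [/[!inE] /UV Vx|_]; first by rewrite mem_set.
by rewrite normr0.
Qed.

Lemma L2v_sub U V u : measurable (U : set (M3 R)) -> U `<=` V -> L2v V u -> L2v U u.
Proof. by move=> mU UV [u1 u2 u3]; split; exact: L2_sub UV _. Qed.

Lemma continuous_L2 U f : open U -> bounded_set U -> continuous f -> L2 U f.
Proof.
move=> oU bU cf; have [M0 [_ hM]] := bU; pose M := Num.max M0 0 + 1.
pose K : set (E3 R) := cbox (- M, - M, - M) (M, M, M).
have UK : U `<=` K.
  move=> x Ux; have := hM M; rewrite /M ltr_pwDr// ?le_max ?lexx// => /(_ isT x Ux) /=.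
  rewrite /K /cbox /= -!ler_norml; rewrite /Num.norm /= !ge_max.
  by move=> /andP[/andP[-> ->] ->].
have : compact (f @` K).
  apply: continuous_compact; last exact: cbox_compact.
  by apply: continuous_subspaceT => x; exact: cf.
move=> /compact_bounded[C0 [_ hC]]; pose C := Num.max C0 0 + 1.
have fC x : K x -> `|f x| <= C.
  by move=> Kx; apply: (hC C); [rewrite ltr_pwDr// le_max lexx|exists x].
apply: (L2_dominated (g := cst C) (V := U)); last exact: L2_cst.
  by apply: mfun3_patch; [exact: open_measurable3|exact: continuous_mfun3].
move=> x; rewrite !patchE; case: ifPn => [/[!inE] /UK /fC h|_]; last by rewrite normr0.
exact: le_trans h (ler_norm _).
Qed.

Lemma integ_sub U V h : U `<=` V -> (forall x, ~ U x -> h x = 0) ->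
  integ V h = integ U h :> R.
Proof.
by move=> UV h0; rewrite !integ_supp// => x nV; apply: h0 => /UV.
Qed.

Lemma testfunS U V phi : U `<=` V -> testfun U phi -> testfun V phi.
Proof. by move=> UV [s k sU]; split => // x /sU /UV. Qed.

(** Test fields on [U] are test fields on [Omega], so [w] is still the weak curl of [th] on [U],
    where integration by parts and the fundamental lemma identify it with the classical curl of
    [q]. *)
Lemma curl_C1_local Omega U th w q : open Omega -> bounded_set Omega -> open U ->
  U `<=` Omega -> L2v Omega th -> is_wcurl Omega th w -> compwise C1fun q ->
  th = q %[ae leb3 in U] -> w = curl q %[ae leb3 in U].
Proof.
move=> oO bO oU UO th2 [w2 hw] q1 thq.
have bU : bounded_set U.
  by have [M [Mr hM]] := bO; exists M; split => // N /hM h x /UO; exact: h.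
have mU := open_measurable3 oU.
have [[q1c q1d] [q2c q2d] [q3c q3d]] := q1.
have qU : L2v U q by split; exact: continuous_L2.
have cqU : L2v U (curl q).
  have L2D f i : C1fun f -> L2 U (fun x => 'D_(axis i) f x).
    by move=> [_ /(_ i)[cd _]]; exact: continuous_L2.
  case: q1 => h1 h2 h3; split; apply: L2B.
  + exact: (L2D _ 1 h3).
  + exact: (L2D _ 2 h2).
  + exact: (L2D _ 2 h1).
  + exact: (L2D _ 0 h3).
  + exact: (L2D _ 0 h2).
  + exact: (L2D _ 1 h1).
have wU : L2v U w by exact: L2v_sub UO w2.
have thU : L2v U th by exact: L2v_sub UO th2.
apply: ae_subr0; apply: (weak_eq0v oU bU); first exact: L2vB.
move=> psi t; have pU := testfun_L2v oU t; have cpU := curl_L2v oU t.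
rewrite (l2dotBl wU cqU pU).
have tO : compwise (testfun Omega) psi by case: t => t1 t2 t3; split; exact: testfunS UO _.
have psi0 x : ~ U x -> psi x = 0.
  case: t => t1 t2 t3 nU; rewrite [psi x]surjective_pairing [(psi x).1]surjective_pairing.
  by rewrite (testfun_out t1 nU) (testfun_out t2 nU) (testfun_out t3 nU).
have cpsi0 x : ~ U x -> curl psi x = 0.
  case: t => t1 t2 t3 nU; rewrite /curl /pd1 /pd2 /pd3.
  have d (phi : E3 R -> R) (v : E3 R) (t : testfun U phi) : 'D_v phi x = 0.
    exact: testfun_out (testfun_derive v t) nU.
  by rewrite !(d _ _ t1) !(d _ _ t2) !(d _ _ t3) subrr.
have dot0 (y : E3 R) : dot y 0 = 0 by rewrite /dot !mulr0 !addr0.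
apply/eqP; rewrite subr_eq0; apply/eqP.
transitivity (l2dot Omega w psi).
  by symmetry; apply: integ_sub => // x /psi0 ->.
rewrite -[LHS]hw//; transitivity (l2dot U th (curl psi)).
  by apply: integ_sub => // x /cpsi0 ->.
by rewrite (l2dot_ae thU qU cpU thq); exact: integ_curl_C1.
Qed.

(** The curl is identified on the interior of [T], where test fields live; the rest of [T] is a null
    set. *)
Lemma curl_nedelec_piecewise Omega T k th w q : open Omega -> bounded_set Omega ->
  lipschitz_boundary Omega -> tetrahedron T -> T `<=` closure Omega ->
  L2v Omega th -> is_wcurl Omega th w -> nedelec k q ->
  th = q %[ae leb3 in T] -> w = curl q %[ae leb3 in T].
Proof.
move=> oO bO lO tT TO th2 hw nq thq.
have oU : open T° by exact: open_interior.
have UO : T° `<=` Omega.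
  by apply: open_sub_lipschitz => // x /interior_subset /TO.
have q1 : compwise C1fun q.
  have [h1 h2 h3] := nedelec_C1 nq.
  by split; [exact: poly_C1_C1fun h1|exact: poly_C1_C1fun h2|exact: poly_C1_C1fun h3].
have thq' : th = q %[ae leb3 in T°].
  by apply: aeS thq => x h /interior_subset; exact: h.
have := curl_C1_local oO bO oU UO th2 hw q1 thq'.
by apply: aeS2 (tetrahedron_ae_interior tT) => x h1 h2 /h1 /h2.
Qed.

End Localization.

(** * Finite dimension of the discrete spaces *)

Section Dimension.
Context {R : realType}.
Implicit Types (Omega : set (E3 R)) (q : E3 R -> E3 R) (F G : bool -> E3 R -> E3 R).

Lemma compwiseP (P : (E3 R -> R) -> Prop) q :
  compwise P q <-> forall i, P (fun x => dot (axis i) (q x)).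
Proof.
have e0 : (fun x => dot (axis 0) (q x)) = (fun x => (q x).1.1).
  by apply/funext => x; rewrite /dot /= mul1r !mul0r !addr0.
have e1 : (fun x => dot (axis 1) (q x)) = (fun x => (q x).1.2).
  by apply/funext => x; rewrite /dot /= mul1r !mul0r addr0 add0r.
have e2 : (fun x => dot (axis 2) (q x)) = (fun x => (q x).2).
  by apply/funext => x; rewrite /dot /= mul1r !mul0r !add0r.
split=> [[h0 h1 h2] i|h]; last by rewrite /compwise -e0 -e1 -e2.
have : i \in [:: 0; 1; 2 : 'I_3] by case: i => -[|[|[|//]]] ?.
by rewrite !inE => /orP[/eqP ->|/orP[/eqP ->|/eqP ->]]; rewrite ?e0 ?e1 ?e2.
Qed.

Variables (s : seq (set (E3 R))) (K : nat).

(* Coordinates of a pair of piecewise polynomial fields, the pair being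
   indexed by bool. *)
Definition coefs : finType :=
  ('I_(size s) * bool * 'I_3 * ('I_K.+1 * 'I_K.+1 * 'I_K.+1))%type.

(** [monomial_sum] expects coefficients indexed by [nat] but reads them only at indices up to [K],
    where [inord] loses nothing. *)
Definition represents F (c : coefs -> R) : Prop :=
  forall (i : 'I_(size s)) (b : bool) (j : 'I_3),
  (fun x => dot (axis j) (F b x)) =
  monomial_sum K xpredT (fun n m l => c (i, b, j, (inord n, inord m, inord l)))
    %[ae leb3 in nth set0 s i].

Lemma represents_exists F :
  (forall T, T \in s -> forall b, exists2 q, compwise (box_poly K) q &
    F b = q %[ae leb3 in T]) -> exists c, represents F c.
Proof.
move=> hF.
have /choice[C hC] : forall t : 'I_(size s) * bool * 'I_3, exists c0,
    (fun x => dot (axis t.2) (F t.1.2 x)) = monomial_sum K xpredT c0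
      %[ae leb3 in nth set0 s t.1.1].
  move=> [[i b] j]; have [q /compwiseP/(_ j)[c hc] Fq] := hF _ (mem_nth set0 (ltn_ord i)) b.
  by exists c; apply: aeS Fq => x h /h /= ->; rewrite hc.
exists (fun t : coefs => C t.1 t.2.1.1 t.2.1.2 t.2.2) => i b j; have := hC (i, b, j).
apply: aeS => x h /h ->; apply: eq_bigr => n _; apply: eq_bigr => m _.
by apply: eq_bigr => l _; rewrite /= !inord_val.
Qed.

Lemma represents_lin (a : R) F G c d : represents F c -> represents G d ->
  represents (fun b => a *: F b + G b) (fun t => a * c t + d t).
Proof.
move=> hF hG i b j; apply: aeS2 (hF i b j) (hG i b j) => x h1 h2 sx.
rewrite monomial_sum_lin -h1// -h2//.
have -> : (a *: F b + G b) x = a *: F b x + G b x by [].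
by rewrite dotC dotPl !(dotC (axis j)).
Qed.

Lemma represents0 Omega F : Omega `<=` \bigcup_(T in [set` s]) T ->
  represents F (fun=> 0) -> forall b, F b = cst 0 %[ae leb3 in Omega].
Proof.
move=> Os hF b.
have hT T : T \in s -> F b = cst 0 %[ae leb3 in T].
  move=> /(nthP set0)[i si <-].
  have h j : (fun x => dot (axis j) (F b x)) = cst 0 %[ae leb3 in nth set0 s i].
    by apply: aeS (hF (Ordinal si) b j) => x h /h ->; rewrite monomial_sum0.
  apply: aeS2 (h 0) (aeS2 (fun _ a b => conj a b) (h 1) (h 2)) => x h0 [h1 h2] sx.
  move: (h0 sx) (h1 sx) (h2 sx); rewrite /dot /= !mul1r !mul0r !addr0 !add0r.
  by move=> e0 e1 e2; rewrite [F b x]surjective_pairing [(F b x).1]surjective_pairing e0 e1 e2.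
have : {ae leb3, forall x, forall T, T \in s -> T x -> F b x = 0}.
  elim: s hT => [_|T s' IH hT]; first exact: aeW.
  apply: aeS2 (hT T (mem_head _ _)) (IH _) => [x h1 h2 T'|T' sT']; last first.
    by apply: hT; rewrite inE sT' orbT.
  by rewrite inE => /orP[/eqP -> /h1|/h2].
by apply: aeS => x h /Os[T sT Tx]; exact: h sT Tx.
Qed.

End Dimension.

(** * The mixed problem *)

(** Orthogonality to a fixed [t] survives limits by Cauchy-Schwarz; [ip t t + 1] replaces a norm
    that may be zero. *)
Lemma complete_annihilator {R : realType} {T : lmodType R} (ip : T -> T -> R)
    (A : set T) : semi_inner ip -> complete_on ip setT ->
  complete_on ip [set x | forall t, A t -> ip x t = 0].
Proof.
move=> ipS ipc u Wu cu; have [//|x _ hx] := ipc u _ cu; exists x => // t At.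
apply/eqP; rewrite -sqrf_eq0 eq_le sqr_ge0 andbT; apply/ler_addgt0Pl => e e0.
rewrite addr0; have t1 : 0 < ip t t + 1 by have := ip_ge0 ipS t; lra.
have [N /(_ N (leqnn N)) hN] := hx _ (divr_gt0 e0 t1).
have -> : ip x t = - ip (u N - x) t by rewrite (ipBl ipS) Wu//; ring.
rewrite sqrrN; apply: le_trans (ip_CS ipS _ _) _.
rewrite -[leRHS](divfK (lt0r_neq0 t1)).
apply: ler_pM => //; [exact: (ip_ge0 ipS)|exact: (ip_ge0 ipS)|lra].
Qed.

Lemma le_of_sqr_le {R : realFieldType} (a b N : R) :
  0 < a -> 0 <= b -> 0 <= N -> a * N ^+ 2 <= b * N -> N <= b / a.
Proof.
move=> a0 b0; rewrite le_eqVlt => /orP[/eqP <- _|N0]; first by rewrite divr_ge0// ltW.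
by rewrite ler_pdivlMr// expr2 mulrA ler_pM2r// mulrC.
Qed.

(** Here [x] is the exact solution, [y] the Galerkin one and [z] a competitor; the hypothesis is
    Galerkin orthogonality. It gives [B (y - z) (y - z) = B (x - z) (y - z)], which bounds [y - z],
    and the triangle inequality adds the 1. *)
Lemma cea {R : realType} {T : lmodType R} (ip B : T -> T -> R) (M alpha : R) (x y z : T) :
  semi_inner ip -> elliptic ip B M alpha -> B (x - y) (y - z) = 0 ->
  ipn (ip := ip) (x - y) <= (1 + Num.sqrt M / alpha) * ipn (ip := ip) (x - z).
Proof.
move=> ipS [Bl _ M0 hM a0 Bc] ort.
have dE : x - z = 1 *: (x - y) + (y - z) by rewrite scale1r addrA subrK.
have d : ipn (ip := ip) (y - z) <= Num.sqrt M * ipn (ip := ip) (x - z) / alpha.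
  apply: (le_of_sqr_le a0 (mulr_ge0 (sqrtr_ge0 M) (ipn_ge0 _)) (ipn_ge0 _)).
  rewrite (ipn_sqr ipS); apply: le_trans (Bc _) _.
  have <- : B (x - z) (y - z) = B (y - z) (y - z) by rewrite {1}dE Bl ort mulr0 add0r.
  apply: le_trans (ler_norm _) _.
  rewrite -(@ler_pXn2r _ 2) ?nnegrE ?mulr_ge0 ?sqrtr_ge0//.
  by rewrite real_normK ?num_real// !exprMn sqr_sqrtr// !(ipn_sqr ipS) hM.
have -> : x - y = (x - z) + (-1) *: (y - z) by rewrite scaleN1r opprB addrA subrK.
apply: le_trans (ipnD ipS _ _) _.
have -> : ipn (ip := ip) (-1 *: (y - z)) = ipn (ip := ip) (y - z).
  by rewrite /ipn !(ipZl ipS) !(ipZr ipS) !mulN1r opprK.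
by rewrite mulrDl mul1r lerD2l mulrAC.
Qed.

(** * The mixed form and its coercive shift *)

Section MixedForm.
Context {R : realType} {H : lmodType R} {q : H -> H -> R}.
Hypothesis qS : semi_inner q.
Variables (K : H -> H) (nu sigma : R).
Hypotheses (nu0 : 0 < nu) (sigma0 : 0 < sigma).
Hypothesis Klin : forall (a : R) x y, K (a *: x + y) = a *: K x + K y.
Hypothesis Kle : forall x, nu^-1 * q (K x) (K x) <= 3 / 2 * sigma * q x x.

Notation s := (Num.sqrt nu).
Notation V := (H * H * H)%type.
Implicit Types x y z : V.

(* A triple (u, w, g) stands for a velocity, a vorticity and its curl. *)
Definition mixed_ip x y : R := q x.1.1 y.1.1 + q x.1.2 y.1.2 + nu * q x.2 y.2.

(** The vorticity equation is subtracted: on the diagonal its curl term then cancels that of the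
    momentum equation, and the square of the vorticity enters with a plus sign. *)
Definition mixed_form x y : R :=
  (sigma * q x.1.1 y.1.1 + s * q x.2 y.1.1 + s^-1 * q (K x.1.2) y.1.1)
  - (s * q y.2 x.1.1 - q x.1.2 y.1.2).

(* Testing the momentum equation with a multiple of the curl of the vorticity
   controls that curl. *)
Definition shift_test (a : R) x : V := (x.1.1 + (a * s) *: x.2, x.1.2, x.2).

Definition stable_form x y : R := mixed_form x (shift_test (16 * sigma)^-1 y).

Definition mixed_alpha : R := Num.min (Num.min (sigma / 4) 8^-1) (32 * sigma)^-1.

Lemma mixed_ip_semi : semi_inner mixed_ip.
Proof.
split=> [a x y z|x y|x].
- rewrite /mixed_ip -!/(_.1 _) !(ipPl qS); ring.
- by rewrite /mixed_ip !(ipC qS x.1.1) !(ipC qS x.1.2) (ipC qS x.2).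
- by rewrite /mixed_ip !addr_ge0// ?mulr_ge0// ?(ip_ge0 qS)// ltW.
Qed.

Lemma mixed_ip_eq0 x : mixed_ip x x = 0 -> q x.1.1 x.1.1 = 0 /\ q x.1.2 x.1.2 = 0.
Proof.
have := ip_ge0 qS x.1.1; have := ip_ge0 qS x.1.2.
have := mulr_ge0 (ltW nu0) (ip_ge0 qS x.2).
rewrite /mixed_ip => h1 h2 h3 h4; split; lra.
Qed.

Lemma mixed_ip_complete : complete_on q setT -> complete_on mixed_ip setT.
Proof.
move=> qc u _ cu.
have q0 (h : H) : 0 <= q h h by exact: (ip_ge0 qS).
have part (c : R) (pr : V -> H) : 0 < c -> (forall x y, pr (x - y) = pr x - pr y) ->
    (forall x, c * q (pr x) (pr x) <= mixed_ip x x) ->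
    exists2 l, [set: H] l & forall e : R, 0 < e -> exists N : nat, forall n, (N <= n)%N ->
      q (pr (u n) - l) (pr (u n) - l) <= e.
  move=> c0 prB prle; apply: (qc (fun n => pr (u n))) => // e e0.
  have [N hN] := cu (c * e) (mulr_gt0 c0 e0); exists N => m n Nm Nn.
  by rewrite -(ler_pM2l c0) -prB (le_trans (prle _))// hN.
have [||l1 _ h1] := part 1 (fun x => x.1.1) ltr01 => //.
  move=> x; rewrite mul1r /mixed_ip -addrA lerDl addr_ge0// mulr_ge0// ltW//.
have [||l2 _ h2] := part 1 (fun x => x.1.2) ltr01 => //.
  by move=> x; rewrite mul1r /mixed_ip addrAC lerDr addr_ge0// mulr_ge0// ltW.
have [||l3 _ h3] := part nu (fun x => x.2) nu0 => //.
  by move=> x; rewrite /mixed_ip lerDr addr_ge0.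
exists (l1, l2, l3) => // e e0; have e3 : 0 < e / 3 by lra.
have [N1 k1] := h1 _ e3; have [N2 k2] := h2 _ e3.
have [N3 k3] := h3 (e / 3 / nu) (divr_gt0 e3 nu0).
exists (maxn N1 (maxn N2 N3)) => n; rewrite !geq_max => /and3P[n1 n2 n3].
have := k3 n n3; rewrite ler_pdivlMr// mulrC => {}k3.
move: (k1 n n1) (k2 n n2) k3; rewrite /mixed_ip /=; lra.
Qed.

Let s0 : 0 < s. Proof. by rewrite sqrtr_gt0. Qed.
Let ss : s * s = nu. Proof. by rewrite -expr2 sqr_sqrtr// ltW. Qed.

Lemma mixed_formPl (a : R) x y z :
  mixed_form (a *: x + y) z = a * mixed_form x z + mixed_form y z.
Proof.
rewrite /mixed_form /= Klin !(ipPl qS) (ipPr qS); ring.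
Qed.

Lemma mixed_formPr (a : R) x y z :
  mixed_form z (a *: x + y) = a * mixed_form z x + mixed_form z y.
Proof. rewrite /mixed_form /= (ipPl qS) !(ipPr qS); ring. Qed.

Lemma shift_testP (b a : R) x y :
  shift_test b (a *: x + y) = a *: shift_test b x + shift_test b y.
Proof.
rewrite /shift_test; congr (_, _, _) => /=.
by rewrite !scalerDr !scalerA (mulrC (b * s)) addrACA.
Qed.

Lemma stable_formPl (a : R) x y z :
  stable_form (a *: x + y) z = a * stable_form x z + stable_form y z.
Proof. exact: mixed_formPl. Qed.

Lemma stable_formPr (a : R) x y z :
  stable_form z (a *: x + y) = a * stable_form z x + stable_form z y.
Proof. by rewrite /stable_form shift_testP mixed_formPr. Qed.

Lemma shift_testK b : cancel (shift_test b) (shift_test (- b)).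
Proof.
by move=> [[u w] g]; rewrite /shift_test /= mulNr scaleNr addrK.
Qed.

Lemma shift_test_le b x :
  mixed_ip (shift_test b x) (shift_test b x) <= (3 + 2 * b ^+ 2) * mixed_ip x x.
Proof.
case: x => [[u w] g]; rewrite /mixed_ip /shift_test /=.
have q0 (h : H) : 0 <= q h h by exact: (ip_ge0 qS).
(* The square of the difference bounds the cross term in the square of the sum, whence [|u + b s
   g|^2 <= 2 |u|^2 + 2 b^2 nu |g|^2]. *)
have := q0 (u + (- (b * s)) *: g); rewrite !(ipE qS) (ipC qS g u).
have -> : b * s * (b * s * q g g) = b ^+ 2 * (nu * q g g) by rewrite -[in RHS]ss; ring.
have -> : - (b * s) * (- (b * s) * q g g) = b ^+ 2 * (nu * q g g) by rewrite -[in RHS]ss; ring.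
have b0 := sqr_ge0 b; have g0 : 0 <= nu * q g g by rewrite mulr_ge0// ltW.
have := mulr_ge0 b0 (q0 u); have := mulr_ge0 b0 (q0 w); have := mulr_ge0 b0 g0.
by have := q0 u; have := q0 w; lra.
Qed.

Definition bounded_form (b : V -> V -> R) : Prop :=
  exists2 M : R, 0 <= M & forall x y, b x y ^+ 2 <= M * mixed_ip x x * mixed_ip y y.

Lemma bounded_formD b b' : bounded_form b -> bounded_form b' ->
  bounded_form (fun x y => b x y + b' x y).
Proof.
move=> [M M0 hM] [N N0 hN]; exists (2 * M + 2 * N); first lra.
move=> x y; have := hM x y; have := hN x y; have := sqr_ge0 (b x y - b' x y).
by rewrite !expr2; lra.
Qed.

Lemma bounded_formZ (a : R) b : bounded_form b -> bounded_form (fun x y => a * b x y).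
Proof.
move=> [M M0 hM]; exists (a ^+ 2 * M); first by rewrite mulr_ge0// sqr_ge0.
by move=> x y; have := ler_wpM2l (sqr_ge0 a) (hM x y); rewrite exprMn !mulrA.
Qed.

Lemma bounded_form_ip (l r : V -> H) (cl cr : R) : 0 <= cl -> 0 <= cr ->
  (forall x, q (l x) (l x) <= cl * mixed_ip x x) ->
  (forall x, q (r x) (r x) <= cr * mixed_ip x x) ->
  bounded_form (fun x y => q (l x) (r y)).
Proof.
move=> cl0 cr0 hl hr; exists (cl * cr); first exact: mulr_ge0.
move=> x y; apply: le_trans (ip_CS qS _ _) _.
have -> : cl * cr * mixed_ip x x * mixed_ip y y =
  (cl * mixed_ip x x) * (cr * mixed_ip y y) by ring.
by apply: ler_pM; rewrite ?(ip_ge0 qS).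
Qed.

(** Expands into eight products of components of [x] and [y], with [K] applied to the vorticity in
    two of them; each factor is bounded by [mixed_ip]. *)
Lemma stable_form_bounded : bounded_form stable_form.
Proof.
have q0 (h : H) : 0 <= q h h by exact: (ip_ge0 qS).
have m0 x : 0 <= mixed_ip x x by exact: (ip_ge0 mixed_ip_semi).
have nuq (h : H) : 0 <= nu * q h h by rewrite mulr_ge0// ltW.
have nui : 0 <= nu^-1 by rewrite invr_ge0 ltW.
have p1 x : q x.1.1 x.1.1 <= 1 * mixed_ip x x.
  by have := q0 x.1.2; have := nuq x.2; rewrite /mixed_ip; lra.
have p2 x : q x.1.2 x.1.2 <= 1 * mixed_ip x x.
  by have := q0 x.1.1; have := nuq x.2; rewrite /mixed_ip; lra.
have p3 x : q x.2 x.2 <= nu^-1 * mixed_ip x x.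
  rewrite mulrC ler_pdivlMr// mulrC.
  by have := q0 x.1.1; have := q0 x.1.2; rewrite /mixed_ip; lra.
have nk : 0 <= nu * (3 / 2 * sigma) by do ![apply: mulr_ge0 => //; try exact: ltW].
have pK x : q (K x.1.2) (K x.1.2) <= nu * (3 / 2 * sigma) * mixed_ip x x.
  have := Kle x.1.2; rewrite mulrC ler_pdivrMr// => h; apply: le_trans h _.
  have := ler_wpM2l nk (p2 x); lra.
set a := (16 * sigma)^-1 * s.
have e : stable_form = (fun x y => sigma * q x.1.1 y.1.1 + (sigma * a) * q x.1.1 y.2 +
    s * q x.2 y.1.1 + (s * a) * q x.2 y.2 + s^-1 * q (K x.1.2) y.1.1 +
    (s^-1 * a) * q (K x.1.2) y.2 + (- s) * q x.1.1 y.2 + 1 * q x.1.2 y.1.2).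
  apply/funext => x; apply/funext => y; rewrite /stable_form /mixed_form /= -/a.
  by rewrite !(ipDr qS) !(ipZr qS) (ipC qS y.2); ring.
rewrite e; do ![apply: bounded_formD]; apply: bounded_formZ.
- exact: (bounded_form_ip ler01 ler01 p1 p1).
- exact: (bounded_form_ip ler01 nui p1 p3).
- exact: (bounded_form_ip nui ler01 p3 p1).
- exact: (bounded_form_ip nui nui p3 p3).
- exact: (bounded_form_ip nk ler01 pK p1).
- exact: (bounded_form_ip nk nui pK p3).
- exact: (bounded_form_ip ler01 nui p1 p3).
- exact: (bounded_form_ip ler01 ler01 p2 p2).
Qed.

Lemma mixed_alpha_gt0 : 0 < mixed_alpha.
Proof.
rewrite /mixed_alpha !lt_min !invr_gt0 ltr0n /= andbT.
by apply/andP; split; have := sigma0; lra.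
Qed.

(** Write [e = 1 / (16 sigma)] and [G = nu |g|^2]. Eight times [e h1] absorbs the convective term
    [q (K w) u] at the cost of [sigma / 2 |u|^2] and [3 / 4 |w|^2]. The shift creates two cross
    terms: [h2] absorbs the one with [K w] for [3 / 32 |w|^2] and [e G / 4], and [h3] the one with
    [u] for [sigma / 16 |u|^2] and [e G / 4]. There remain [7 sigma / 16], [5 / 32] and [e / 2],
    which dominate the three entries of [mixed_alpha]. *)
Lemma stable_form_coercive x : mixed_alpha * mixed_ip x x <= stable_form x x.
Proof.
case: x => [[u w] g]; pose e := (16 * sigma)^-1.
have es : e * sigma = 16^-1 by rewrite /e invfM mulrAC -mulrA mulfV ?mulr1// gt_eqF.
have e0 : 0 < e by rewrite invr_gt0 mulr_gt0.
have si : s^-1 * s = 1 by rewrite mulVf// gt_eqF.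
have sii : s^-1 * s^-1 = nu^-1 by rewrite -invfM ss.
have q0 (h : H) : 0 <= q h h by exact: (ip_ge0 qS).
pose k := nu^-1 * q (K w) (K w); pose G := nu * q g g.
have GE : G = s * s * q g g by rewrite /G ss.
have hk : k <= 3 / 2 * sigma * q w w by exact: Kle.
have h1 : 0 <= k + 2 * sigma * (s^-1 * q (K w) u) + sigma * sigma * q u u.
  have := q0 (s^-1 *: K w + sigma *: u).
  by rewrite !(ipE qS) (ipC qS u (K w)) /k -sii; lra.
have h2 : 0 <= k + q (K w) g + G / 4.
  have := q0 (s^-1 *: K w + (s / 2) *: g).
  rewrite !(ipE qS) (ipC qS g (K w)) /k -sii GE => h.
  have -> : q (K w) g = s^-1 * s * q (K w) g by rewrite si mul1r.
  by lra.
have h3 : 0 <= sigma * sigma * q u u + sigma * (s * q u g) + G / 4.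
  have := q0 (sigma *: u + (s / 2) *: g).
  by rewrite !(ipE qS) (ipC qS g u) GE; lra.
have a1 : mixed_alpha <= sigma / 4 by rewrite /mixed_alpha !ge_min lexx.
have a2 : mixed_alpha <= 8^-1 by rewrite /mixed_alpha !ge_min lexx orbT.
have a3 : mixed_alpha <= e / 2.
  by rewrite /mixed_alpha !ge_min; apply/orP; right; rewrite /e -invfM; lra.
have b1 := ler_wpM2r (q0 u) a1; have b2 := ler_wpM2r (q0 w) a2.
have G0 : 0 <= G by rewrite /G mulr_ge0// ltW.
have b3 := ler_wpM2r G0 a3.
have E : stable_form (u, w, g) (u, w, g) = sigma * q u u + e * (sigma * (s * q u g)) +
    e * G + s^-1 * q (K w) u + e * q (K w) g + q w w.
  rewrite /stable_form /mixed_form /= -/e !(ipDr qS) !(ipZr qS) GE (ipC qS g u).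
  have -> : e * q (K w) g = s^-1 * s * (e * q (K w) g) by rewrite si mul1r.
  by ring.
rewrite E /mixed_ip /= -/G.
have c1 := mulr_ge0 (ltW e0) h1; have c2 := mulr_ge0 (ltW e0) h2.
have c3 := mulr_ge0 (ltW e0) h3; have ck := ler_wpM2l (ltW e0) hk.
have d1 : e * (sigma * sigma * q u u) = 16^-1 * (sigma * q u u).
  by rewrite -es; ring.
have d2 : e * (2 * sigma * (s^-1 * q (K w) u)) = 8^-1 * (s^-1 * q (K w) u).
  by rewrite (_ : 8^-1 = 2 * 16^-1 :> R) -?es; [ring|lra].
have d3 : e * (3 / 2 * sigma * q w w) = 3 / 32 * q w w.
  by rewrite (_ : 3 / 32 = 3 / 2 * 16^-1 :> R) -?es; [ring|lra].
rewrite !mulrDr in c1 c2 c3.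
rewrite d1 d2 in c1; rewrite d1 in c3; rewrite d3 in ck.
by have := q0 u; have := q0 w; have := mulr_ge0 (ltW sigma0) (q0 u); lra.
Qed.

Lemma stable_form_elliptic :
  exists M, elliptic mixed_ip stable_form M mixed_alpha.
Proof.
have [M M0 hM] := stable_form_bounded; exists M; split => //.
- exact: stable_formPl.
- exact: stable_formPr.
- exact: mixed_alpha_gt0.
- exact: stable_form_coercive.
Qed.

End MixedForm.

(** * The mixed problem on the domain: data, solvability and error bounds *)

Section Assembly.
Context {R : realType}.
Variables (Omega Gam Sig : set (E3 R)) (nu sigma : R) (beta : E3 R -> E3 R).
Hypotheses (oO : open Omega) (bO : bounded_set Omega).
Hypothesis GamSig : boundary_partition Omega Gam Sig.
Hypotheses (nu0 : 0 < nu) (sigma0 : 0 < sigma).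
Hypothesis betaL : Linfv Omega beta.
Hypothesis beta_small : 2 * norm_infv Omega beta ^+ 2 / (nu * sigma) < 1.

Implicit Types (u v w th f : E3 R -> E3 R) (p : set (E3 R -> R))
  (us : (E3 R -> E3 R) -> R) (Xs Zs : set (E3 R -> E3 R)).

Notation H := (L2sp Omega).
Notation V := (H * H * H)%type.
Notation q := (@l2ip R Omega).
Notation qS := (@l2ip_semi R Omega).
Notation s := (Num.sqrt nu).
Notation X := (spaceX Omega Gam).
Notation Z := (spaceZ Omega Gam).

Definition cross_beta (u : H) : H := mkL2 (L2v_cross (L2spP u) betaL).

Lemma cross_beta_lin (a : R) (u v : H) :
  cross_beta (a *: u + v) = a *: cross_beta u + cross_beta v.
Proof.
apply: val_inj; apply/funext => x /=.
have lin (y z b : E3 R) : cross (a *: y + z) b = a *: cross y b + cross z b.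
  have -> : a *: y + z = (a * y.1.1 + z.1.1, a * y.1.2 + z.1.2, a * y.2 + z.2) by [].
  have -> : a *: cross y b + cross z b = (a * (cross y b).1.1 + (cross z b).1.1,
    a * (cross y b).1.2 + (cross z b).1.2, a * (cross y b).2 + (cross z b).2) by [].
  by rewrite /cross /=; congr (_, _, _); ring.
exact: (lin (u x) (v x) (beta x)).
Qed.

(** The smallness assumption bounds [norm_infv ^+ 2] by [nu * sigma / 2], and the factor 3 of
    [l2dot_cross_le] turns this into [3 / 2]. *)
Lemma cross_beta_le (u : H) :
  nu^-1 * q (cross_beta u) (cross_beta u) <= 3 / 2 * sigma * q u u.
Proof.
have h := l2dot_cross_le (L2spP u) betaL; rewrite mulrC ler_pdivrMr//.
apply: le_trans h _; rewrite -[q u u]/(l2dot Omega u u) [leRHS]mulrAC.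
apply: ler_wpM2r; first exact: l2dot_ge0.
move: beta_small; rewrite ltr_pdivrMr ?mulr_gt0//; lra.
Qed.

Local Notation K := cross_beta.
Local Notation ip := (@mixed_ip _ _ q nu).
Local Notation B := (@stable_form _ _ q K nu sigma).
Local Notation B0 := (@mixed_form _ _ q K nu sigma).
Local Notation S := (@shift_test _ H nu (16 * sigma)^-1).
Local Notation alpha := (mixed_alpha sigma).
Local Notation ipS := (mixed_ip_semi qS nu0).

Lemma stable_formBl (x y z : V) : B (x - y) z = B x z - B y z.
Proof.
by rewrite [x - y]addrC -scaleN1r (stable_formPl qS nu sigma cross_beta_lin) mulN1r addrC.
Qed.

Definition mixed_space Xs Zs : set V :=
  [set x : V | [/\ Xs x.1.1, Zs x.1.2 & is_wcurl Omega x.1.2 x.2]].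

(** What the continuous and the discrete problem have in common. The last field keeps shifted test
    functions in the space. *)
Record space_pair Xs Zs : Prop := SpacePair {
  space_pair_subX : Xs `<=` X;
  space_pair_subZ : Zs `<=` Z;
  space_pair_X : subspace_set Xs;
  space_pair_Z : subspace_set Zs;
  space_pair_curl : forall th w, Zs th -> is_wcurl Omega th w -> Xs w }.

Lemma spaceX_subspace : subspace_set X.
Proof.
have gL phi (U : set (E3 R)) : testfun U phi -> L2v Omega (grad phi).
  by move=> t; exact: testfun_L2v (testfun_grad t).
split=> [|a u v /(spaceXP oO bO)[u2 uO uG] /(spaceXP oO bO)[v2 vO vG]].
  by apply/(spaceXP oO bO); split => [|phi _|phi _]; rewrite ?l2dot0l//; exact: L2v0.
apply/(spaceXP oO bO); split; first exact: L2v_lin.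
  by move=> phi t; rewrite l2dotPl ?uO ?vO ?mulr0 ?addr0//; exact: gL t.
by move=> phi t; rewrite l2dotPl ?uG ?vG ?mulr0 ?addr0//; exact: gL t.
Qed.

Lemma spaceZ_curl_lin (a : R) th th' w w' : Z th -> is_wcurl Omega th w ->
  Z th' -> is_wcurl Omega th' w' ->
  Z (a *: th + th') /\ is_wcurl Omega (a *: th + th') (a *: w + w').
Proof.
move=> Zt cw Zt' cw'.
have [t2 w2 hO hG] := (spaceZP oO bO Gam th w).1 (conj Zt cw).
have [t2' w2' hO' hG'] := (spaceZP oO bO Gam th' w').1 (conj Zt' cw').
apply/(spaceZP oO bO); split; [exact: L2v_lin|exact: L2v_lin| |].
  move=> psi t; have p2 := testfun_L2v oO t; have c2 := curl_L2v oO t.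
  by rewrite (l2dotPl _ t2 t2' c2) (l2dotPl _ w2 w2' p2) hO// hO'.
move=> psi t; have p2 := testfun_L2v oO t; have c2 := curl_L2v oO t.
by rewrite (l2dotPl _ t2 t2' c2) (l2dotPl _ w2 w2' p2) hG// hG'.
Qed.

Lemma spaceZ_L2v th : Z th -> L2v Omega th.
Proof. by move=> [[]]. Qed.

Lemma spaceX_L2v v : X v -> L2v Omega v.
Proof. by move=> [[[]]]. Qed.

Lemma spaceZ_wcurl th : Z th -> is_wcurl Omega th (wcurl Omega th).
Proof. by move=> [/wcurlP]. Qed.

Lemma spaceZ0 : Z 0 /\ is_wcurl Omega 0 0.
Proof.
by apply/(spaceZP oO bO); split => [||psi _|psi _]; rewrite ?l2dot0l//; exact: L2v0.
Qed.

Lemma spaceZ_subspace : subspace_set Z.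
Proof.
split=> [|a th w Zt Zw]; first by have [] := spaceZ0.
by have [] := spaceZ_curl_lin a Zt (spaceZ_wcurl Zt) Zw (spaceZ_wcurl Zw).
Qed.

Lemma continuous_pair : space_pair X Z.
Proof.
split => //; [exact: spaceX_subspace|exact: spaceZ_subspace|].
by move=> th w Zt; exact: curl_spaceX.
Qed.

Lemma mixed_space_subspace Xs Zs : space_pair Xs Zs -> subspace_set (mixed_space Xs Zs).
Proof.
move=> P; have [X0 XP] := space_pair_X P; have [Z0 ZP] := space_pair_Z P.
have [_ c0] := spaceZ0; split; first by split.
move=> a [[xu xw] xg] [[yu yw] yg] [/= Xx Zx cx] [/= Xy Zy cy].
have -> : a *: (xu, xw, xg) + (yu, yw, yg) = (a *: xu + yu, a *: xw + yw, a *: xg + yg) :> V by [].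
change ([/\ Xs (l2val (a *: xu + yu)), Zs (l2val (a *: xw + yw)) &
  is_wcurl Omega (l2val (a *: xw + yw)) (l2val (a *: xg + yg))]).
rewrite !l2val_lin; split; [exact: XP Xx Xy|exact: ZP Zx Zy|].
by have [_] := spaceZ_curl_lin a (space_pair_subZ P Zx) cx (space_pair_subZ P Zy) cy.
Qed.

Lemma mixed_space_complete : complete_on ip (mixed_space X Z).
Proof.
pose gr : set V := [set t | exists phi (d : H),
  [/\ testfun Omega phi \/ testfun (away Omega Gam) phi, l2val d = grad phi & t = (d, 0, 0)]].
(* The factor [- nu^-1] undoes the weight in [mixed_ip], so that orthogonality to such a triple
   reads [q w (curl psi) = q g psi]. *)
pose cu : set V := [set t | exists psi (c d : H),
  [/\ compwise (testfun Omega) psi \/ compwise (testfun (away Omega Gam)) psi,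
      l2val c = curl psi, l2val d = psi & t = (0, c, - nu^-1 *: d)]].
have ip_gr (x : V) d : ip x (d, 0, 0) = q x.1.1 d.
  by rewrite /mixed_ip /= !(ipC qS _ 0) !(ip0l qS); ring.
have ip_cu (x : V) c d : ip x (0, c, - nu^-1 *: d) = q x.1.2 c - q x.2 d.
  rewrite /mixed_ip /= (ipC qS _ 0) (ip0l qS) (ipZr qS) mulrA mulrN mulfV ?gt_eqF//; ring.
have -> : mixed_space X Z = [set x | forall t, (gr `|` cu) t -> ip x t = 0].
  apply/seteqP; split => x.
    move=> [/(spaceXP oO bO)[_ uO uG] Zw cw] t [].
      move=> [phi [d [tp dE ->]]]; rewrite ip_gr /l2ip dE.
      by case: tp => tp; [exact: uO|exact: uG].
    move=> [psi [c [d [tp cE dE ->]]]]; rewrite ip_cu /l2ip cE dE.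
    have [_ _ wO wG] := (spaceZP oO bO Gam x.1.2 x.2).1 (conj Zw cw).
    by apply/eqP; rewrite subr_eq0; apply/eqP; case: tp => tp; [exact: wO|exact: wG].
  move=> hx.
  have hg phi : testfun Omega phi \/ testfun (away Omega Gam) phi ->
      l2dot Omega x.1.1 (grad phi) = 0.
    move=> tp; have d2 : L2v Omega (grad phi).
      by case: tp => tp; exact: testfun_L2v (testfun_grad tp).
    have := hx (mkL2 d2, 0, 0); rewrite ip_gr; apply.
    by left; exists phi, (mkL2 d2).
  have hc psi : compwise (testfun Omega) psi \/ compwise (testfun (away Omega Gam)) psi ->
      l2dot Omega x.1.2 (curl psi) = l2dot Omega x.2 psi.
    move=> tp; have d2 : L2v Omega psi by case: tp => tp; exact: testfun_L2v tp.
    have c2 : L2v Omega (curl psi) by case: tp => tp; exact: curl_L2v tp.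
    apply/eqP; rewrite -subr_eq0; apply/eqP.
    have := hx (0, mkL2 c2, - nu^-1 *: mkL2 d2); rewrite ip_cu; apply.
    by right; exists psi, (mkL2 c2), (mkL2 d2).
  have [] : Z x.1.2 /\ is_wcurl Omega x.1.2 x.2; last split => //.
    apply/(spaceZP oO bO); split; [exact: L2spP|exact: L2spP| |].
      by move=> psi t; apply: hc; left.
    by move=> psi t; apply: hc; right.
  apply/(spaceXP oO bO); split; [exact: L2spP| |].
    by move=> phi t; apply: hg; left.
  by move=> phi t; apply: hg; right.
apply: complete_annihilator; first exact: ipS.
apply: (mixed_ip_complete qS nu0); apply: l2ip_complete; exact: open_measurable3.
Qed.

Lemma mixed_wcurl Xs Zs (x : V) : space_pair Xs Zs -> mixed_space Xs Zs x ->
  wcurl Omega x.1.2 = x.2 %[ae leb3 in Omega].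
Proof.
move=> P [_ Zx cx].
exact: is_wcurl_unique (spaceZ_wcurl (space_pair_subZ P Zx)) cx.
Qed.

Lemma wcurl_L2v th : Z th -> L2v Omega (wcurl Omega th).
Proof. by move=> /spaceZ_wcurl[]. Qed.

Lemma is_wcurl_ae0 th : L2v Omega th -> th = cst 0 %[ae leb3 in Omega] ->
  is_wcurl Omega th (cst 0).
Proof.
move=> t2 t0; have z2 := L2v0 Omega; split => // psi tp; have c2 := curl_L2v oO tp.
rewrite -[LHS]/(l2dot Omega th (curl psi)) (l2dot_ae t2 z2 c2 t0) l2dot0l.
exact: esym (l2dot0l Omega psi).
Qed.

Lemma normHcurl_ae0 th : Z th -> th = cst 0 %[ae leb3 in Omega] ->
  normHcurl Omega th = 0.
Proof.
move=> Zt t0; have t2 := spaceZ_L2v Zt; have z2 := L2v0 Omega.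
have c0 : wcurl Omega th = cst 0 %[ae leb3 in Omega].
  exact: (is_wcurl_unique oO bO (spaceZ_wcurl Zt) (is_wcurl_ae0 t2 t0)).
rewrite /normHcurl (norm2v_ae t2 z2 t0) (norm2v_ae (wcurl_L2v Zt) z2 c0).
by rewrite norm2v_cst0 expr0n addr0 sqrtr0.
Qed.

Lemma normHcurl_gt0 th : Z th -> ~ (th = cst 0 %[ae leb3 in Omega]) ->
  0 < normHcurl Omega th.
Proof.
move=> Zt nt; have t2 := spaceZ_L2v Zt.
rewrite sqrtr_gt0 ltr_wpDr ?sqr_ge0// norm2v_sqr// lt_def l2dot_ge0 andbT.
by apply/eqP => /(l2dot_eq0 t2).
Qed.

Lemma norm_datum_ge0 us : tangential_datum Omega Gam Sig us ->
  0 <= norm_datum Omega Gam us.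
Proof.
move=> [_ [C hC] _]; rewrite /norm_datum; set A := [set _ | _ in _].
have [->|/set0P[y Ay]] := eqVneq A set0; first by rewrite sup0.
have y0 : 0 <= y by case: Ay => th _ <-; rewrite divr_ge0// sqrtr_ge0.
apply: le_trans y0 _; apply: ub_le_sup => //; exists C => _ [th [Zt nt] <-].
by rewrite ler_pdivrMr ?normHcurl_gt0// hC.
Qed.

(** The supremum leaves out the fields that vanish almost everywhere; their H(curl) norm is 0, so
    the continuity of the datum forces its value there to be 0. *)
Lemma datum_le us th : tangential_datum Omega Gam Sig us -> Z th ->
  `|us th| <= norm_datum Omega Gam us * normHcurl Omega th.
Proof.
move=> [_ [C hC] _] Zt; have [t0|nt] := pselect (th = cst 0 %[ae leb3 in Omega]).
  by have := hC _ Zt; rewrite normHcurl_ae0// !mulr0.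
rewrite -ler_pdivrMr ?normHcurl_gt0//; apply: ub_le_sup; last by exists th.
exists C => _ [th' [Zt' nt'] <-].
by rewrite ler_pdivrMr ?normHcurl_gt0// hC.
Qed.

Lemma norm2v_l2sp (u : H) : norm2v Omega u ^+ 2 = q u u.
Proof. by rewrite norm2v_sqr//; exact: L2spP. Qed.

Lemma q_ge0 (u : H) : 0 <= q u u. Proof. exact: l2dot_ge0. Qed.

Definition load f p us (x : V) : R := form_F Omega f p x.1.1 - form_G nu us x.1.2.

Lemma load_lin f p us : admissible Omega Gam Sig f p us ->
  linear_on (mixed_space X Z) (load f p us).
Proof.
move=> [f2 Hp [usl _ _]] a [[xu xw] xg] [[yu yw] yg] [/= Xx Zx _] [/= Xy Zy _].
have e : l2dot Omega f (a *: l2val xu + l2val yu) =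
    a * l2dot Omega f xu + l2dot Omega f yu.
  by rewrite !(l2dotC _ f) l2dotPl//; exact: L2spP.
have Xxy : X (a *: l2val xu + l2val yu) by apply: (spaceX_subspace).2.
have e2 := normal_pairing_lin oO bO GamSig Xx Xy Xxy Hp.
have e3 : us (a *: l2val xw + l2val yw) = a * us xw + us yw by exact: usl.
have lin (b A A1 A2 P P1 P2 U U1 U2 : R) : A = b * A1 + A2 -> P = b * P1 + P2 ->
    U = b * U1 + U2 ->
    A - P - - (s * U) = b * (A1 - P1 - - (s * U1)) + (A2 - P2 - - (s * U2)).
  by move=> -> -> ->; ring.
exact: (lin _ _ _ _ _ _ _ _ _ _ e e2 e3).
Qed.

Definition data_norm f p us : R :=
  norm2v Omega f + norm12 Omega p + norm_datum Omega Gam us.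

Lemma data_norm_ge0 f p us : admissible Omega Gam Sig f p us -> 0 <= data_norm f p us.
Proof.
by move=> [_ _ hus]; rewrite /data_norm !addr_ge0// ?norm2v_ge0 ?norm12_ge0 ?norm_datum_ge0.
Qed.

(** The 1 serves [F]. In the other term, [s] is the factor in [G], and [Num.sqrt (1 + nu^-1)] bounds
    the unweighted H(curl) norm, dual to that of the datum, by the norm with weight [nu]. *)
Definition load_cst : R := 1 + s * Num.sqrt (1 + nu^-1).

Lemma load_le f p us (x : V) : admissible Omega Gam Sig f p us -> mixed_space X Z x ->
  `|load f p us x| <= load_cst * data_norm f p us * ipn (ip := ip) x.
Proof.
move=> [f2 Hp hus] Wx; have [Xx Zx cx] := Wx.
have N0 : 0 <= ipn (ip := ip) x by exact: ipn_ge0.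
have hu : norm2v Omega x.1.1 <= ipn (ip := ip) x.
  rewrite -(@ler_pXn2r _ 2) ?nnegrE ?norm2v_ge0// ipn_sqr; last exact: ipS.
  rewrite norm2v_l2sp /mixed_ip -addrA lerDl addr_ge0 ?q_ge0// mulr_ge0 ?q_ge0//.
  exact: ltW.
have nui : 0 < nu^-1 by rewrite invr_gt0.
have hw : normHcurl Omega x.1.2 <= Num.sqrt (1 + nu^-1) * ipn (ip := ip) x.
  rewrite /normHcurl (norm2v_ae (wcurl_L2v Zx) (L2spP x.2) (mixed_wcurl continuous_pair Wx)).
  rewrite !norm2v_l2sp /ipn -sqrtrM; last by rewrite addr_ge0// ltW.
  apply: ler_wsqrtr; rewrite /mixed_ip.
  have := mulr_ge0 (ltW nui) (q_ge0 x.1.1); have := mulr_ge0 (ltW nui) (q_ge0 x.1.2).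
  have := mulr_ge0 (ltW nu0) (q_ge0 x.2); have := q_ge0 x.1.1.
  have -> : (1 + nu^-1) * (q x.1.1 x.1.1 + q x.1.2 x.1.2 + nu * q x.2 x.2) =
    (q x.1.1 x.1.1 + q x.1.2 x.1.2 + nu * q x.2 x.2) +
    (nu^-1 * q x.1.1 x.1.1 + nu^-1 * q x.1.2 x.1.2 + nu^-1 * nu * q x.2 x.2) by ring.
  rewrite mulVf ?gt_eqF// mul1r; lra.
have b1 := l2dot_CSn f2 (L2spP x.1.1).
have b2 := normal_pairing_le oO bO GamSig Xx Hp.
have b3 := datum_le hus Zx.
have n1 := norm2v_ge0 Omega f; have n2 := norm12_ge0 Omega p; have n3 := norm_datum_ge0 hus.
have b1' := le_trans b1 (ler_wpM2l n1 hu).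
have b2' := le_trans b2 (ler_wpM2r n2 hu).
have s0 : 0 <= s by exact: sqrtr_ge0.
have b3' : `|s * us x.1.2| <=
    s * (norm_datum Omega Gam us * (Num.sqrt (1 + nu^-1) * ipn (ip := ip) x)).
  rewrite normrM ger0_norm//; apply: ler_wpM2l => //; apply: le_trans b3 _.
  exact: ler_wpM2l.
rewrite /load /form_F /form_G opprK.
apply: le_trans (ler_normD _ _) _; apply: le_trans (lerD (ler_normB _ _) b3') _.
apply: le_trans (lerD (lerD b1' b2') (lexx _)) _.
rewrite /load_cst /data_norm; set N := ipn _; set c := Num.sqrt (1 + _).
have c0 : 0 <= c by exact: sqrtr_ge0.
have := mulr_ge0 (mulr_ge0 s0 c0) (mulr_ge0 n1 N0).
have := mulr_ge0 (mulr_ge0 s0 c0) (mulr_ge0 n2 N0).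
have := mulr_ge0 n3 N0; rewrite -/N; lra.
Qed.

Lemma mixed_space_sub Xs Zs : space_pair Xs Zs -> mixed_space Xs Zs `<=` mixed_space X Z.
Proof.
move=> P x [Xx Zx cx].
by split => //; [exact: (space_pair_subX P) Xx|exact: (space_pair_subZ P) Zx].
Qed.

Lemma momentum_formE Xs Zs (x : V) (v : H) : space_pair Xs Zs -> mixed_space Xs Zs x ->
  sigma * q x.1.1 v + s * q x.2 v + s^-1 * q (K x.1.2) v =
  form_a Omega sigma x.1.1 v + form_b1 Omega nu v x.1.2 + form_c Omega nu beta x.1.2 v.
Proof.
move=> P Wx; have [_ Zx _] := Wx.
rewrite -[q x.2 v]/(l2dot Omega x.2 v).
by rewrite -(l2dot_ae (wcurl_L2v (space_pair_subZ P Zx)) (L2spP x.2) (L2spP v) (mixed_wcurl P Wx)).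
Qed.

Lemma vorticity_formE Xs Zs (y : V) (u w : H) : space_pair Xs Zs -> mixed_space Xs Zs y ->
  s * q y.2 u - q w y.1.2 = form_b1 Omega nu u y.1.2 - form_d Omega w y.1.2.
Proof.
move=> P Wy; have [_ Zy _] := Wy.
rewrite /form_b1 -[integ _ _ in X in _ = X - _]/(l2dot Omega (wcurl Omega y.1.2) u).
by rewrite (l2dot_ae (wcurl_L2v (space_pair_subZ P Zy)) (L2spP y.2) (L2spP u) (mixed_wcurl P Wy)).
Qed.

Lemma form_F0 f p us : admissible Omega Gam Sig f p us -> form_F Omega f p 0 = 0.
Proof.
move=> [f2 Hp _]; have [X0 _] := spaceX_subspace.
have := normal_pairing_le oO bO GamSig X0 Hp.
rewrite norm2v_cst0 mul0r normr_le0 => /eqP h.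
by rewrite /form_F h -[integ _ _]/(l2dot Omega f 0) l2dotC l2dot0l subrr.
Qed.

Lemma form_G0 us : tangential_datum Omega Gam Sig us -> form_G nu us 0 = 0.
Proof.
move=> [h _ _]; have [Z0 _] := spaceZ0; have := h (-1) 0 0 Z0 Z0.
rewrite (_ : (fun x => _) = 0); last by apply/funext => x; rewrite scaler0 addr0.
by rewrite mulN1r addNr /form_G => ->; rewrite mulr0 oppr0.
Qed.

(** The single equation splits again when tested with [(v, 0, 0)] and with [(0, th, curl th)], since
    [F] and [G] vanish at 0. *)
Lemma solutionP Xs Zs f p us (x : V) : space_pair Xs Zs ->
  admissible Omega Gam Sig f p us -> mixed_space Xs Zs x ->
  solution Omega nu sigma beta Xs Zs f p us x.1.1 x.1.2 <->
  forall y, mixed_space Xs Zs y -> B0 x y = load f p us y.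
Proof.
move=> P adm Wx; have [Xx Zx cx] := Wx; have [_ _ hus] := adm.
have qr0 (u : H) : q u 0 = 0 by rewrite (ipC qS) (ip0l qS).
have [Xs0 _] := space_pair_X P; have [Zs0 _] := space_pair_Z P; have [_ c0] := spaceZ0.
split=> [[_ _ h1 h2] y Wy|h].
  have [Xy Zy cy] := Wy.
  by rewrite /mixed_form (momentum_formE _ P Wx) (vorticity_formE _ _ P Wy) h1// h2.
split => // [v Xv|th Zth].
  have v2 := spaceX_L2v (space_pair_subX P Xv); pose y : V := (mkL2 v2, 0, 0).
  have Wy : mixed_space Xs Zs y by split.
  have := h y Wy; rewrite /mixed_form [LHS]/= (momentum_formE _ P Wx).
  by rewrite (ip0l qS) qr0 mulr0 subrr subr0 /load (form_G0 hus) subr0.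
have [t2 ct] : L2v Omega th /\ is_wcurl Omega th (wcurl Omega th).
  by have Zt := space_pair_subZ P Zth; split; [exact: spaceZ_L2v|exact: spaceZ_wcurl].
have [c2 _] := ct; pose y : V := (0, mkL2 t2, mkL2 c2).
have Wy : mixed_space Xs Zs y by split.
have := h y Wy; rewrite /mixed_form (vorticity_formE _ _ P Wy) [X in X - _]/= !qr0 !mulr0.
rewrite /load (form_F0 adm) !addr0 !sub0r => /oppr_inj; exact.
Qed.

Lemma solution_lift Xs Zs f p us u w : space_pair Xs Zs ->
  solution Omega nu sigma beta Xs Zs f p us u w ->
  exists x : V, [/\ mixed_space Xs Zs x, l2val x.1.1 = u & l2val x.1.2 = w].
Proof.
move=> P [Xu Zw _ _]; have Zw' := space_pair_subZ P Zw.
have u2 := spaceX_L2v (space_pair_subX P Xu); have w2 := spaceZ_L2v Zw'.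
exists (mkL2 u2, mkL2 w2, mkL2 (wcurl_L2v Zw')); split => //; split => //.
exact: spaceZ_wcurl.
Qed.

Lemma shift_mixed_space Xs Zs b (x : V) : space_pair Xs Zs -> mixed_space Xs Zs x ->
  mixed_space Xs Zs (@shift_test _ H nu b x).
Proof.
move=> P; case: x => [[u w] g] [/= Xx Zx cx].
change ([/\ Xs (l2val (u + (b * s) *: g)), Zs (l2val w) & is_wcurl Omega (l2val w) (l2val g)]).
split => //; rewrite addrC l2val_lin; apply: (space_pair_X P).2 => //.
exact: space_pair_curl P _ _ Zx cx.
Qed.

(** The shift is a bijection of the mixed space, its inverse being the opposite shift; replacing the
    test function loses nothing. *)
Lemma stable_formP Xs Zs f p us (x : V) : space_pair Xs Zs ->
  (forall y, mixed_space Xs Zs y -> B0 x y = load f p us y) <->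
  (forall y, mixed_space Xs Zs y -> B x y = load f p us (S y)).
Proof.
move=> P; split=> h y Wy; first by apply: h; exact: shift_mixed_space.
have e : S (shift_test nu (- (16 * sigma)^-1) y) = y.
  by rewrite -{1}[(16 * sigma)^-1]opprK shift_testK.
rewrite -{1 2}e; apply: h; exact: shift_mixed_space.
Qed.

Lemma solution_stable Xs Zs f p us u w : space_pair Xs Zs ->
  admissible Omega Gam Sig f p us -> solution Omega nu sigma beta Xs Zs f p us u w ->
  exists x : V, [/\ mixed_space Xs Zs x, l2val x.1.1 = u, l2val x.1.2 = w &
    forall y, mixed_space Xs Zs y -> B x y = load f p us (S y)].
Proof.
move=> P adm sol; have [x [Wx uE wE]] := solution_lift P sol.
have solx : solution Omega nu sigma beta Xs Zs f p us x.1.1 x.1.2 by rewrite uE wE.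
by exists x; split=> //; exact: (stable_formP f p us x P).1 ((solutionP P adm Wx).1 solx).
Qed.

Lemma load_shift_lin Xs Zs f p us : space_pair Xs Zs -> admissible Omega Gam Sig f p us ->
  linear_on (mixed_space Xs Zs) (fun y => load f p us (S y)).
Proof.
move=> P adm a x y Wx Wy; rewrite shift_testP; apply: (load_lin adm);
  by apply: (mixed_space_sub P); exact: shift_mixed_space.
Qed.

Definition shift_cst : R := 3 + 2 * (16 * sigma)^-1 ^+ 2.

Lemma shift_cst_ge0 : 0 <= shift_cst.
Proof. by rewrite addr_ge0// mulr_ge0// sqr_ge0. Qed.

Lemma load_shift_le Xs Zs f p us (y : V) : space_pair Xs Zs ->
  admissible Omega Gam Sig f p us -> mixed_space Xs Zs y ->
  `|load f p us (S y)| <=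
    load_cst * data_norm f p us * Num.sqrt shift_cst * ipn (ip := ip) y.
Proof.
move=> P adm Wy.
have WS : mixed_space X Z (S y) by apply: (mixed_space_sub P); exact: shift_mixed_space.
apply: le_trans (load_le adm WS) _; rewrite -[leRHS]mulrA; apply: ler_wpM2l.
  rewrite mulr_ge0 ?data_norm_ge0// addr_ge0// mulr_ge0// sqrtr_ge0.
rewrite /ipn -sqrtrM ?shift_cst_ge0//; apply: ler_wsqrtr; exact: (shift_test_le qS nu0).
Qed.

Lemma load_shift_bounded Xs Zs f p us : space_pair Xs Zs ->
  admissible Omega Gam Sig f p us ->
  bounded_on ip (mixed_space Xs Zs) (fun y => load f p us (S y)).
Proof.
move=> P adm; set C := load_cst * data_norm f p us * Num.sqrt shift_cst.
exists (C ^+ 2) => y Wy; have := load_shift_le P adm Wy.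
rewrite -/C -[ip y y](ipn_sqr ipS) -exprMn -(real_normK (num_real (load f p us (S y)))) => h.
by apply: lerXn2r => //; rewrite nnegrE// (le_trans _ h).
Qed.

(** By coercivity the difference of two solutions is a null vector of [mixed_ip], so its velocity
    and its vorticity vanish almost everywhere. *)
Lemma unique_solution_of_exists Xs Zs f p us : space_pair Xs Zs ->
  admissible Omega Gam Sig f p us ->
  (exists2 x, mixed_space Xs Zs x &
     forall y, mixed_space Xs Zs y -> B x y = load f p us (S y)) ->
  unique_solution Omega nu sigma beta Xs Zs f p us.
Proof.
move=> P adm [x Wx hx]; exists x.1.1, x.1.2; split.
  by apply/(solutionP P adm Wx)/(stable_formP f p us x P).
move=> u w sol; have [x' [Wx' uE wE hx']] := solution_stable P adm sol; rewrite -uE -wE {uE wE sol}.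
have Wd : mixed_space Xs Zs (x' - x) by apply: (subspaceB (mixed_space_subspace P)).
have d0 : ip (x' - x) (x' - x) = 0.
  have : B (x' - x) (x' - x) = 0.
    by rewrite stable_formBl hx// hx'// subrr.
  have := stable_form_coercive qS nu0 sigma0 cross_beta_le (x' - x) => + E.
  rewrite E pmulr_rle0 ?mixed_alpha_gt0// => le0.
  by apply/eqP; rewrite eq_le le0 (ip_ge0 ipS).
have [d1 d2] := mixed_ip_eq0 qS nu0 d0.
split; apply: ae_subr0.
- exact: (l2dot_eq0 (L2spP (x' - x).1.1) d1).
- exact: (l2dot_eq0 (L2spP (x' - x).1.2) d2).
Qed.

Lemma normH_spaceX v : X v -> normH Omega v = norm2v Omega v.
Proof.
move=> [[Hv _] d0]; have [g2 _] := wdivP Hv.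
rewrite /normH /normHdiv (_ : norm2 Omega _ = 0) ?expr0n ?addr0 ?sqrtr_sqr ?ger0_norm ?norm2v_ge0//.
rewrite norm2E// (_ : integ _ _ = 0) ?sqrtr0//.
rewrite -[RHS](integ0 Omega); apply: integ_ae.
- by under eq_fun do rewrite expr2; exact: L2_mul.
- by apply: (L2_L1 oO bO); exact: L2_0.
- by apply: aeS d0 => x h Ox; rewrite h// expr0n.
Qed.

Lemma normH_mixed (x : V) : mixed_space X Z x -> normH Omega x.1.1 = Num.sqrt (q x.1.1 x.1.1).
Proof. by move=> [Xx _ _]; rewrite normH_spaceX// norm2vE//; exact: L2spP. Qed.

Lemma normZ_mixed (x : V) : mixed_space X Z x ->
  normZ Omega nu x.1.2 = Num.sqrt (q x.1.2 x.1.2 + nu * q x.2 x.2).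
Proof.
move=> Wx; have [_ Zx _] := Wx; rewrite /normZ.
rewrite (norm2v_ae (wcurl_L2v Zx) (L2spP x.2) (mixed_wcurl continuous_pair Wx)).
by rewrite !norm2v_l2sp.
Qed.

(** For the squares [a] and [b] of the two norms, [sqrt (a + b) <= sqrt a + sqrt b <= 2 sqrt (a +
    b)]. This is the origin of the factor 2 in the final constants. *)
Lemma mixed_norm_equiv (x : V) : mixed_space X Z x ->
  ipn (ip := ip) x <= normH Omega x.1.1 + normZ Omega nu x.1.2 <= 2 * ipn (ip := ip) x.
Proof.
move=> Wx; rewrite (normH_mixed Wx) (normZ_mixed Wx) /ipn /mixed_ip -addrA.
set a := q _ _; set b := q _ _ + _.
have a0 : 0 <= a by exact: q_ge0.
have b0 : 0 <= b by rewrite addr_ge0 ?q_ge0// mulr_ge0 ?q_ge0// ltW.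
have ra := sqrtr_ge0 a; have rb := sqrtr_ge0 b.
apply/andP; split.
  rewrite -[leRHS]ger0_norm ?addr_ge0// -sqrtr_sqr; apply: ler_wsqrtr.
  rewrite sqrrD !sqr_sqrtr//.
  by have := mulr_ge0 ra rb; rewrite mulr2n; lra.
rewrite mulrDl mul1r; apply: lerD; apply: ler_wsqrtr; lra.
Qed.

Lemma continuous_solvable f p us : admissible Omega Gam Sig f p us ->
  exists2 x, mixed_space X Z x &
    forall y, mixed_space X Z y -> B x y = load f p us (S y).
Proof.
move=> adm; have [M ell] := stable_form_elliptic qS nu0 sigma0 cross_beta_lin cross_beta_le.
exact: (lax_milgram ipS (mixed_space_subspace continuous_pair) mixed_space_complete ell
  (load_shift_lin continuous_pair adm) (load_shift_bounded continuous_pair adm)).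
Qed.

(** Norm equivalence, bound of the load, norm of the shift and coercivity, in this order; only [nu]
    and [sigma] enter. *)
Definition stability_cst : R := 2 * (load_cst * Num.sqrt shift_cst / alpha).

Lemma load_cst_gt0 : 0 < load_cst.
Proof. by rewrite ltr_wpDr// mulr_ge0// sqrtr_ge0. Qed.

Lemma stability_cst_gt0 : 0 < stability_cst.
Proof.
rewrite mulr_gt0// divr_gt0 ?mixed_alpha_gt0// mulr_gt0 ?load_cst_gt0// sqrtr_gt0.
by rewrite ltr_pwDl// mulr_ge0// sqr_ge0.
Qed.

Lemma mixed_stability Xs Zs f p us (x : V) : space_pair Xs Zs ->
  admissible Omega Gam Sig f p us -> mixed_space Xs Zs x ->
  (forall y, mixed_space Xs Zs y -> B x y = load f p us (S y)) ->
  normH Omega x.1.1 + normZ Omega nu x.1.2 <= stability_cst * data_norm f p us.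
Proof.
move=> P adm Wx hx; have /andP[_ h] := mixed_norm_equiv (mixed_space_sub P Wx).
apply: le_trans h _; rewrite /stability_cst -!mulrA ler_pM2l//.
have a0 := mixed_alpha_gt0 sigma0.
have -> : load_cst * (Num.sqrt shift_cst * (alpha^-1 * data_norm f p us)) =
  (load_cst * data_norm f p us * Num.sqrt shift_cst) / alpha by ring.
apply: le_of_sqr_le => //; last 2 first.
- exact: ipn_ge0.
- rewrite (ipn_sqr ipS); apply: le_trans (load_shift_le P adm Wx).
  apply: le_trans (stable_form_coercive qS nu0 sigma0 cross_beta_le x) _.
  by rewrite hx// ler_norm.
- by rewrite mulr_ge0 ?sqrtr_ge0// mulr_ge0 ?data_norm_ge0// ltW// load_cst_gt0.
Qed.

(** The constant precedes the quantifier over the pair of spaces, so one value serves all meshes.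
    Galerkin orthogonality holds because discrete test triples are also continuous ones. *)
Lemma mixed_cea : exists2 C : R, 0 < C & forall Xs Zs f p us (x xh z : V),
  space_pair Xs Zs -> admissible Omega Gam Sig f p us ->
  mixed_space X Z x -> (forall y, mixed_space X Z y -> B x y = load f p us (S y)) ->
  mixed_space Xs Zs xh ->
  (forall y, mixed_space Xs Zs y -> B xh y = load f p us (S y)) ->
  mixed_space Xs Zs z ->
  normH Omega (x - xh).1.1 + normZ Omega nu (x - xh).1.2 <=
  C * (normH Omega (x - z).1.1 + normZ Omega nu (x - z).1.2).
Proof.
have [M ell] := stable_form_elliptic qS nu0 sigma0 cross_beta_lin cross_beta_le.
have a0 := mixed_alpha_gt0 sigma0.
exists (2 * (1 + Num.sqrt M / alpha)).
  by rewrite mulr_gt0// ltr_wpDr// divr_ge0 ?sqrtr_ge0// ltW.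
move=> Xs Zs f p us x xh z P adm Wx hx Wxh hxh Wz.
have Ws := mixed_space_subspace continuous_pair.
have Wxh' := mixed_space_sub P Wxh; have Wz' := mixed_space_sub P Wz.
have /andP[_ h1] := mixed_norm_equiv (subspaceB Ws Wx Wxh').
have /andP[h2 _] := mixed_norm_equiv (subspaceB Ws Wx Wz').
apply: le_trans h1 _; rewrite -mulrA ler_pM2l//.
have c0 : 0 <= 1 + Num.sqrt M / alpha by rewrite addr_ge0// divr_ge0 ?sqrtr_ge0// ltW.
apply: le_trans (ler_wpM2l c0 h2).
have Wd : mixed_space Xs Zs (xh - z) by apply: (subspaceB (mixed_space_subspace P)).
apply: (cea ipS ell).
by rewrite stable_formBl hx ?hxh ?subrr//; exact: (mixed_space_sub P).
Qed.

Lemma piecewise_subspace (Loc : (E3 R -> E3 R) -> Prop) (Ts : set (set (E3 R))) :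
  subspace_set (Loc : set (E3 R -> E3 R)) ->
  subspace_set (piecewise Loc Ts : set (E3 R -> E3 R)).
Proof.
move=> [L0 LP]; split=> [T TT|a u v pu pv T TT].
  by exists (0 : E3 R -> E3 R) => //; exact: aeW.
have [qu Lu eu] := pu T TT; have [qv Lv ev] := pv T TT.
exists (a *: qu + qv); first exact: LP.
apply: aeS2 eu ev => x hu hv Tx.
have lE (f g : E3 R -> E3 R) : (a *: f + g) x = a *: f x + g x by [].
by rewrite !lE hu// hv.
Qed.

(** * The discrete spaces *)

Section Discrete.
Variables (k : nat) (Ts : set (set (E3 R))).
Hypotheses (lO : lipschitz_boundary Omega) (cover : tetrahedral_cover Omega Ts).

Local Notation Xh := (spaceXh Omega Gam k Ts).
Local Notation Zh := (spaceZh Omega Gam k Ts).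

Lemma discrete_curl th w : Z th -> is_wcurl Omega th w -> piecewise (nedelec k) Ts th ->
  piecewise (raviart_thomas k) Ts w.
Proof.
move=> Zt cw pt T TT; have [q' nq e] := pt T TT; have [_ tet clE] := cover.
exists (curl q'); first exact: curl_nedelec.
apply: (curl_nedelec_piecewise oO bO lO (tet _ TT) _ (spaceZ_L2v Zt) cw nq e).
by rewrite clE; exact: bigcup_sup.
Qed.

Lemma spaceXhP v : Xh v <-> X v /\ piecewise (raviart_thomas k) Ts v.
Proof. by split=> [[[Hv pv] dv]|[[Hv dv] pv]]. Qed.

Lemma discrete_pair : space_pair Xh Zh.
Proof.
have pRT := piecewise_subspace Ts
  (conj (@raviart_thomas0 R k) (fun a => @raviart_thomas_lin R k a)).
have pN := piecewise_subspace Ts (conj (@nedelec0 R k) (fun a => @nedelec_lin R k a)).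
split.
- by move=> v /spaceXhP[].
- by move=> th [].
- split=> [|a u v /spaceXhP[Xu pu] /spaceXhP[Xv pv]]; apply/spaceXhP.
    by split; [case: spaceX_subspace|case: pRT].
  by split; [apply: spaceX_subspace.2|apply: pRT.2].
- split=> [|a u v [Zu pu] [Zv pv]].
    by split; [case: spaceZ_subspace|case: pN].
  by split; [apply: spaceZ_subspace.2|apply: pN.2].
- move=> th w [Zt pt] cw; apply/spaceXhP; split.
    exact: curl_spaceX cw.
  exact: discrete_curl cw pt.
Qed.

Lemma discrete_solvable f p us : admissible Omega Gam Sig f p us ->
  exists2 x, mixed_space Xh Zh x &
    forall y, mixed_space Xh Zh y -> B x y = load f p us (S y).
Proof.
move=> adm; have [M ell] := stable_form_elliptic qS nu0 sigma0 cross_beta_lin cross_beta_le.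
have [/finite_seqP[ts tsE] _ clE] := cover.
(* Only velocity and vorticity receive coordinates: the weak curl of a vorticity vanishing almost
   everywhere vanishes too. Degree [k.+1] in each variable accommodates both local spaces. *)
pose F (x : V) (b : bool) : E3 R -> E3 R := if b then l2val x.1.2 else l2val x.1.1.
apply: (galerkin ipS (mixed_space_subspace discrete_pair) ell
  (load_shift_lin discrete_pair adm) (load_shift_bounded discrete_pair adm)
  (I := coefs ts k.+1) (rep := fun x => represents (F x))); split.
- move=> x [/spaceXhP[_ pu] [_ pw] _]; apply: represents_exists => T sT.
  have TT : Ts T by rewrite tsE.
  move=> [|]; [have [q' nq e] := pw T TT|have [q' nq e] := pu T TT]; exists q' => //.
    exact: nedelec_box.
  exact: raviart_thomas_box.
- move=> a x y c d _ _ hc hd.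
  have -> : F (a *: x + y) = (fun b => a *: F x b + F y b) by apply/funext => -[].
  exact: represents_lin.
- move=> i b j; have -> : F 0 b = 0 by rewrite /F; case: b.
  by apply: aeW => x _; rewrite monomial_sum0 /dot !mulr0 !addr0.
- move=> x Wx hx.
  have Os : Omega `<=` \bigcup_(T in [set` ts]) T.
    by rewrite -tsE -clE; exact: subset_closure.
  have u0 := represents0 Os hx false; have w0 := represents0 Os hx true.
  have z2 := L2v0 Omega.
  have [_ Zx cx] := mixed_space_sub discrete_pair Wx.
  have g0 := is_wcurl_unique oO bO cx (is_wcurl_ae0 (L2spP x.1.2) w0).
  have z (u : H) : l2val u = cst 0 %[ae leb3 in Omega] -> q u u = 0.
    by move=> h; rewrite /l2ip (l2dot_ae (L2spP u) z2 (L2spP u) h) l2dot0l.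
  by rewrite /mixed_ip (z _ u0) (z _ w0) (z _ g0) mulr0 !addr0.
Qed.

End Discrete.

End Assembly.

Theorem theorem3p1 (R : realType) (Omega Gam Sig : set (E3 R)) (nu sigma : R)
    (beta : E3 R -> E3 R) (hs : set R) (Th : R -> set (set (E3 R))) (k : nat)
    (Omega_dom : polyhedral_lipschitz_domain Omega)
    (partition_GamSig : boundary_partition Omega Gam Sig)
    (nu_gt0 : 0 < nu) (sigma_gt0 : 0 < sigma)
    (beta_Linf : Linfv Omega beta)
    (beta_small : 2 * norm_infv Omega beta ^+ 2 / (nu * sigma) < 1)
    (Th_mesh : mesh_family Omega Gam Sig hs Th) :
  let X := spaceX Omega Gam in
  let Z := spaceZ Omega Gam in
  let Xh h := spaceXh Omega Gam k (Th h) in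
  let Zh h := spaceZh Omega Gam k (Th h) in
  (forall f p us, admissible Omega Gam Sig f p us ->
     unique_solution Omega nu sigma beta X Z f p us /\
     forall h, hs h ->
       unique_solution Omega nu sigma beta (Xh h) (Zh h) f p us) /\
  exists C1 C2 : R, [/\ 0 < C1, 0 < C2 &
    forall f p us, admissible Omega Gam Sig f p us ->
    forall h, hs h ->
    forall uh wh, solution Omega nu sigma beta (Xh h) (Zh h) f p us uh wh ->
      normH Omega uh + normZ Omega nu wh
        <= C1 * (norm2v Omega f + norm12 Omega p + norm_datum Omega Gam us) /\
      forall u w, solution Omega nu sigma beta X Z f p us u w ->
        normH Omega (u \- uh) + normZ Omega nu (w \- wh)
          <= C2 * best_error Omega nu (Xh h) (Zh h) u w].
Proof.
have [[oO _ _] bO _ lO] := Omega_dom.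
move=> X Z Xh Zh.
have P : space_pair Omega Gam X Z by exact: continuous_pair.
have Ph h : hs h -> space_pair Omega Gam (Xh h) (Zh h).
  by move=> hh; have [_ _ cov _ _] := Th_mesh.1 h hh; exact: discrete_pair.
split=> [f p us adm|].
  split=> [|h hh].
    apply: (unique_solution_of_exists oO bO partition_GamSig nu_gt0 sigma_gt0
      beta_small P adm).
    exact: (continuous_solvable oO bO partition_GamSig nu_gt0 sigma_gt0 beta_Linf beta_small adm).
  have [_ _ cov _ _] := Th_mesh.1 h hh.
  apply: (unique_solution_of_exists oO bO partition_GamSig nu_gt0 sigma_gt0
    beta_small (Ph h hh) adm).
  exact: (discrete_solvable oO bO partition_GamSig nu_gt0 sigma_gt0 beta_Linf
    beta_small k lO cov adm).
have [C2 C20 cea2] := @mixed_cea R Omega Gam Sig nu sigma beta oO bO nu_gt0 sigma_gt0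
  beta_Linf beta_small.
exists (stability_cst nu sigma), C2; split => //; first exact: stability_cst_gt0.
move=> f p us adm h hh uh wh solh.
have [xh [Wxh uhE whE hxh]] :=
  solution_stable oO bO partition_GamSig beta_Linf (Ph h hh) adm solh.
split.
  rewrite -uhE -whE.
  exact: (mixed_stability oO bO partition_GamSig nu_gt0 sigma_gt0 beta_small (Ph h hh) adm Wxh hxh).
move=> u w sol.
have [x [Wx uE wE hx]] := solution_stable oO bO partition_GamSig beta_Linf P adm sol.
(* Divided by [C2], the error is a lower bound of the set whose infimum is [best_error]; that set is
   nonempty because [(uh, wh)] is itself a competitor. *)
rewrite -ler_pdivrMl//; apply: lb_le_inf.
  have [Xuh Zwh _ _] := solh.
  by exists (normH Omega (u \- uh) + normZ Omega nu (w \- wh)), (uh, wh).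
move=> _ [[v th] [/= Xv Zth] <-]; rewrite ler_pdivrMl//.
have Xv' := space_pair_subX (Ph h hh) Xv; have Zth' := space_pair_subZ (Ph h hh) Zth.
pose z := (mkL2 (spaceX_L2v Xv'), mkL2 (spaceZ_L2v Zth'), mkL2 (wcurl_L2v Zth')).
have Wz : mixed_space (Xh h) (Zh h) z by split => //; exact: (spaceZ_wcurl Zth').
have := cea2 _ _ _ _ _ x xh z (Ph h hh) adm Wx hx Wxh hxh Wz.
by rewrite -uE -wE -uhE -whE.
Qed.
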